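(* (Unbounded) C2E \textsc{Nondeterministic Constraint Logic}, (unbounded) C2C \textsc{Nondeterministic Constraint Logic}, and bounded C2E \textsc{Nondeterministic Constraint Logic} are $\mathsf{W}[1]$-hard when parameterized by the solution length $l$.
   Context: A constraint graph is an undirected graph with a positive integer weight on every edge and a nonnegative integer weight (its minimum inflow) on every vertex. A legal configuration is an assignment of an orientation to every edge such that for every vertex, the total weight of the edges oriented into that vertex is at least that vertex's minimum inflow. A reconfiguration sequence is a sequence of legal configurations in which each configuration is obtained from the previous one by reversing exactly one edge; its length is the number of edge reversals; it is bounded if every edge is reversed at most once. C2C NCL: given a constraint graph $G$ and legal configurations $C_1,C_2$, is there a reconfiguration sequence from $C_1$ to $C_2$? C2E NCL: given $G$, a target edge $e$ and a legal configuration $C_1$, is there a reconfiguration sequence starting at $C_1$ that eventually reverses $e$? The bounded variants require the sequence to be bounded. In the parameterized versions, an integer $l$ is additionally given and the question is whether such a sequence of length at most $l$ exists; $l$ is the parameter. *)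

(* Defs.v *)
From mathcomp Require Import all_boot.
Set Implicit Arguments.
Unset Strict Implicit.
Unset Printing Implicit Defensive.

(** * Computation model

    A unit-cost random access machine over the natural numbers, as in
    Papadimitriou, Computational Complexity, section 2.6, or Flum-Grohe,
    Parameterized Complexity Theory.  There is no multiplication, so the bit
    length of a value grows by O(1) per step and the model is polynomially
    equivalent to Turing machines.  A result is written by appending to an
    output stream, so its length is bounded by the number of steps. *)

Inductive instr : Type :=
| Const of nat & nat          (* Const d c   : R[d] := c                  *)
| Add of nat & nat & nat      (* Add d a b   : R[d] := R[a] + R[b]        *)
| Sub of nat & nat & nat      (* Sub d a b   : R[d] := R[a] - R[b]        *)
| Half of nat & nat           (* Half d a    : R[d] := R[a] / 2           *)
| Fetch of nat & nat          (* Fetch d a   : R[d] := M[R[a]]            *)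
| Store of nat & nat          (* Store a b   : M[R[a]] := R[b]            *)
| Emit of nat                 (* Emit a      : append R[a] to the output  *)
| JumpZ of nat & nat.         (* JumpZ a l   : if R[a] = 0 then goto l    *)

Definition program := seq instr.

Record state := State {
  pc : nat;
  reg : nat -> nat;
  mem : nat -> nat;
  out : seq nat
}.

Definition upd (h : nat -> nat) (a v : nat) : nat -> nat :=
  fun b => if b == a then v else h b.

Definition exec (i : instr) (s : state) : state :=
  let: State pc r m o := s in
  match i with
  | Const d c => State pc.+1 (upd r d c) m o
  | Add d a b => State pc.+1 (upd r d (r a + r b)) m o
  | Sub d a b => State pc.+1 (upd r d (r a - r b)) m o
  | Half d a => State pc.+1 (upd r d (r a)./2) m o
  | Fetch d a => State pc.+1 (upd r d (m (r a))) m o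
  | Store a b => State pc.+1 r (upd m (r a) (r b)) o
  | Emit a => State pc.+1 r m (rcons o (r a))
  | JumpZ a l => State (if r a == 0 then l else pc.+1) r m o
  end.

Definition halted (p : program) (s : state) : bool := size p <= pc s.

Definition step (p : program) (s : state) : state :=
  if halted p s then s else exec (nth (Const 0 0) p (pc s)) s.

(* The parameter is in R[0], the length of the word in R[1], and the word
   itself in the first memory cells. *)
Definition init (x : seq nat) (k : nat) : state :=
  State 0 (upd (upd (fun _ => 0) 1 (size x)) 0 k) (nth 0 x) [::].

(* On input (x, k), p halts after at most t steps with output (x', k'). *)
Definition computes (p : program) (x : seq nat) (k t : nat)
    (x' : seq nat) (k' : nat) : Prop :=
  let s := iter t (step p) (init x k) in
  [/\ halted p s, out s = x' & reg s 0 = k'].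

Definition computable (f : nat -> nat) : Prop :=
  exists p, forall k, exists t x', computes p [::] k t x' (f k).

(** * Parameterized complexity *)

(* A set of pairs (x, k) where x is a word over nat, with numbers measured by
   their binary length, and k is the parameter. *)
Definition pproblem := seq nat -> nat -> Prop.

Definition bitlen (n : nat) : nat := (trunc_log 2 n).+1.

Definition isize (x : seq nat) : nat := \sum_(n <- x) bitlen n.

(* Many-one fpt-reductions.  As usual, the computable bounds f and g are taken
   to be nondecreasing, which is no restriction. *)
Definition fpt_reduces (P Q : pproblem) : Prop :=
  exists (p : program) (f g : nat -> nat) (c : nat),
    [/\ computable f /\ {homo f : m n / m <= n},
        computable g /\ {homo g : m n / m <= n} &
        forall x k, exists t x' k',
          [/\ computes p x k t x' k',
              t <= f k * (isize x).+1 ^ c,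
              k' <= g k &
              P x k <-> Q x' k']].

(* Boolean circuits as lists of nodes in topological order: the arguments of
   a node are positions of earlier nodes, and the last node is the output. *)
Inductive gate : Type :=
| GIn
| GNot of nat
| GAnd of seq nat
| GOr of seq nat.

Definition circuit := seq gate.

Definition gate_args (g : gate) : seq nat :=
  match g with GIn => [::] | GNot i => [:: i] | GAnd a | GOr a => a end.

Definition gate_wf (g : gate) : bool :=
  match g with GAnd a | GOr a => (2 <= size a) && uniq a | _ => true end.

Definition circuit_wf (C : circuit) : Prop :=
  0 < size C /\
  forall i, i < size C ->
    gate_wf (nth GIn C i) /\ all (fun j => j < i) (gate_args (nth GIn C i)).

(* The list of values of all nodes, where f computes the value of a node from
   the values of the earlier ones. *)
Definition scan_gates (T : Type) (f : seq T -> gate -> T) (C : circuit) : seq T :=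
  foldl (fun vs g => rcons vs (f vs g)) [::] C.

(* The value of the output node when the inputs in S are set to true. *)
Definition circuit_eval (C : circuit) (S : pred nat) : bool :=
  last false (scan_gates (fun vs g =>
    match g with
    | GIn => S (size vs)
    | GNot i => ~~ nth false vs i
    | GAnd a => all (nth false vs) a
    | GOr a => has (nth false vs) a
    end) C).

(* Maximum length of a path from an input to the output. *)
Definition depth (C : circuit) : nat :=
  last 0 (scan_gates (fun ds g =>
    match g with
    | GIn => 0
    | _ => (\max_(i <- gate_args g) nth 0 ds i).+1
    end) C).

(* Maximum number of large nodes (fan-in more than 2) on such a path. *)
Definition weft (C : circuit) : nat :=
  last 0 (scan_gates (fun ws g =>
    (2 < size (gate_args g)) + \max_(i <- gate_args g) nth 0 ws i) C).

Definition is_input (C : circuit) (i : nat) : bool :=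
  if nth (GNot 0) C i is GIn then true else false.

Definition encode_gate (g : gate) : seq nat :=
  match g with
  | GIn => [:: 0]
  | GNot i => [:: 1; i]
  | GAnd a => [:: 2, size a & a]
  | GOr a => [:: 3, size a & a]
  end.

Definition encode_circuit (C : circuit) : seq nat :=
  size C :: flatten [seq encode_gate g | g <- C].

(* Weighted circuit satisfiability for circuits of weft at most t and depth
   at most d: is there a satisfying assignment of weight exactly k? *)
Definition WCS (t d : nat) : pproblem := fun x k =>
  exists C : circuit,
    [/\ circuit_wf C, weft C <= t, depth C <= d, x = encode_circuit C &
        exists S : {set 'I_(size C)},
          [/\ forall i, i \in S -> is_input C i,
              #|S| = k &
              circuit_eval C (fun j => j \in [seq val i | i in S])]].

Definition in_W (t : nat) (P : pproblem) : Prop :=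
  exists d, fpt_reduces P (WCS t d).

Definition W_hard (t : nat) (Q : pproblem) : Prop :=
  forall P, in_W t P -> fpt_reduces P Q.

(** * Nondeterministic constraint logic *)

(* end1 and end2 list the two endpoints of an edge in an arbitrary order. *)
Record cgraph := CGraph {
  nv : nat;
  ne : nat;
  end1 : 'I_ne -> 'I_nv;
  end2 : 'I_ne -> 'I_nv;
  weight : 'I_ne -> nat;
  inflow : 'I_nv -> nat
}.

(* Positive edge weights on a simple graph. *)
Definition cgraph_wf (G : cgraph) : Prop :=
  [/\ forall e : 'I_(ne G), 0 < weight e,
      forall e : 'I_(ne G), end1 e != end2 e &
      injective (fun e : 'I_(ne G) => [set end1 e; end2 e])].

(* An orientation; C e tells that e is oriented into end2 e. *)
Definition config (G : cgraph) := {ffun 'I_(ne G) -> bool}.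

Definition head_of (G : cgraph) (C : config G) (e : 'I_(ne G)) : 'I_(nv G) :=
  if C e then end2 e else end1 e.

Definition legal (G : cgraph) (C : config G) : bool :=
  [forall v, inflow v <= \sum_(e | head_of C e == v) weight e].

Definition reversal (G : cgraph) (C C' : config G) : bool :=
  #|[set e | C e != C' e]| == 1.

(* C :: s is a reconfiguration sequence; its length is size s. *)
Definition reconf (G : cgraph) (C : config G) (s : seq (config G)) : bool :=
  all (@legal G) (C :: s) && path (@reversal G) C s.

Definition times_reversed (G : cgraph) (C : config G) (s : seq (config G))
    (e : 'I_(ne G)) : nat :=
  count id (pairmap (fun D D' : config G => D e != D' e) C s).

Definition bounded (G : cgraph) (C : config G) (s : seq (config G)) : Prop :=
  forall e, times_reversed C s e <= 1.

Definition encode_cgraph (G : cgraph) : seq nat :=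
  [:: nv G; ne G]
  ++ [seq inflow v | v <- enum 'I_(nv G)]
  ++ flatten [seq [:: val (end1 e); val (end2 e); weight e]
             | e <- enum 'I_(ne G)].

Definition encode_config (G : cgraph) (C : config G) : seq nat :=
  [seq nat_of_bool (C e) | e <- enum 'I_(ne G)].

Definition C2C_NCL : pproblem := fun x l =>
  exists (G : cgraph) (C1 C2 : config G),
    [/\ cgraph_wf G, legal C1, legal C2,
        x = encode_cgraph G ++ encode_config C1 ++ encode_config C2 &
        exists s, [/\ reconf C1 s, last C1 s = C2 & size s <= l]].

Definition C2E_NCL : pproblem := fun x l =>
  exists (G : cgraph) (e : 'I_(ne G)) (C1 : config G),
    [/\ cgraph_wf G, legal C1,
        x = encode_cgraph G ++ val e :: encode_config C1 &
        exists s, [/\ reconf C1 s, 0 < times_reversed C1 s e & size s <= l]].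

Definition bounded_C2E_NCL : pproblem := fun x l =>
  exists (G : cgraph) (e : 'I_(ne G)) (C1 : config G),
    [/\ cgraph_wf G, legal C1,
        x = encode_cgraph G ++ val e :: encode_config C1 &
        exists s, [/\ reconf C1 s, bounded C1 s, 0 < times_reversed C1 s e
                    & size s <= l]].

(* Main.v *)
Require Import Defs.
From mathcomp Require Import all_boot.
From mathcomp Require Import zify.
From Stdlib Require Import FunctionalExtensionality.

(* A circuit of weft 1 and depth d unfolds from its output to a binary tree with
   q = 2 ^ L leaves, L depending only on d, each leaf being an input or a gate of
   large arity all of whose descendants have small arity.  The number of true
   arguments of a leaf is then a polynomial of degree at most q in the inputs, so
   by Moebius inversion it is a sum, over the sets of at most q of the k chosen
   inputs, of terms that depend only on that set.  Choosing one item for every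
   q-tuple of slots and one item for the q leaf values turns "some k inputs satisfy
   the circuit" into an exact subset sum problem on vectors of nonnegative
   integers, in which both the dimension and the number of chosen items depend on
   k alone.

   In the constraint graph, reversing the edge of an item lets the pool vertex lose
   the row sum of the item, which is distributed over the column vertices.  The
   pool can lose at most the sum of the targets and reversing the goal edge requires
   every column to gain at least its target, hence exactly its target.  For C2C, a
   triangle that can be turned only while the goal edge is reversed remembers that
   this has happened.

   The given reduction to weighted circuit satisfiability, an arbitrary RAM program,
   is simulated inside a structured program, and the rest of the reduction is
   written in a language whose loops are capped so that every program runs in fpt
   time. *)

Set Implicit Arguments.
Unset Strict Implicit.
Unset Printing Implicit Defensive.

(** * Structured programs *)

(** The class is defined by weighted satisfiability of circuits of weft one, so the reduction starts
    from the circuits themselves, for every depth bound [d]. The obstacle is that the length of a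
    reconfiguration sequence, hence the number of chosen items and of columns, may depend on [k]
    only, while a large gate may have as many arguments as the circuit has nodes. Such a gate is
    therefore not evaluated argument by argument: the number of its true arguments is added up over
    tuples of slots, and the circuit enters only through the weights and through the choice among
    [n.+1 ^ q] items per row. Moebius differences have both signs, so an offset makes the weights
    nonnegative; an unknown that has to be subtracted enters as its complement to [n]. Vertices
    impose lower bounds only, and equality results from two opposite bounds, the slack of the pool
    and the demands of the columns. Since the problems ask whether some graph has the given word as
    its code, the encodings must also be shown injective, and malformed words must be recognised. *)

Inductive cmd : Type :=
| CSkip
| CI of instr
| CSeq of cmd & cmd
| CIf of nat & cmd & cmd
| CWhile of nat & cmd.

Fixpoint csize (c : cmd) : nat :=
  match c with
  | CSkip => 0
  | CI _ => 1
  | CSeq c1 c2 => csize c1 + csize c2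
  | CIf _ c1 c2 => csize c1 + csize c2 + 2
  | CWhile _ c => csize c + 2
  end.

(* Register 2 is kept equal to 0, so that JumpZ 2 is an unconditional jump. *)
Fixpoint code (c : cmd) (off : nat) : program :=
  match c with
  | CSkip => [::]
  | CI i => [:: i]
  | CSeq c1 c2 => code c1 off ++ code c2 (off + csize c1)
  | CIf r c1 c2 =>
      JumpZ r (off + csize c1 + 2) ::
      code c1 off.+1 ++
      JumpZ 2 (off + csize c1 + csize c2 + 2) :: code c2 (off + csize c1 + 2)
  | CWhile r c =>
      JumpZ r (off + csize c + 2) :: rcons (code c off.+1) (JumpZ 2 off)
  end.

Lemma size_code c off : size (code c off) = csize c.
Proof.
elim: c off => //= [c1 IH1 c2 IH2|r c1 IH1 c2 IH2|r c IH] off.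
- by rewrite size_cat IH1 IH2.
- by rewrite size_cat /= IH1 IH2; lia.
- by rewrite size_rcons IH; lia.
Qed.

Record mst := Mst { mr : nat -> nat; mm : nat -> nat; mo : seq nat }.

Definition st (off : nat) (s : mst) : state := State off (mr s) (mm s) (mo s).

Definition drop_pc (s : state) : mst := Mst (reg s) (Defs.mem s) (out s).

Definition exec_m (i : instr) (s : mst) : mst := drop_pc (exec i (st 0 s)).

Definition plain (i : instr) : bool :=
  match i with
  | Const d _ | Add d _ _ | Defs.Sub d _ _ | Half d _ | Fetch d _ => d != 2
  | Store _ _ | Emit _ => true
  | JumpZ _ _ => false
  end.

Definition code_at (p : program) (off : nat) (l : program) : Prop :=
  exists p1 p2, p = p1 ++ l ++ p2 /\ size p1 = off.

Lemma code_at_cat p off l1 l2 :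
  code_at p off (l1 ++ l2) ->
  code_at p off l1 /\ code_at p (off + size l1) l2.
Proof.
move=> [p1 [p2 [-> <-]]]; split; first by exists p1, (l2 ++ p2); rewrite -catA.
by exists (p1 ++ l1), p2; rewrite size_cat -!catA.
Qed.

Lemma code_at_cons p off i l : code_at p off (i :: l) -> code_at p off.+1 l.
Proof. by rewrite -cat1s => /code_at_cat[_]; rewrite addn1. Qed.

Lemma step_at p off i l s :
  code_at p off (i :: l) -> step p (st off s) = exec i (st off s).
Proof.
move=> [p1 [p2 [-> <-]]]; rewrite /step /halted /= !size_cat /=.
rewrite ifF; last by lia.
by rewrite nth_cat ltnn subnn.
Qed.

(* c, started in s, ends within N steps in a state satisfying Q. *)
Definition wp (c : cmd) (N : nat) (Q : mst -> Prop) (s : mst) : Prop :=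
  mr s 2 = 0 ->
  exists n s', [/\ n <= N, Q s', mr s' 2 = 0 &
    forall p off, code_at p off (code c off) ->
      iter n (step p) (st off s) = st (off + csize c) s'].

Lemma wp_conseq c N N' (Q Q' : mst -> Prop) s :
  wp c N Q s -> N <= N' -> (forall s', Q s' -> Q' s') -> wp c N' Q' s.
Proof.
move=> H NN QQ s2; have [n [s' [nN Qs' s'2 Hs']]] := H s2.
by exists n, s'; split=> //; [exact: leq_trans nN NN | exact: QQ].
Qed.

Lemma wp_skip Q s : Q s -> wp CSkip 0 Q s.
Proof. by move=> Qs s2; exists 0, s; split=> // p off _; rewrite addn0. Qed.

Lemma wp_instr i (Q : mst -> Prop) s :
  plain i -> Q (exec_m i s) -> wp (CI i) 1 Q s.
Proof.
move=> pl Qs s2; exists 1, (exec_m i s); split=> //.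
  by case: i pl {Qs} => //= [d c|d a b|d a b|d a|d a] d2;
    rewrite /upd eq_sym (negPf d2).
move=> p off pat; rewrite [LHS]/= (step_at _ pat) addn1.
by case: i pl {Qs pat} => //=.
Qed.

Lemma wp_seq c1 c2 N1 N2 (Q : mst -> Prop) s :
  wp c1 N1 (wp c2 N2 Q) s -> wp (CSeq c1 c2) (N1 + N2) Q s.
Proof.
move=> H s2; have [n1 [s1 [le1 H1 s12 E1]]] := H s2.
have [n2 [s' [le2 Qs' s'2 E2]]] := H1 s12.
exists (n2 + n1), s'; split=> //; first by lia.
move=> p off /=/code_at_cat[at1 at2]; rewrite size_code in at2.
by rewrite iterD (E1 _ _ at1) (E2 _ _ at2) addnA.
Qed.

Lemma wp_if r c1 c2 N (Q : mst -> Prop) s :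
  (mr s r != 0 -> wp c1 N Q s) -> (mr s r = 0 -> wp c2 N Q s) ->
  wp (CIf r c1 c2) N.+2 Q s.
Proof.
move=> H1 H2 s2; case: (eqVneq (mr s r) 0) => rs.
  have [n [s' [le Qs' s'2 E]]] := H2 rs s2.
  exists n.+1, s'; split=> //; first by lia.
  move=> p off pat; rewrite iterSr (step_at _ pat) /= rs eqxx.
  move: pat => /code_at_cons/code_at_cat[_ /code_at_cons].
  rewrite size_code (_ : _.+1 = off + csize c1 + 2); last by lia.
  by move/E; rewrite /st => ->; congr State; lia.
have [n [s' [le Qs' s'2 E]]] := H1 rs s2.
exists n.+2, s'; split=> //.
move=> p off pat; rewrite (_ : n.+2 = 1 + (n + 1)); last by lia.
rewrite !iterD [iter 1 _ (st off s)]/= (step_at _ pat) /= (negPf rs).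
move: pat => /code_at_cons/code_at_cat[/E]; rewrite /st /= => -> pat.
rewrite size_code in pat; have := step_at s' pat.
rewrite /= /st /= => ->; rewrite s'2 eqxx; congr State; lia.
Qed.

(** The index of [Inv] is the number of rounds still to be made, so the invariant also fixes the
    number of rounds. A round costs the body and two jumps, the exit one more test. *)
Lemma wp_while (Inv : nat -> mst -> Prop) r c N (Q : mst -> Prop) m s :
  (forall m s, Inv m.+1 s -> mr s r != 0 /\ wp c N (Inv m) s) ->
  (forall s, Inv 0 s -> mr s r = 0 /\ Q s) ->
  Inv m s -> wp (CWhile r c) (m * N.+2).+1 Q s.
Proof.
move=> HS H0; elim: m s => [|m IH] s Is s2.
  have [r0 Qs] := H0 s Is.
  exists 1, s; split=> // p off /= pat; rewrite (step_at _ pat) /= r0 eqxx.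
  by congr State; lia.
have [r0 W] := HS _ _ Is.
have [n [s1 [le I1 s12 E]]] := W s2.
have [n1 [s' [le1 Qs' s'2 E1]]] := IH _ I1 s12.
exists (n1 + n.+2), s'; split=> //; first by lia.
move=> p off pat; rewrite (_ : n1 + n.+2 = n1 + (1 + (n + 1))); last by lia.
rewrite !iterD [iter 1 _ (st off s)]/= (step_at _ pat) /= (negPf r0).
move: (pat) => /code_at_cons; rewrite -cats1 => /code_at_cat[/E]; rewrite /st /= => -> patE.
rewrite size_code in patE; have := step_at s1 patE.
rewrite /= /st /= => ->; rewrite s12 eqxx.
by move/(_ p off): E1; rewrite /st => ->.
Qed.

Lemma wp_computes c N x k (Q : mst -> Prop) :
  wp c N Q (drop_pc (init x k)) ->
  exists t s, [/\ t <= N, Q s & computes (code c 0) x k t (mo s) (mr s 0)].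
Proof.
move=> /(_ erefl)[n [s [nN Qs _ E]]]; exists n, s; split=> //.
have /E : code_at (code c 0) 0 (code c 0) by exists [::], [::]; rewrite cats0.
rewrite /st /= /computes -/(init x k) => ->.
by split=> //=; rewrite /halted size_code.
Qed.

(** * Simulation of an arbitrary program inside a structured one *)

Definition run_block (l : seq instr) (s : mst) : mst :=
  foldl (fun s i => exec_m i s) s l.

Definition block (l : seq instr) : cmd := foldr (fun i c => CSeq (CI i) c) CSkip l.

Arguments block : simpl never.

(** Makes the standing assumption of [wp] available inside a proof; moves between registers are
    written as additions of register 2 and rely on it. *)
Lemma wp_zero c N (Q : mst -> Prop) s :
  (mr s 2 = 0 -> wp c N Q s) -> wp c N Q s.
Proof. by move=> H s2; exact: H. Qed.

Lemma wp_block l (Q : mst -> Prop) s :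
  all plain l -> Q (run_block l s) -> wp (block l) (size l) Q s.
Proof.
elim: l s => [|i l IH] s /=; first by move=> _; exact: wp_skip.
case/andP=> pi pl Qs; rewrite -add1n; apply: wp_seq.
by apply: wp_instr => //; apply: IH.
Qed.

Lemma updE h a v b : upd h a v b = if b == a then v else h b.
Proof. by []. Qed.

Lemma upd_same h a v : upd h a v a = v.
Proof. by rewrite /upd eqxx. Qed.

Lemma upd_other h a v b : b != a -> upd h a v b = h b.
Proof. by rewrite /upd => /negPf->. Qed.

Section Simulation.

(* The registers of the simulated program are moved to those of index at least
   10 and of the parity of e; its memory and its output stream are moved to the
   addresses congruent to j and to j' modulo 4.  Registers 3 and 6 hold the
   program counter and the length of the output. *)
Variables (e j j' : nat).
Hypotheses (e2 : e < 2) (j4 : j < 4) (j'4 : j' < 4) (jj' : j != j').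

Let phi i := i + i + (10 + e).

Definition sim_addr a : seq instr :=
  [:: Add 7 a a; Add 7 7 7; Const 8 j; Add 7 7 8].

Definition sim_incr : seq instr := [:: Const 8 1; Add 3 3 8].

Definition sim_instr (i : instr) : cmd :=
  match i with
  | Const d c => block (Const (phi d) c :: sim_incr)
  | Add d a b => block (Add (phi d) (phi a) (phi b) :: sim_incr)
  | Defs.Sub d a b => block (Defs.Sub (phi d) (phi a) (phi b) :: sim_incr)
  | Half d a => block (Half (phi d) (phi a) :: sim_incr)
  | Fetch d a => block (sim_addr (phi a) ++ Fetch (phi d) 7 :: sim_incr)
  | Store a b => block (sim_addr (phi a) ++ Store 7 (phi b) :: sim_incr)
  | Emit a => block ([:: Add 7 6 6; Add 7 7 7; Const 8 j'; Add 7 7 8;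
                        Store 7 (phi a); Const 8 1; Add 6 6 8] ++ sim_incr)
  | JumpZ a l => CIf (phi a) (block sim_incr) (block [:: Const 3 l])
  end.

(** The last three fields are a frame condition that lets a second program be simulated afterwards,
    on registers of the other parity and on two further residue classes. [sim_out] speaks of all
    addresses: the cells behind the output are zero, so the stored output can be read as an input
    word. *)
Record simulates (s0 : mst) (c : state) (s : mst) : Prop := Simulates {
  sim_pc : mr s 3 = pc c;
  sim_reg : forall i, mr s (phi i) = reg c i;
  sim_mem : forall a, mm s (a * 4 + j) = Defs.mem c a;
  sim_len : mr s 6 = size (out c);
  sim_out : forall a, mm s (a * 4 + j') = nth 0 (out c) a;
  sim_fixed : forall r, (r < 3) || (9 < r) && (odd r != odd e) -> mr s r = mr s0 r;
  sim_rest : forall a i, i < 4 -> i != j -> i != j' ->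
    mm s (a * 4 + i) = mm s0 (a * 4 + i);
  sim_emit : mo s = mo s0
}.

(** Registers 4, 5, 7 and 8 are the scratch registers of the simulation. *)
Lemma simulates_ext s0 c s s' :
  simulates s0 c s -> mm s' = mm s -> mo s' = mo s ->
  (forall r, (r != 4) && (r != 5) && (r != 7) && (r != 8) ->
    mr s' r = mr s r) ->
  simulates s0 c s'.
Proof.
case=> H1 H2 H3 H4 H5 H6 H7 H8 Em Eo Er.
split; rewrite ?Em ?Eo ?Er //.
- by move=> i; rewrite Er //; rewrite /phi; lia.
- by move=> r Hr; rewrite Er ?H6 //; lia.
Qed.

Lemma phi_eq i d : (phi i == phi d) = (i == d).
Proof. by rewrite /phi; lia. Qed.

Lemma phi_small i n : n < 10 -> ((phi i == n) = false) * ((n == phi i) = false).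
Proof. by rewrite /phi => n10; split; lia. Qed.

Lemma wp_sim_instr s0 c s i :
  simulates s0 c s ->
  wp (sim_instr i) 9 (simulates s0 (exec i c)) s.
Proof.
case: c => pc0 r0 m0 o0 [/= H1 H2 H3 H4 H5 H6 H7 H8].
have wpb l Q : all plain l -> size l <= 9 -> Q (run_block l s) ->
    wp (block l) 9 Q s.
  by move=> pl sl Qs; apply: wp_conseq sl (fun _ => id); apply: wp_block.
have phiE := (phi_eq, phi_small).
have fixE r d n : (r < 3) || (9 < r) && (odd r != odd e) -> (2 < n < 10) ->
    ((r == n) = false) * ((r == phi d) = false).
  by rewrite /phi => Hr Hn; split; lia.
have addr (a b : nat) u : u < 4 -> (a * 4 + u == b + b + (b + b) + j) =
    (u == j) && (a == b).
  by move=> u4; apply/eqP/andP => [?|[/eqP-> /eqP->]]; lia.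
have addr' (a b : nat) u : u < 4 -> (a * 4 + u == b + b + (b + b) + j') =
    (u == j') && (a == b).
  by move=> u4; apply/eqP/andP => [?|[/eqP-> /eqP->]]; lia.
have j'j : (j' == j) = false by rewrite eq_sym (negPf jj').
have memE a : mm s (a + a + (a + a) + j) = m0 a by rewrite -H3; congr mm; lia.
case: i => [d v|d a b|d a b|d a|d a|a b|a|a l].
1-5: apply: wpb; rewrite /= ?phiE //; split=> //=; rewrite ?/upd /= ?phiE //;
  [ by rewrite H1 addn1
  | by move=> i0; rewrite !phiE // ?memE !H2 ?memE
  | move=> r Hr; rewrite !(fixE r d 3) // ?(fixE r d 7) // ?(fixE r d 8) //;
    exact: H6].
- apply: wpb; rewrite /= ?phiE //; split=> //=; rewrite ?/upd /= ?phiE //.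
  + by rewrite H1 addn1.
  + by move=> i0; rewrite !phiE // !H2.
  + by move=> i0; rewrite addr // eqxx !H2 H3.
  + by move=> i0; rewrite addr // j'j H5.
  + move=> r Hr; rewrite !(fixE r 0 3) // (fixE r 0 7) // (fixE r 0 8) //.
    exact: H6.
  + by move=> a' i0 i4 /negPf ij /negPf ij'; rewrite addr // ij H7 // ?ij ?ij'.
- apply: wpb; rewrite /= ?phiE //; split=> //=; rewrite ?/upd /= ?phiE //.
  + by rewrite H1 addn1.
  + by move=> i0; rewrite !phiE // !H2.
  + by move=> i0; rewrite addr' // (negPf jj') H3.
  + by rewrite H4 size_rcons addn1.
  + move=> i0; rewrite addr' // eqxx /= H4 H2 nth_rcons H5.
    by case: ltngtP => // ?; rewrite nth_default //; lia.
  + move=> r Hr; rewrite !(fixE r 0 3) // (fixE r 0 7) // (fixE r 0 8) //.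
    rewrite (fixE r 0 6) //; exact: H6.
  + by move=> a' i0 i4 /negPf ij /negPf ij'; rewrite addr' // ij' H7 // ?ij ?ij'.
- apply: wp_conseq (_ : wp _ 4 _ _) _ (fun _ => id) => //.
  apply: wp_if => ra.
    apply: wp_block; rewrite //=; split=> //=; rewrite ?/upd /= ?phiE //.
    + by rewrite -H2 (negPf ra) H1 addn1.
    + by move=> i0; rewrite !phiE // !H2.
    + by move=> r Hr; rewrite !(fixE r 0 3) // (fixE r 0 8) //; exact: H6.
  apply: (@wp_conseq _ 1) (fun _ => id) => //.
  apply: wp_block; rewrite //=; split=> //=; rewrite ?/upd /= ?phiE //.
  + by rewrite -H2 ra.
  + by move=> i0; rewrite !phiE // !H2.
  + by move=> r Hr; rewrite !(fixE r 0 3) //; exact: H6.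
Qed.

(** There is no computed jump: the current instruction is found by counting register 5 down from the
    program counter. The cost is linear in the size of [p], which is a constant. *)
Fixpoint dispatch (p : program) : cmd :=
  if p is i :: p' then
    CIf 5 (CSeq (block [:: Const 8 1; Defs.Sub 5 5 8]) (dispatch p')) (sim_instr i)
  else CSkip.

Lemma wp_dispatch p n s0 c s :
  n < size p -> mr s 5 = n -> simulates s0 c s ->
  wp (dispatch p) (4 * size p + 9) (simulates s0 (exec (nth (Const 0 0) p n) c)) s.
Proof.
elim: p n s => [|i p IH] n s //= np s5 Hs.
have -> : 4 * (size p).+1 + 9 = (2 + (4 * size p + 9)).+2 by lia.
apply: wp_if => [n0|n0].
  apply: wp_seq; apply: wp_block => //=.
  case: n np s5 n0 => [|n] np s5 n0; first by rewrite s5 in n0.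
  apply: IH => //=; first by rewrite /upd /= s5; lia.
  apply: simulates_ext Hs _ _ _ => //= r Hr.
  by rewrite /upd !ifF //; lia.
have -> : n = 0 by lia.
apply: wp_conseq (wp_sim_instr i Hs) _ (fun _ => id); lia.
Qed.

Definition test_halt (p : program) : seq instr := [:: Const 8 (size p); Defs.Sub 4 8 3].

Definition sim_loop (p : program) : cmd :=
  CSeq (block (test_halt p))
    (CWhile 4 (CSeq (CSeq (block [:: Add 5 3 2]) (dispatch p)) (block (test_halt p)))).

Lemma iter_halted p c m n : halted p (iter m (step p) c) -> m <= n ->
  iter n (step p) c = iter m (step p) c.
Proof.
move=> Hm /subnK <-; elim: (n - m) => // i IH.
by rewrite addSn iterS IH /step Hm.
Qed.

Lemma wp_sim_loop p s0 c s t :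
  simulates s0 c s -> halted p (iter t (step p) c) ->
  wp (sim_loop p) (3 + t * (4 * size p + 14))
     (simulates s0 (iter t (step p) c)) s.
Proof.
move=> Hs Ht.
(* The loop stops at the first halting time [m], whereas [t] is any time by which the program has
   halted. *)
have [m Hm m_min] := ex_minnP (ex_intro (fun t => halted p (iter t (step p) c)) t Ht).
have mt := m_min _ Ht; rewrite (iter_halted Hm mt).
pose Inv i s := [/\ i <= m, simulates s0 (iter (m - i) (step p) c) s &
  mr s 4 = size p - pc (iter (m - i) (step p) c)].
apply: (@wp_conseq _ (2 + (m * (4 * size p + 12).+2).+1)) (fun _ => id).
- apply: wp_seq; apply: wp_block => //=; apply: (@wp_while Inv).
  + move=> i s1 [im Hi s4]; have := m_min (m - i.+1).
    have Hh : ~~ halted p (iter (m - i.+1) (step p) c).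
      by apply/negP => /m_min; lia.
    move=> _; rewrite /halted -ltnNge in Hh; split; first by rewrite s4; lia.
    apply: wp_zero => s12.
    apply: (@wp_conseq _ (1 + (4 * size p + 9) + 2)) (fun _ => id); last by lia.
    do 2!apply: wp_seq; apply: wp_block => //=.
    apply: (@wp_conseq _ (4 * size p + 9)) (leqnn _) _.
      apply: (wp_dispatch Hh).
        by rewrite /= upd_same s12 addn0 (sim_pc Hi).
      by apply: simulates_ext Hi _ _ _ => //= r Hr; rewrite /upd !ifF //; lia.
    rewrite [exec _ _](_ : _ = iter (m - i) (step p) c); last first.
      have -> : m - i = (m - i.+1).+1 by lia.
      by rewrite iterS /step /halted leqNgt Hh.
    move=> s2 H2; apply: wp_block => //=; split; first by lia.
      by apply: simulates_ext H2 _ _ _ => //= r Hr; rewrite /upd !ifF //; lia.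
    by rewrite /= upd_same !updE /= (sim_pc H2).
  + move=> s1 [_]; rewrite subn0 => Hi s4; split=> //.
    by rewrite s4; apply/eqP; rewrite subn_eq0; exact: Hm.
  + split; rewrite ?subnn //=; last by rewrite /= upd_same !updE /= (sim_pc Hs).
    by apply: simulates_ext Hs _ _ _ => //= r Hr; rewrite /upd !ifF //; lia.
- by nia.
Qed.

End Simulation.

(** * A language of bounded iteration *)

(* Variables are de Bruijn indices; EK and ESz are the parameter and the length
   of the input word.  EIter e1 e0 e2 binds the iteration index (index 0) and
   the accumulator (index 1) in e2; EDrop n e weakens e by n variables. *)
Inductive exp : Type :=
| EVar of nat
| ECst of nat
| EK
| ESz
| EAdd of exp & exp
| ESub of exp & exp
| EGet of exp
| EIf of exp & exp & exp
| EIter of exp & exp & exp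
| ELet of exp & exp
| EDrop of nat & exp.

Inductive stm : Type :=
| SNil
| SEmit of exp
| SSeq of stm & stm
| SFor of exp & stm
| SIf of exp & stm & stm.

Section Language.

Variable beta : nat.

(* Every loop is cut off after cap x k rounds, which makes the running time
   polynomial for all inputs, including malformed ones. *)
Definition cap (x : seq nat) (k : nat) : nat := size x + k + beta.

Section Denotation.
Variables (x : seq nat) (k : nat).

Fixpoint eden (s : seq nat) (e : exp) : nat :=
  match e with
  | EVar i => nth 0 s i
  | ECst c => c
  | EK => k
  | ESz => size x
  | EAdd e1 e2 => eden s e1 + eden s e2
  | ESub e1 e2 => eden s e1 - eden s e2
  | EGet e => nth 0 x (eden s e)
  | EIf e1 e2 e3 => if eden s e1 != 0 then eden s e2 else eden s e3
  | EIter e1 e0 e2 =>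
      iteri (minn (eden s e1) (cap x k)) (fun i a => eden (i :: a :: s) e2)
            (eden s e0)
  | ELet e1 e2 => eden (eden s e1 :: s) e2
  | EDrop n e => eden (drop n s) e
  end.

Fixpoint sden (s : seq nat) (c : stm) : seq nat :=
  match c with
  | SNil => [::]
  | SEmit e => [:: eden s e]
  | SSeq c1 c2 => sden s c1 ++ sden s c2
  | SFor e c =>
      flatten [seq sden (i :: s) c | i <- iota 0 (minn (eden s e) (cap x k))]
  | SIf e c1 c2 => if eden s e != 0 then sden s c1 else sden s c2
  end.

End Denotation.

(** [B] stands for the cap on the rounds of a loop. Both branches of a conditional are counted, so
    that the cost depends on the values through [B] alone. *)
Fixpoint ecost (B : nat) (e : exp) : nat :=
  match e with
  | EVar _ | ECst _ | EK | ESz => 1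
  | EAdd e1 e2 | ESub e1 e2 | ELet e1 e2 => ecost B e1 + (ecost B e2 + 1)
  | EGet e => ecost B e + 5
  | EIf e1 e2 e3 => ecost B e1 + (ecost B e2 + ecost B e3).+2
  | EIter e1 e0 e2 =>
      ecost B e0 + (ecost B e1 + (3 + (B * (ecost B e2 + 4).+2).+1))
  | EDrop _ e => ecost B e
  end.

Fixpoint scost (B : nat) (c : stm) : nat :=
  match c with
  | SNil => 0
  | SEmit e => ecost B e + 1
  | SSeq c1 c2 => scost B c1 + scost B c2
  | SFor e c => ecost B e + (3 + (B * (scost B c + 3).+2).+1)
  | SIf e c1 c2 => ecost B e + (scost B c1 + scost B c2).+2
  end.

Definition poly_bounded (f : nat -> nat) : Prop :=
  exists a h, forall B, f B <= a * B.+1 ^ h.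

Lemma poly_cst c : poly_bounded (fun=> c).
Proof. by exists c, 0 => B; rewrite expn0 muln1. Qed.

Lemma poly_add f g :
  poly_bounded f -> poly_bounded g -> poly_bounded (fun B => f B + g B).
Proof.
move=> [a [h Hf]] [b [l Hg]]; exists (a + b), (h + l) => B.
rewrite mulnDl leq_add // ?(leq_trans (Hf B)) ?(leq_trans (Hg B)) //.
  by rewrite leq_mul2l leq_pexp2l ?leq_addr ?orbT.
by rewrite leq_mul2l leq_pexp2l ?leq_addl ?orbT.
Qed.

Lemma poly_mulB f : poly_bounded f -> poly_bounded (fun B => B * f B).
Proof.
move=> [a [h Hf]]; exists a, h.+1 => B.
by rewrite expnS mulnCA leq_mul.
Qed.

Lemma poly_S f : poly_bounded f -> poly_bounded (fun B => (f B).+1).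
Proof. by move=> Hf; apply: (poly_add (poly_cst 1)) Hf. Qed.

Ltac poly := repeat first [assumption | exact: poly_cst | apply: poly_S
  | apply: poly_add | apply: poly_mulB].

Lemma poly_ecost e : poly_bounded (ecost^~ e).
Proof. by elim: e => /= *; poly. Qed.

Lemma poly_scost c : poly_bounded (scost^~ c).
Proof. by elim: c => /= *; repeat first [exact: poly_ecost | progress poly]. Qed.

Section Compilation.

Variable w : nat.
Hypothesis w4 : w < 4.

(* Registers 3, 4 and 5 hold the cap, the parameter and the length of the word,
   which is stored at the addresses congruent to w modulo 4.  Variable i is in
   register nu_i, the result goes to register t, and registers below t are
   preserved. *)
Fixpoint ecomp (nu : seq nat) (t : nat) (e : exp) : cmd :=
  match e with
  | EVar i => block [:: Add t (nth 2 nu i) 2]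
  | ECst c => block [:: Const t c]
  | EK => block [:: Add t 4 2]
  | ESz => block [:: Add t 5 2]
  | EAdd e1 e2 =>
      CSeq (ecomp nu t e1) (CSeq (ecomp nu t.+1 e2) (block [:: Add t t t.+1]))
  | ESub e1 e2 =>
      CSeq (ecomp nu t e1) (CSeq (ecomp nu t.+1 e2) (block [:: Defs.Sub t t t.+1]))
  | EGet e => CSeq (ecomp nu t e)
      (block [:: Add t t t; Add t t t; Const t.+1 w; Add t t t.+1; Fetch t t])
  | EIf e1 e2 e3 =>
      CSeq (ecomp nu t e1) (CIf t (ecomp nu t e2) (ecomp nu t e3))
  | EIter e1 e0 e2 =>
      CSeq (ecomp nu t e0) (CSeq (ecomp nu t.+1 e1) (CSeq
        (block [:: Defs.Sub t.+2 t.+1 3; Defs.Sub t.+1 t.+1 t.+2; Const t.+2 0])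
        (CWhile t.+1 (CSeq (ecomp [:: t.+2, t & nu] t.+3 e2)
          (block [:: Add t t.+3 2; Const t.+3 1; Add t.+2 t.+2 t.+3;
                     Defs.Sub t.+1 t.+1 t.+3])))))
  | ELet e1 e2 =>
      CSeq (ecomp nu t e1) (CSeq (ecomp (t :: nu) t.+1 e2) (block [:: Add t t.+1 2]))
  | EDrop n e => ecomp (drop n nu) t e
  end.

Fixpoint scomp (nu : seq nat) (t : nat) (c : stm) : cmd :=
  match c with
  | SNil => CSkip
  | SEmit e => CSeq (ecomp nu t e) (block [:: Emit t])
  | SSeq c1 c2 => CSeq (scomp nu t c1) (scomp nu t c2)
  | SFor e c =>
      CSeq (ecomp nu t e) (CSeq
        (block [:: Defs.Sub t.+1 t 3; Defs.Sub t t t.+1; Const t.+1 0])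
        (CWhile t (CSeq (scomp (t.+1 :: nu) t.+2 c)
          (block [:: Const t.+2 1; Add t.+1 t.+1 t.+2; Defs.Sub t t t.+2]))))
  | SIf e c1 c2 => CSeq (ecomp nu t e) (CIf t (scomp nu t c1) (scomp nu t c2))
  end.

Variables (x : seq nat) (k : nat).

(** Register 2 is the default of [nu] and holds 0, the default of [s], so an unbound variable reads
    0 on both sides and [env_var] can speak of all [i]. In the same way the addresses beyond the
    word hold 0. *)
Record env_at (nu : seq nat) (t : nat) (s : seq nat) (m : mst) : Prop := EnvAt {
  env_cap : mr m 3 = cap x k;
  env_par : mr m 4 = k;
  env_len : mr m 5 = size x;
  env_word : forall a, mm m (a * 4 + w) = nth 0 x a;
  env_var : forall i, mr m (nth 2 nu i) = nth 0 s i;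
  env_lt : forall i, nth 2 nu i < t;
  env_tmp : 5 < t
}.

Definition keeps (t : nat) (m m' : mst) : Prop :=
  [/\ forall r, r < t -> mr m' r = mr m r, mm m' = mm m & mo m' = mo m].

Lemma keeps_trans t t' m m1 m2 :
  keeps t m m1 -> keeps t' m1 m2 -> t <= t' -> keeps t m m2.
Proof.
move=> [H1 H2 H3] [H4 H5 H6] tt'; split; rewrite ?H5 ?H6 // => r rt.
by rewrite H4 ?H1 //; exact: leq_trans tt'.
Qed.

Lemma keeps_block t l m :
  all (fun i => match i with
    | Const d _ | Add d _ _ | Defs.Sub d _ _ | Half d _ | Fetch d _ => t <= d
    | _ => false end) l -> keeps t m (run_block l m).
Proof.
elim: l m => [|i l IH] m; first by split.
move=> /andP[Hi Hl]; apply: (keeps_trans (m1 := exec_m i m)); last exact: leqnn.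
  by case: i Hi => // *; split=> //= r rt; rewrite upd_other //; lia.
exact: IH.
Qed.

Lemma env_keeps nu t t' s m m' :
  env_at nu t s m -> keeps t m m' -> t <= t' -> env_at nu t' s m'.
Proof.
case=> H1 H2 H3 H4 H5 H6 H7 [K1 K2 K3] tt'.
split; rewrite ?K1 ?K2 //; try lia.
- by move=> i; rewrite K1.
- by move=> i; apply: leq_trans tt'.
Qed.

Lemma env_cons nu t s m r v :
  env_at nu t s m -> r < t -> mr m r = v -> env_at (r :: nu) t (v :: s) m.
Proof. by case=> H1 H2 H3 H4 H5 H6 H7 rt rv; split=> // -[|i] /=. Qed.

Lemma env_drop n nu t s m : env_at nu t s m -> env_at (drop n nu) t (drop n s) m.
Proof.
case=> H1 H2 H3 H4 H5 H6 H7; split=> // i; rewrite ?nth_drop //.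
Qed.

Definition evaluated (t v : nat) (m m' : mst) : Prop := mr m' t = v /\ keeps t m m'.

Lemma keeps_reg t m m' r : keeps t m m' -> r < t -> mr m' r = mr m r.
Proof. by case=> H _ _; exact: H. Qed.

Lemma wp_ecomp e nu t s m :
  env_at nu t s m ->
  wp (ecomp nu t e) (ecost (cap x k) e) (evaluated t (eden x k s e) m) m.
Proof.
have plain1 t' (i : instr) : 5 < t' -> (if i is Add d _ _ then d == t' else
    if i is Const d _ then d == t' else false) -> all plain [:: i].
  by case: i => //= [d _|d _ _] ? /eqP->; rewrite andbT; lia.
elim: e nu t s m => /=.
1-2: move=> i.
1-4: move=> nu t s m H; apply: wp_zero => m2; apply: wp_block;
  [by apply: plain1 (env_tmp H) _ => /= | split; last by
    [apply: keeps_block; rewrite /= leqnn]].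
- by rewrite /= upd_same (env_var H) m2 addn0.
- by rewrite /= upd_same.
- by rewrite /= upd_same (env_par H) m2 addn0.
- by rewrite /= upd_same (env_len H) m2 addn0.
1-2: move=> e1 IH1 e2 IH2 nu t s m H; have t5 := env_tmp H;
  apply: wp_seq; apply: (wp_conseq (IH1 _ _ _ _ H) (leqnn _)) => m1 [v1 K1];
  have H1 := env_keeps H K1 (leqnSn t);
  apply: wp_seq; apply: (wp_conseq (IH2 _ _ _ _ H1) (leqnn _)) => m2 [v2 K2];
  apply: wp_block; [by rewrite /= andbT; lia|];
  split; [by rewrite /= upd_same v2 (keeps_reg K2) // v1|];
  apply: keeps_trans (keeps_trans K1 K2 _) _ (leqnn t) => //;
  by apply: (@keeps_block t [:: _]); rewrite /= leqnn.
- move=> e IH nu t s m H; have t5 := env_tmp H.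
  apply: wp_seq; apply: (wp_conseq (IH _ _ _ _ H) (leqnn _)) => m1 [v1 K1].
  apply: wp_block => /=; first by lia.
  split; last first.
    apply: keeps_trans K1 _ (leqnn t).
    by apply: (@keeps_block t [:: _; _; _; _; _]) => /=; lia.
  rewrite /= !updE /= !eqxx.
  do ![rewrite ifF; last by lia].
  case: K1 => _ -> _.
  by rewrite v1 -(env_word H); congr mm; lia.
- move=> e1 IH1 e2 IH2 e3 IH3 nu t s m H; have t5 := env_tmp H.
  apply: wp_seq; apply: (wp_conseq (IH1 _ _ _ _ H) (leqnn _)) => m1 [v1 K1].
  have H1 := env_keeps H K1 (leqnn t).
  apply: wp_if; rewrite v1 => /eqP; rewrite ?eqb0 => v0.
    apply: (wp_conseq (IH2 _ _ _ _ H1) (leq_addr _ _)) => m2 [v2 K2].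
    by split; [case: eqP v0 | apply: keeps_trans K1 K2 _].
  apply: (wp_conseq (IH3 _ _ _ _ H1) (leq_addl _ _)) => m2 [v2 K2].
  by split; [rewrite v0 | apply: keeps_trans K1 K2 _].
- move=> e1 IH1 e0 IH0 e2 IH2 nu t s m H; have t5 := env_tmp H.
  apply: wp_seq; apply: (wp_conseq (IH0 _ _ _ _ H) (leqnn _)) => m1 [v1 K1].
  have H1 := env_keeps H K1 (leqnSn t).
  apply: wp_seq; apply: (wp_conseq (IH1 _ _ _ _ H1) (leqnn _)) => m2 [v2 K2].
  have H2 := env_keeps H1 K2 (leqnn _).
  apply: wp_seq; apply: wp_block => /=; first by lia.
  set n := eden x k s e1 in v2 *; set v0 := eden x k s e0 in v1 *.
  set F := fun i a => _; set N := minn n _.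
  pose Inv j m' := [/\ j <= N, mr m' t.+1 = j, mr m' t.+2 = N - j,
    mr m' t = iteri (N - j) F v0 & keeps t m m'].
  apply: (@wp_conseq _ (N * (ecost (cap x k) e2 + 4).+2).+1 _
     (evaluated t (iteri N F v0) m)) => //; last first.
    by rewrite ltnS leq_mul2r geq_minr orbT.
  apply: (wp_while (Inv := Inv)).
  + move=> j m3 [jN r1 r2 r0 K3]; split; first by rewrite r1.
    have H3 : env_at [:: t.+2, t & nu] t.+3 [:: N - j.+1, iteri (N - j.+1) F v0 & s] m3.
      apply: env_cons r2; last by [].
      apply: env_cons r0; last by lia.
      by apply: (env_keeps H K3); lia.
    apply: wp_seq; apply: (wp_conseq (IH2 _ _ _ _ H3) (leqnn _)) => m4 [v4 K4].
    apply: wp_zero => m42; apply: wp_block => /=; first by lia.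
    have [q1 q2 q3] : [/\ mr m4 t.+1 = j.+1, mr m4 t.+2 = N - j.+1 &
        mr m4 t = iteri (N - j.+1) F v0].
      by split; rewrite (keeps_reg K4) //; lia.
    have NE : N - j = (N - j.+1).+1 by lia.
    split; first by lia.
    * rewrite /= !updE /= !eqxx; do ![rewrite ifF; last by lia].
      by rewrite q1 subn1.
    * rewrite /= !updE /= !eqxx; do ![rewrite ifF; last by lia].
      by rewrite q2 NE addn1.
    * rewrite /= !updE /= !eqxx; do ![rewrite ifF; last by lia].
      by rewrite v4 m42 addn0 NE.
    * apply: keeps_trans K3 _ (leqnn t); apply: (keeps_trans (t := t) (t' := t) (m1 := m4)) (leqnn t).
        by case: K4 => K4 ? ?; split=> // r rt; apply: K4; lia.
      by apply: (@keeps_block t [:: _; _; _; _]) => /=; lia.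
  + move=> m3 [_ r1 r2 r0 K3]; split=> //; split=> //.
    by rewrite r0 subn0.
  + rewrite /Inv subnn; split=> //.
    (* The two subtractions compute [n - (n - cap) = minn n cap]. *)
    * rewrite /= !updE /= !eqxx; do ![rewrite ifF; last by lia].
      by rewrite v2 (env_cap H2) /N; lia.
    * by rewrite /= !updE eqxx.
    * rewrite /= !updE /=; do ![rewrite ifF; last by lia].
      by rewrite (keeps_reg K2) // v1.
    * apply: keeps_trans K1 _ (leqnSn t); apply: (keeps_trans K2) (leqnn t.+1).
      by apply: (@keeps_block t.+1 [:: _; _; _]) => /=; lia.
- move=> e1 IH1 e2 IH2 nu t s m H; have t5 := env_tmp H.
  apply: wp_seq; apply: (wp_conseq (IH1 _ _ _ _ H) (leqnn _)) => m1 [v1 K1].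
  have H1 := env_cons (env_keeps H K1 (leqnSn t)) (leqnn _) v1.
  apply: wp_seq; apply: (wp_conseq (IH2 _ _ _ _ H1) (leqnn _)) => m2 [v2 K2].
  apply: wp_zero => m22; apply: wp_block => /=; first by lia.
  split; first by rewrite /= upd_same v2 m22 addn0.
  apply: keeps_trans (keeps_trans K1 K2 _) _ (leqnn t) => //.
  by apply: (@keeps_block t [:: _]); rewrite /= leqnn.
- by move=> n e IH nu t s m H; apply: IH; exact: env_drop.
Qed.

Definition emitted (t : nat) (o : seq nat) (m m' : mst) : Prop :=
  [/\ forall r, r < t -> mr m' r = mr m r, mm m' = mm m & mo m' = mo m ++ o].

Lemma env_emitted nu t s m o m' :
  env_at nu t s m -> emitted t o m m' -> env_at nu t s m'.
Proof.
case=> H1 H2 H3 H4 H5 H6 H7 [K1 K2 K3].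
split; rewrite ?K1 ?K2 //; try lia.
by move=> i; rewrite K1.
Qed.

Lemma wp_scomp c nu t s m :
  env_at nu t s m ->
  wp (scomp nu t c) (scost (cap x k) c) (emitted t (sden x k s c) m) m.
Proof.
elim: c nu t s m => /=.
- by move=> nu t s m H; apply: wp_skip; split; rewrite ?cats0.
- move=> e nu t s m H.
  apply: wp_seq; apply: (wp_conseq (wp_ecomp e H) (leqnn _)) => m1 [v1 [K1 K2 K3]].
  by apply: wp_block => //; split=> //=; rewrite K3 v1 cats1.
- move=> c1 IH1 c2 IH2 nu t s m H.
  apply: wp_seq; apply: (wp_conseq (IH1 _ _ _ _ H) (leqnn _)) => m1 K1.
  have H1 := env_emitted H K1; case: K1 => K1 K2 K3.
  apply: (wp_conseq (IH2 _ _ _ _ H1) (leqnn _)) => m2 [L1 L2 L3].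
  split; rewrite ?L2 ?L3 ?K3 ?catA // => r rt.
  by rewrite L1 // K1.
- move=> e c IH nu t s m H; have t5 := env_tmp H.
  apply: wp_seq; apply: (wp_conseq (wp_ecomp e H) (leqnn _)) => m1 [v1 K1].
  apply: wp_seq; apply: wp_block => /=; first by lia.
  set n := eden x k s e in v1 *; set N := minn n _.
  set F := fun i => _.
  pose Inv j m' := [/\ j <= N, mr m' t = j, mr m' t.+1 = N - j &
    emitted t (flatten [seq F i | i <- iota 0 (N - j)]) m m'].
  apply: (@wp_conseq _ (N * (scost (cap x k) c + 3).+2).+1 _
     (emitted t (flatten [seq F i | i <- iota 0 N]) m)) => //; last first.
    by rewrite ltnS leq_mul2r geq_minr orbT.
  apply: (wp_while (Inv := Inv)).
  + move=> j m3 [jN r1 r2 K3]; split; first by rewrite r1.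
    have H3 : env_at (t.+1 :: nu) t.+2 (N - j.+1 :: s) m3.
      apply: env_cons r2; last by [].
      have := env_emitted H K3; case=> *; split=> //; last by lia.
      move=> i; have := env_lt H i; lia.
    apply: wp_seq; apply: (wp_conseq (IH _ _ _ _ H3) (leqnn _)) => m4 [L1 L2 L3].
    apply: wp_block => /=; first by lia.
    have NE : N - j = (N - j.+1).+1 by lia.
    split; first by lia.
    * rewrite /= !updE /= !eqxx; do ![rewrite ifF; last by lia].
      by rewrite L1 ?r1 ?subn1 //; lia.
    * rewrite /= !updE /= !eqxx; do ![rewrite ifF; last by lia].
      by rewrite L1 ?r2 ?NE ?addn1 //; lia.
    * case: K3 => M1 M2 M3; split=> /=; rewrite ?L2 ?L3 ?M3 //.
        move=> r rt; rewrite /= !updE /=; do ![rewrite ifF; last by lia].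
        by rewrite L1 ?M1 //; lia.
      by rewrite NE -[(N - j.+1).+1]addn1 iotaD map_cat flatten_cat /= cats0 catA.
  + move=> m3 [_ r1 r2]; rewrite subn0 => K3; split=> //.
  + rewrite /Inv subnn; split=> //.
    * rewrite /= !updE /= !eqxx; do ![rewrite ifF; last by lia].
      by rewrite v1 (keeps_reg K1) ?(env_cap H) /N; lia.
    * by rewrite /= upd_same.
    * case: K1 => K1 K2 K3; split=> /=; rewrite ?cats0 //.
      move=> r rt; rewrite /= !updE /=; do ![rewrite ifF; last by lia].
      exact: K1.
- move=> e c1 IH1 c2 IH2 nu t s m H.
  apply: wp_seq; apply: (wp_conseq (wp_ecomp e H) (leqnn _)) => m1 [v1 K1].
  have H1 := env_keeps H K1 (leqnn t); case: K1 => K1 K2 K3.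
  apply: wp_if; rewrite v1 => v0.
    apply: (wp_conseq (IH1 _ _ _ _ H1) (leq_addr _ _)) => m2 [L1 L2 L3].
    by rewrite v0; split; rewrite ?L2 ?L3 ?K3 // => r rt; rewrite L1 ?K1.
  apply: (wp_conseq (IH2 _ _ _ _ H1) (leq_addl _ _)) => m2 [L1 L2 L3].
  by rewrite v0; split; rewrite ?L2 ?L3 ?K3 // => r rt; rewrite L1 ?K1.
Qed.

End Compilation.

End Language.

(** * Composition of reductions *)

(** The word is spread out in place, from its last cell down: the target [4 * j] is never among the
    cells below [j] that are still to be read. Cell [j] is cleared before the value is written,
    which is right also for [j = 0], where source and target coincide, and which leaves zeros in the
    other residue classes. *)
Definition relocate : cmd :=
  CSeq (block [:: Add 3 1 2]) (CWhile 3
    (block [:: Const 4 1; Defs.Sub 3 3 4; Fetch 5 3; Store 3 2;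
               Add 6 3 3; Add 6 6 6; Store 6 5])).

Lemma wp_relocate x s :
  mr s 1 = size x -> (forall a, mm s a = nth 0 x a) ->
  wp relocate (size x * 9 + 2)
    (fun s' => [/\ forall r, (r < 3) || (6 < r) -> mr s' r = mr s r,
       forall a, mm s' (a * 4 + 0) = nth 0 x a,
       forall a i, 0 < i < 4 -> mm s' (a * 4 + i) = 0 & mo s' = mo s]) s.
Proof.
move=> s1 sm; apply: wp_zero => s2.
pose Inv j s' := [/\ mr s' 3 = j, mr s' 2 = 0,
  forall r, (r < 3) || (6 < r) -> mr s' r = mr s r, mo s' = mo s &
  forall a, mm s' a = if (a %% 4 == 0) && (j <= a %/ 4) then nth 0 x (a %/ 4)
    else if a < j then nth 0 x a else 0].
apply: (@wp_conseq _ (1 + (size x * 7.+2).+1)) (fun _ => id); last by lia.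
apply: wp_seq; apply: wp_block => //; apply: (wp_while (Inv := Inv)).
- move=> j s' [r3 r2 rr ro rm]; split; first by rewrite r3.
  apply: wp_block => //; split=> //=.
  + by rewrite !updE /= r3; lia.
  + by move=> r Hr; rewrite !updE /= !ifF ?rr //; lia.
  + move=> a; rewrite !updE /= r3 r2 subn1 /= !rm.
    have -> : (j %% 4 == 0) && (j < j %/ 4) = false by lia.
    rewrite ltnSn; case: (eqVneq a (j + j + (j + j))) => [->|a1].
      have -> : (j + j + (j + j)) %/ 4 = j by lia.
      by rewrite leqnn andbT ifT //; lia.
    case: (eqVneq a j) => [E|a2].
      by rewrite E; case: ifP => //; [lia | rewrite ltnn].
    have -> : (a %% 4 == 0) && (j < a %/ 4) = (a %% 4 == 0) && (j <= a %/ 4) by lia.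
    by have -> : (a < j.+1) = (a < j) by lia.
- move=> s' [r3 r2 rr ro rm]; split=> //; split=> // [a|a i Hi].
    by rewrite rm addn0 modnMl mulnK.
  by rewrite rm ifF //; lia.
- split=> //=.
  + by rewrite !updE /= s1 s2 addn0.
  + by move=> r Hr; rewrite updE ifF //; lia.
  + move=> a; rewrite sm; case: (ltnP a (size x)) => [ax|xa].
      rewrite ifF //; lia.
    rewrite nth_default //; case: ifP => // /andP[_ xa'].
    by rewrite nth_default.
Qed.

Definition sim_init (e : nat) : cmd :=
  block [:: Add (10 + e) 0 2; Add (12 + e) 1 2; Const 3 0; Const 6 0].

Lemma wp_sim_init e j j' x k s :
  e < 2 -> mr s 0 = k -> mr s 1 = size x ->
  (forall r, 9 < r -> odd r = odd e -> mr s r = 0) ->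
  (forall a, mm s (a * 4 + j) = nth 0 x a) -> (forall a, mm s (a * 4 + j') = 0) ->
  wp (sim_init e) 4 (simulates e j j' s (init x k)) s.
Proof.
move=> e2 s0 s1 sz sj sj'; apply: wp_zero => s2; apply: wp_block => //.
split=> //=.
- move=> i; rewrite !updE /=; do ![rewrite ifF; last by lia].
  case: i => [|[|i]] /=.
  + by rewrite ifF ?ifT ?s0 ?s2 ?addn0 //; lia.
  + by rewrite ifT ?ifF ?s1 ?s2 ?addn0 //; lia.
  + by rewrite !ifF ?sz //; lia.
- by move=> a; rewrite sj' nth_nil.
- move=> r Hr; rewrite !updE /=; do ![rewrite ifF; last by lia].
  by [].
Qed.

Section Finish.

Variables (beta w : nat) (e : exp).

(* Registers 4 and 5 are expected to hold the parameter and the length of the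
   word. *)
Definition cap_init : cmd := block [:: Add 3 4 5; Const 7 beta; Add 3 3 7].

Definition result : cmd := CSeq (ecomp w [::] 6 e) (block [:: Add 0 6 2]).

Lemma wp_cap_init x k s N Q c :
  mr s 4 = k -> mr s 5 = size x -> (forall a, mm s (a * 4 + w) = nth 0 x a) ->
  (forall s', env_at beta w x k [::] 6 [::] s' -> mo s' = mo s -> wp c N Q s') ->
  wp (CSeq cap_init c) (3 + N) Q s.
Proof.
move=> s4 s5 sw H; apply: wp_zero => s2; apply: wp_seq; apply: wp_block => //.
apply: H => //; split=> //=.
- by rewrite !updE /= s4 s5 /cap; lia.
- by move=> i; rewrite !nth_nil !updE /= s2.
- by move=> i; rewrite !nth_nil.
Qed.

Lemma wp_result x k s :
  w < 4 -> env_at beta w x k [::] 6 [::] s ->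
  wp result (ecost (cap beta x k) e + 1)
    (fun s' => mo s' = mo s /\ mr s' 0 = eden beta x k [::] e) s.
Proof.
move=> w4 H; apply: wp_seq.
apply: (wp_conseq (wp_ecomp w4 e H) (leqnn _)) => s1 [v1 [K1 K2 K3]].
apply: wp_zero => s12; apply: wp_block => //=; split=> //.
by rewrite !updE /= v1 s12 addn0.
Qed.

End Finish.

(** * Closure properties of computable functions *)

Lemma computable_eden beta e f :
  computable f -> computable (fun k => eden beta [::] (f k) [::] e).
Proof.
move=> [p Hp].
exists (code (CSeq (sim_init 0) (CSeq (sim_loop 0 0 1 p)
  (CSeq (block [:: Add 4 10 2; Const 5 0])
     (CSeq (cap_init beta) (result 2 e))))) 0) => k.
have [t [x' [Hh Ho Hf]]] := Hp k.
pose s0 := drop_pc (init [::] k).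
suff [N W] : exists N, wp (CSeq (sim_init 0) (CSeq (sim_loop 0 0 1 p)
    (CSeq (block [:: Add 4 10 2; Const 5 0])
      (CSeq (cap_init beta) (result 2 e))))) N
    (fun s => mr s 0 = eden beta [::] (f k) [::] e) s0.
  have [t' [s [_ <- Hc]]] := wp_computes W.
  by exists t', (mo s).
eexists; apply: wp_seq; apply: (wp_conseq (wp_sim_init (x := [::]) (e := 0)
  (j := 0) (j' := 1) (k := k) _ _ _ _ _ _) (leqnn _)) => //=.
- by move=> r r9 _; rewrite !updE !ifF //; lia.
- by move=> a; rewrite !nth_nil.
- by move=> a; rewrite nth_nil.
move=> s1 H1; apply: wp_seq.
apply: (wp_conseq (wp_sim_loop _ _ _ _ H1 Hh) (leqnn _)) => // s2 H2.
apply: wp_zero => s22; apply: wp_seq; apply: wp_block => //.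
apply: (wp_cap_init (w := 2) (x := [::]) (k := f k)) => /=.
- rewrite !updE /= -Hf s22 addn0.
  by have := sim_reg H2 0; rewrite /=.
- by [].
(* Residue class 2 was not touched by the simulation and holds the empty word. *)
- move=> a; rewrite nth_nil (@sim_rest _ _ _ _ _ _ H2 a 2) //=.
  by rewrite nth_nil.
move=> s3 H3 _; apply: wp_conseq (@wp_result beta 2 e _ _ _ isT H3) (leqnn _) _ => //.
by move=> s' [].
Qed.

(** The two programs run one after the other in registers of different parity and in disjoint
    residue classes, so the second still finds the input in registers 0 and 1 and zeros in its own
    part. The time bound of a composed reduction is built from such sums. *)
Lemma computable_add f g :
  computable f -> computable g -> computable (fun k => f k + g k).
Proof.
move=> [p Hp] [q Hq].
exists (code (CSeq (sim_init 0) (CSeq (sim_loop 0 0 1 p)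
  (CSeq (sim_init 1) (CSeq (sim_loop 1 2 3 q) (block [:: Add 0 10 11]))))) 0) => k.
have [t [x' [Hh _ Hf]]] := Hp k; have [u [y' [Gh _ Hg]]] := Hq k.
pose s0 := drop_pc (init [::] k).
suff [N W] : exists N, wp (CSeq (sim_init 0) (CSeq (sim_loop 0 0 1 p)
    (CSeq (sim_init 1) (CSeq (sim_loop 1 2 3 q) (block [:: Add 0 10 11]))))) N
    (fun s => mr s 0 = f k + g k) s0.
  have [t' [s [_ <- Hc]]] := wp_computes W.
  by exists t', (mo s).
eexists; apply: wp_seq; apply: (wp_conseq (wp_sim_init (x := [::]) (e := 0)
  (j := 0) (j' := 1) (k := k) _ _ _ _ _ _) (leqnn _)) => //=.
- by move=> r r9 _; rewrite !updE !ifF //; lia.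
- by move=> a; rewrite !nth_nil.
- by move=> a; rewrite nth_nil.
move=> s1 H1; apply: wp_seq.
apply: (wp_conseq (wp_sim_loop _ _ _ _ H1 Hh) (leqnn _)) => // s2 H2.
apply: wp_seq; apply: (wp_conseq (wp_sim_init (x := [::]) (e := 1)
  (j := 2) (j' := 3) (k := k) _ _ _ _ _ _) (leqnn _)) => //=.
- by rewrite (sim_fixed H2).
- by rewrite (sim_fixed H2).
- move=> r r9 ro; rewrite (sim_fixed H2); last by rewrite r9 ro orbT.
  by rewrite /s0 /= !updE !ifF //; lia.
- move=> a; rewrite (@sim_rest _ _ _ _ _ _ H2) /= ?nth_nil //.
- move=> a; rewrite (@sim_rest _ _ _ _ _ _ H2) /= ?nth_nil //.
move=> s3 H3; apply: wp_seq.
apply: (wp_conseq (wp_sim_loop _ _ _ _ H3 Gh) (leqnn _)) => // s4 H4.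
apply: wp_block => //=; rewrite !updE /= -Hf -Hg.
have /= -> := sim_reg H4 0; rewrite (sim_fixed H4) //.
by have /= -> := sim_reg H2 0.
Qed.

Lemma computable_poly a b h f :
  computable f -> computable (fun k => a * (f k + b) ^ h).
Proof.
(* On the empty word and with [beta = b] the cap is [k + b], exactly the number of rounds wanted, so
   nothing is cut off. *)
move=> Hf; pose E := fix E h := if h is h'.+1 then
  EIter (EAdd EK (ECst b)) (ECst 0) (EAdd (EVar 1) (EDrop 2 (E h'))) else ECst a.
have EE k s : eden b [::] k s (E h) = a * (k + b) ^ h.
  elim: h s => [|h IH] s /=; first by rewrite expn0 muln1.
  rewrite {1}/cap /= minnn (_ : iteri _ _ _ = (k + b) * (a * (k + b) ^ h)).
    by rewrite expnS; lia.
  by rewrite drop0 IH; elim: {1 3}(k + b) => //= n ->; rewrite mulSn addnC.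
have [p Hp] := computable_eden b (E h) Hf.
by exists p => i; have [t [x' Ht]] := Hp i; exists t, x'; rewrite -(EE _ [::]).
Qed.

(** * Running time of a composed reduction *)

Lemma size_out_iter p t c : size (out (iter t (step p) c)) <= size (out c) + t.
Proof.
elim: t => [|t IH]; first by rewrite addn0.
apply: (leq_trans (n := (size (out (iter t (step p) c))).+1)); last by lia.
rewrite iterS /step; case: ifP => // _.
case: (iter t _ _) => pc0 r m o; case: (nth _ _ _) => //= *.
by rewrite size_rcons.
Qed.

Lemma size_isize x : size x <= isize x.
Proof.
rewrite /isize; elim: x => [|n x IH]; first by rewrite big_nil.
by rewrite big_cons /= -add1n leq_add.
Qed.

Lemma leq_pow m n h : m <= n -> m ^ h <= n ^ h.
Proof. by case: h => // h; rewrite leq_exp2r. Qed.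

(** The simulated reduction leaves its output word [x'] in memory, where it is the input of the
    second stage. One instruction appends at most one number, so [x'] is no longer than the running
    time [t]; together with [k' <= g k] this bounds the cap, and with it the cost of [S] and [e], in
    terms of the original input. *)
Theorem fpt_reduces_stm beta S e a b h (P Q R : pproblem) :
  (forall x k, Q x k <-> R (sden beta x k [::] S) (eden beta x k [::] e)) ->
  (forall x k, eden beta x k [::] e <= a * (k + b) ^ h) ->
  fpt_reduces P Q -> fpt_reduces P R.
Proof.
move=> HQR He [p [f [g [c [[cf mf] [cg mg] Hp]]]]].
have [a1 [h1 HS]] := poly_scost S; have [a2 [h2 HE]] := poly_ecost e.
pose prog := CSeq relocate (CSeq (sim_init 0) (CSeq (sim_loop 0 0 1 p)
  (CSeq (block [:: Add 4 10 2; Add 5 6 2])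
     (CSeq (cap_init beta) (CSeq (scomp 1 [::] 6 S) (result 1 e)))))).
pose H := h1 + h2.
pose A := a1 + a2 + 4 * size p + 100.
exists (code prog 0), (fun k => A * (f k + g k + beta.+1) ^ H.+1),
  (fun k => a * (g k + b) ^ h), (c * H.+1 + 1).
split.
- split; first by apply: computable_poly; apply: computable_add.
  move=> m n mn; rewrite leq_mul2l; apply/orP; right.
  by apply: leq_pow; have := mf _ _ mn; have := mg _ _ mn; lia.
- split; first exact: computable_poly.
  move=> m n mn; rewrite leq_mul2l; apply/orP; right.
  by apply: leq_pow; have := mg _ _ mn; lia.
move=> x k; have [t [x' [k' [[Hh Ho Hk] Ht Hg HPQ]]]] := Hp x k.
pose B := cap beta x' k'.
suff W : wp prog (size x * 9 + 2 + (4 + (3 + t * (4 * size p + 14) +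
    (2 + (3 + (scost B S + (ecost B e + 1)))))))
    (fun s => mo s = sden beta x' k' [::] S /\ mr s 0 = eden beta x' k' [::] e)
    (drop_pc (init x k)).
  have [t' [s [t'N [so sr] Hc]]] := wp_computes W.
  exists t', (mo s), (mr s 0); split=> //.
  + apply: leq_trans t'N _.
    (* Each part of the running time is at most a constant times [X]: [U * M] bounds [B.+1], its
       power bounds the costs of [S] and [e], and the factor [(isize x).+1] pays for relocating the
       word. *)
    set M := (isize x).+1 ^ c; set U := f k + g k + beta.+1.
    rewrite -mulnA (_ : U ^ H.+1 * _ = (U * M) ^ H.+1 * (isize x).+1); last first.
      by rewrite expnD expn1 expnM expnMn mulnA.
    set X := _ * (isize x).+1.
    have M0 : 0 < M by rewrite expn_gt0.
    have UM0 : 0 < U * M by rewrite muln_gt0 M0 andbT /U; lia.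
    have UX i : i <= H.+1 -> (U * M) ^ i <= X.
      move=> iH; apply: (leq_trans (n := (U * M) ^ H.+1)).
        by rewrite leq_pexp2l.
      by rewrite leq_pmulr.
    have xX : size x < X.
      apply: (leq_trans (n := (isize x).+1)); first by rewrite ltnS size_isize.
      by rewrite leq_pmull // expn_gt0 UM0.
    have tX : t <= X.
      apply: leq_trans (UX 1 isT); rewrite expn1; apply: leq_trans Ht _.
      by rewrite leq_mul2r /U; apply/orP; right; lia.
    have BU : B.+1 <= U * M.
      have x't : size x' <= t by rewrite -Ho; apply: leq_trans (size_out_iter _ _ _) _.
      have : f k * M + (g k + beta.+1) * M <= U * M by rewrite -mulnDl addnA.
      have : g k + beta.+1 <= (g k + beta.+1) * M by rewrite leq_pmulr.
      move: Ht; rewrite /B /cap; lia.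
    have SX : scost B S <= a1 * X.
      apply: leq_trans (HS B) _; rewrite leq_mul2l; apply/orP; right.
      by apply: leq_trans (leq_pow _ BU) (UX _ _); rewrite /H; lia.
    have EX : ecost B e <= a2 * X.
      apply: leq_trans (HE B) _; rewrite leq_mul2l; apply/orP; right.
      by apply: leq_trans (leq_pow _ BU) (UX _ _); rewrite /H; lia.
    have tpX : t * (4 * size p + 14) <= (4 * size p + 14) * X.
      by rewrite mulnC leq_mul2l tX orbT.
    rewrite /A !mulnDl; rewrite mulnDl in tpX; lia.
  + by rewrite sr; apply: leq_trans (He _ _) _; rewrite leq_mul2l leq_pow ?orbT //; lia.
  + by rewrite HPQ so sr.
apply: wp_seq; apply: (wp_conseq (wp_relocate (x := x) _ _) (leqnn _)) => //.
move=> s1 [r1 m1 m1' o1].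
apply: wp_seq; apply: (wp_conseq (wp_sim_init (x := x) (e := 0)
  (j := 0) (j' := 1) (k := k) _ _ _ _ _ _) (leqnn _)) => //=.
- by rewrite r1.
- by rewrite r1.
- by move=> r r9 _; rewrite r1 /= ?updE ?ifF //; lia.
- by move=> a0; rewrite m1'.
move=> s2 H2; apply: wp_seq.
apply: (wp_conseq (wp_sim_loop _ _ _ _ H2 Hh) (leqnn _)) => // s3 H3.
apply: wp_zero => s32; apply: wp_seq; apply: wp_block => //.
apply: (wp_cap_init (w := 1) (x := x') (k := k')) => /=.
- rewrite !updE /= -Hk s32 addn0.
  by have := sim_reg H3 0; rewrite /=.
- by rewrite !updE /= s32 addn0 (sim_len H3) Ho.
- by move=> a0; rewrite (sim_out H3) Ho.
move=> s4 H4 o4; apply: wp_seq.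
apply: (wp_conseq (wp_scomp (isT : 1 < 4) S H4) (leqnn _)) => s5 H5.
have H6 := env_emitted (isT : 1 < 4) H4 H5.
apply: (wp_conseq (@wp_result beta 1 e _ _ _ isT H6) (leqnn _)) => s6 [o6 ->].
split=> //; rewrite o6; case: H5 => _ _ ->.
by rewrite o4 /= (sim_emit H3) o1.
Qed.

(** * Constraint graphs given by a list of edges *)

Section ListGraph.

Variables (T : eqType) (z0 : T) (zs : seq T) (s1 s2 wt : T -> nat).
Variables (nv1 : nat) (infl : nat -> nat).
Hypotheses (zs_uniq : uniq zs).
Hypotheses (s1_lt : forall z, z \in zs -> s1 z < nv1.+1)
           (s2_lt : forall z, z \in zs -> s2 z < nv1.+1).

Definition list_graph : cgraph :=
  @CGraph nv1.+1 (size zs) (fun e => inord (s1 (nth z0 zs e)))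
    (fun e => inord (s2 (nth z0 zs e))) (fun e => wt (nth z0 zs e))
    (fun v => infl v).

Definition list_config (F : T -> bool) : config list_graph :=
  [ffun e : 'I_(size zs) => F (nth z0 zs e)].

Lemma map_enum_ord (A : Type) n (f : nat -> A) :
  [seq f (val e) | e <- enum 'I_n] = [seq f i | i <- iota 0 n].
Proof. by rewrite -(val_enum_ord n) -map_comp. Qed.

Lemma map_enum_nth (A : Type) (f : T -> A) :
  [seq f (nth z0 zs (val e)) | e <- enum 'I_(size zs)] = [seq f z | z <- zs].
Proof.
rewrite (map_enum_ord (size zs) (fun i => f (nth z0 zs i))) (map_comp f).
by rewrite map_nth_iota0 ?take_size.
Qed.

Lemma encode_list_graph :
  encode_cgraph list_graph =
  [:: nv1.+1; size zs] ++ [seq infl v | v <- iota 0 nv1.+1] ++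
  flatten [seq [:: s1 z; s2 z; wt z] | z <- zs].
Proof.
rewrite /encode_cgraph; congr ([:: _; _] ++ (_ ++ _)).
  exact: (map_enum_ord nv1.+1 infl).
rewrite -(map_enum_nth (fun z => [:: s1 z; s2 z; wt z])); congr flatten.
apply: eq_map => e /=; have zin : nth z0 zs e \in zs by rewrite mem_nth.
by rewrite !inordK ?s1_lt ?s2_lt.
Qed.

Lemma encode_list_config F :
  encode_config (list_config F) = [seq nat_of_bool (F z) | z <- zs].
Proof.
rewrite -(map_enum_nth (fun z => nat_of_bool (F z))) /encode_config.
by apply: eq_map => e; rewrite ffunE.
Qed.

Lemma list_configP (C : config list_graph) : exists F, C = list_config F.
Proof.
exists (fun z => [exists e : 'I_(size zs), (nth z0 zs e == z) && C e]).
apply/ffunP => e; rewrite ffunE; apply/idP/existsP => [Ce|[e' /andP[/eqP E Ce']]].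
  by exists e; rewrite eqxx.
suff <- : e' = e by [].
by apply/val_inj/eqP; rewrite /= -(nth_uniq z0 (ltn_ord e') (ltn_ord e) zs_uniq) E.
Qed.

Definition head_label (F : T -> bool) (z : T) := if F z then s2 z else s1 z.

Lemma list_legal F :
  legal (list_config F) =
  all (fun v => infl v <= \sum_(z <- zs | head_label F z == v) wt z)
      (iota 0 nv1.+1).
Proof.
have E v : v < nv1.+1 ->
    \sum_(z <- zs | head_label F z == v) wt z =
    \sum_(e : 'I_(size zs) | head_of (list_config F) e == inord v :> 'I_nv1.+1) wt (nth z0 zs e).
  move=> vn; rewrite (big_nth z0) big_mkord; apply: eq_bigl => e.
  have zin : nth z0 zs e \in zs by rewrite mem_nth.
  rewrite /head_label /head_of ffunE /= -val_eqE /= inordK //.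
  by case: (F _); rewrite inordK ?s1_lt ?s2_lt.
apply/forallP/allP => [H v|H v].
  rewrite mem_iota add0n => /= vn; rewrite E //.
  by have := H (inord v); rewrite /= inordK.
have vn := ltn_ord v; have := H v; rewrite mem_iota add0n => /(_ vn).
by rewrite E //= inord_val.
Qed.

Lemma list_reversal F F' z :
  z \in zs -> F' z = ~~ F z -> {in zs, forall y, y != z -> F' y = F y} ->
  reversal (list_config F) (list_config F').
Proof.
move=> zin Fz Fy; have iz : index z zs < size zs by rewrite index_mem.
rewrite /reversal (_ : [set e | _] = [set Ordinal iz]) ?cards1 //.
apply/setP => e; rewrite !inE !ffunE -val_eqE /=.
case: (eqVneq (nth z0 zs e) z) => [E|ne].
  have Ee : val e = index z zs by rewrite -E index_uniq.
  by rewrite E Fz Ee eqxx; case: (F z).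
rewrite Fy ?mem_nth // eqxx; apply/esym/negbTE; apply: contraNneq ne => ->.
by rewrite nth_index.
Qed.

Lemma reversal_inj F F' y z :
  reversal (list_config F) (list_config F') -> y \in zs -> z \in zs ->
  F y != F' y -> F z != F' z -> y = z.
Proof.
move=> /cards1P[e He] yin zin Hy Hz.
have iy : index y zs < size zs by rewrite index_mem.
have iz : index z zs < size zs by rewrite index_mem.
have : Ordinal iy \in [set e] by rewrite -He inE !ffunE /= nth_index.
have : Ordinal iz \in [set e] by rewrite -He inE !ffunE /= nth_index.
rewrite !inE => /eqP<- /eqP/(congr1 val) /= E.
by rewrite -(nth_index z0 yin) E nth_index.
Qed.

Lemma list_graph_wf :
  {in zs, forall z, 0 < wt z} -> {in zs, forall z, s1 z != s2 z} ->
  {in zs &, forall y z, (s1 y, s2 y) = (s1 z, s2 z) \/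
                        (s1 y, s2 y) = (s2 z, s1 z) -> y = z} ->
  cgraph_wf list_graph.
Proof.
move=> Hw Hne Hinj; split=> [e|e|e e'] /=.
- by rewrite Hw ?mem_nth.
- by rewrite -val_eqE /= !inordK ?s1_lt ?s2_lt ?Hne ?mem_nth.
set a := inord _; set b := inord _; set a' := inord _; set b' := inord _ => E.
have nab : a != b by rewrite -val_eqE /= !inordK ?s1_lt ?s2_lt ?Hne ?mem_nth.
apply/val_inj/eqP; rewrite -(nth_uniq z0 (ltn_ord e) (ltn_ord e') zs_uniq); apply/eqP.
apply: Hinj; [exact: (mem_nth z0 (ltn_ord e))|exact: (mem_nth z0 (ltn_ord e'))|].
have Ha : a \in [set a'; b'] by rewrite -E set21.
have Hb : b \in [set a'; b'] by rewrite -E set22.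
have [va vb va' vb'] : [/\ val a = s1 (nth z0 zs e), val b = s2 (nth z0 zs e),
    val a' = s1 (nth z0 zs e') & val b' = s2 (nth z0 zs e')].
  by rewrite /= !inordK ?s1_lt ?s2_lt ?mem_nth.
suff : (val a, val b) = (val a', val b') \/ (val a, val b) = (val b', val a').
  by rewrite va vb va' vb'.
case/set2P: Ha nab => ->; case/set2P: Hb => ->; rewrite ?eqxx //.
  by left.
by right.
Qed.

End ListGraph.

(** The problems ask for some graph with the given code, so soundness requires that no other graph
    has it. The records are identified component by component, their maps by functional
    extensionality; the remainders [r] and [r'] allow the code to be read off as a prefix. *)
Lemma encode_cgraph_inj (G G' : cgraph) r r' :
  encode_cgraph G ++ r = encode_cgraph G' ++ r' -> G = G' /\ r = r'.
Proof.
case: G => n m a b w f; case: G' => n' m' a' b' w' f'.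
rewrite /encode_cgraph -!catA /= => -[En Em]; case: _ / En in a' b' f' *.
case: _ / Em in a' b' w' *; move/eqP.
rewrite eqseq_cat; last by rewrite !size_map.
case/andP => /eqP/eq_in_map Ef.
have sz (g : 'I_m -> seq nat) : (forall e, size (g e) = 3) ->
    size (flatten [seq g e | e <- enum 'I_m]) = 3 * m.
  move=> Hg; rewrite size_flatten /shape -map_comp.
  rewrite (eq_map (g := fun=> 3)) => [|e]; last exact: Hg.
  have -> (s : seq 'I_m) : [seq 3 | _ <- s] = nseq (size s) 3 by elim: s => //= ? ? ->.
  by rewrite sumn_nseq size_enum_ord.
rewrite eqseq_cat; last by rewrite !sz.
case/andP => /eqP E /eqP->; split=> //.
have {E}/eq_in_map E : [seq [:: val (a e); val (b e); w e] | e <- enum 'I_m] =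
   [seq [:: val (a' e); val (b' e); w' e] | e <- enum 'I_m].
  apply: eq_from_flatten_shape => //; rewrite /shape -!map_comp.
  exact: eq_map.
have Ea : a = a'.
  by apply: functional_extensionality => e; apply/val_inj; case: (E e (mem_enum _ e)).
have Eb : b = b'.
  by apply: functional_extensionality => e; apply/val_inj; case: (E e (mem_enum _ e)).
have Ew : w = w'.
  by apply: functional_extensionality => e; case: (E e (mem_enum _ e)).
have Ef' : f = f'.
  by apply: functional_extensionality => v; apply: Ef; rewrite mem_enum.
by rewrite Ea Eb Ew Ef'.
Qed.

Lemma encode_config_inj (G : cgraph) (C C' : config G) r r' :
  encode_config C ++ r = encode_config C' ++ r' -> C = C' /\ r = r'.
Proof.
move/eqP; rewrite eqseq_cat ?size_map // => /andP[/eqP/eq_in_map E /eqP->].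
split=> //; apply/ffunP => e.
by have := E e (mem_enum _ e); case: (C e); case: (C' e).
Qed.

Lemma times_reversed_gt0 (G : cgraph) (C : config G) s e :
  (0 < times_reversed C s e) = has (fun D : config G => D e != C e) s.
Proof.
rewrite /times_reversed; elim: s C => //= D s IH C.
rewrite addn_gt0 lt0b IH eq_sym; case: (eqVneq (D e) (C e)) => //= E.
by rewrite E.
Qed.

Lemma reversal_sym (G : cgraph) : symmetric (@reversal G).
Proof.
move=> C C'; rewrite /reversal; congr (_ == 1); apply: eq_card => e.
by rewrite !inE eq_sym.
Qed.

(** * The gadget: exact sums of nonnegative vectors *)

Section Gadget.

Variables (I J : nat) (w : nat -> nat -> nat) (T : nat -> nat).
Hypotheses (w_gt0 : forall i c, i < I -> c < J -> 0 < w i c)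
           (T_gt0 : forall c, c < J -> 0 < T c) (J_gt0 : 0 < J).

(* Edge (0, i, 0) joins the pool to item i, (1, i, c) item i to column c, (2, 0, c)
   column c to the collector, (3, 0, 0) is the goal edge, and (4, 0, 0), (5, 0, 0),
   (6, 0, 0) form the latch, a triangle at the far end of the goal edge. *)
Definition label : eqType := ((nat * nat) * nat)%type.

Definition edges : seq label :=
  [seq (0, i, 0) | i <- iota 0 I] ++
  [seq (1, i, c) | i <- iota 0 I, c <- iota 0 J] ++
  [seq (2, 0, c) | c <- iota 0 J] ++
  [:: (3, 0, 0); (4, 0, 0); (5, 0, 0); (6, 0, 0)].

Definition row_sum i := \sum_(c <- iota 0 J) w i c.
Definition goal_total := \sum_(c <- iota 0 J) T c.

Definition src (z : label) : nat :=
  match z.1.1 with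
  | 0 => J + I | 1 => J + z.1.2 | 2 => z.2 | 3 => J + I + 1
  | 4 => J + I + 2 | 5 => J + I + 3 | _ => J + I + 4
  end.

Definition dst (z : label) : nat :=
  match z.1.1 with
  | 0 => J + z.1.2 | 1 => z.2 | 2 => J + I + 1 | 3 => J + I + 2
  | 4 => J + I + 3 | 5 => J + I + 4 | _ => J + I + 2
  end.

Definition wgt (z : label) : nat :=
  match z.1.1 with
  | 0 => row_sum z.1.2 | 1 => w z.1.2 z.2 | 2 => T z.2 | 3 => goal_total | _ => 1
  end.

(** The pool can lose [goal_total], or everything if the subtraction truncates. At an item the pool
    edge weighs as much as all column edges together, and at the collector the goal edge as much as
    all edges from the columns, so that either side alone meets the demand. *)
Definition demand (v : nat) : nat :=
  if v < J then T v else if v < J + I then row_sum (v - J) else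
  if v == J + I then \sum_(i <- iota 0 I) row_sum i - goal_total else
  if v == J + I + 1 then goal_total else 1.

Lemma mem_labels t (r r' : seq nat) i c :
  [/\ ((t, i, c) \in [seq (0, i, 0) | i <- r]) = [&& t == 0, i \in r & c == 0],
      ((t, i, c) \in [seq (1, i, c) | i <- r, c <- r']) = [&& t == 1, i \in r & c \in r'] &
      ((t, i, c) \in [seq (2, 0, c) | c <- r']) = [&& t == 2, i == 0 & c \in r']].
Proof.
split.
- apply/mapP/and3P => [[j jr [-> -> ->]] //|[/eqP-> ir /eqP->]]; by exists i.
- apply/allpairsP/and3P => [[[j d]] /= [jr dr [-> -> ->]] //|[/eqP-> ir cr]].
  by exists (i, c).
- apply/mapP/and3P => [[j jr [-> -> ->]] //|[/eqP-> /eqP-> cr]]; by exists c.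
Qed.

Lemma mem_edges t i c : ((t, i, c) \in edges) =
  match t with
  | 0 => (i < I) && (c == 0) | 1 => (i < I) && (c < J) | 2 => (i == 0) && (c < J)
  | 3 | 4 | 5 | 6 => (i == 0) && (c == 0) | _ => false
  end.
Proof.
have [E0 E1 E2] := mem_labels t (iota 0 I) (iota 0 J) i c.
rewrite /edges !mem_cat E0 E1 E2 !inE !xpair_eqE !mem_iota.
by case: t {E0 E1 E2} => [|[|[|[|[|[|[|t]]]]]]] /=; rewrite ?orbF.
Qed.

Lemma edges_uniq : uniq edges.
Proof.
have U1 : uniq [seq ((0, i, 0) : label) | i <- iota 0 I].
  by rewrite map_inj_uniq ?iota_uniq // => ? ? [].
have U2 : uniq [seq ((1, i, c) : label) | i <- iota 0 I, c <- iota 0 J].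
  by rewrite allpairs_uniq ?iota_uniq // => -[? ?] [? ?] _ _ [-> ->].
have U3 : uniq [seq ((2, 0, c) : label) | c <- iota 0 J].
  by rewrite map_inj_uniq ?iota_uniq // => ? ? [].
rewrite /edges !cat_uniq U1 U2 U3 !andTb !andbT; apply/and3P; split; apply/hasPn => -[[t i] c].
- rewrite !mem_cat => /or3P[/allpairsP[] [j d] [_ _ [-> _ _]]|/mapP[j _ [-> _ _]]|].
  + by apply/mapP => -[].
  + by apply/mapP => -[].
  + by rewrite !inE !xpair_eqE => H; apply/mapP => -[j _ [E _ _]]; move: H; rewrite E.
- rewrite !mem_cat => /orP[/mapP[j _ [-> _ _]]|].
  + by apply/allpairsP => -[[? ?] [_ _]].
  + rewrite !inE !xpair_eqE => H; apply/allpairsP => -[[? ?] [_ _ [E _ _]]].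
    by move: H; rewrite E.
- by rewrite !inE !xpair_eqE => H; apply/mapP => -[j _ [E _ _]]; move: H; rewrite E.
Qed.

Lemma src_lt z : z \in edges -> src z < (J + I + 4).+1.
Proof.
case: z => [[t i] c]; rewrite mem_edges /src /=.
by case: t => [|[|[|[|[|[|[|t]]]]]]] //=; lia.
Qed.

Lemma dst_lt z : z \in edges -> dst z < (J + I + 4).+1.
Proof.
case: z => [[t i] c]; rewrite mem_edges /dst /=.
by case: t => [|[|[|[|[|[|[|t]]]]]]] //=; lia.
Qed.

Definition gadget : cgraph :=
  list_graph (0, 0, 0) edges src dst wgt (J + I + 4) demand.

Definition conf (F : label -> bool) : config gadget :=
  @list_config label (0, 0, 0) edges src dst wgt (J + I + 4) demand F.

Lemma total_gt0 : 0 < goal_total.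
Proof.
rewrite /goal_total; case: J J_gt0 T_gt0 => // n _ H.
by rewrite big_cons addn_gt0 H.
Qed.

Lemma row_sum_gt0 i : i < I -> 0 < row_sum i.
Proof.
move=> iI; rewrite /row_sum; case: J J_gt0 w_gt0 => // n _ H.
by rewrite big_cons addn_gt0 H.
Qed.

Lemma gadget_wf : cgraph_wf gadget.
Proof.
apply: list_graph_wf; [exact: edges_uniq|exact: src_lt|exact: dst_lt| | |].
- move=> [[t i] c]; rewrite mem_edges /wgt /=.
  case: t => [|[|[|[|[|[|[|t]]]]]]] //=.
  + by case/andP => /row_sum_gt0.
  + by case/andP; exact: w_gt0.
  + by case/andP => _; exact: T_gt0.
  + by move=> _; exact: total_gt0.
- move=> [[t i] c]; rewrite mem_edges /src /dst /=.
  by case: t => [|[|[|[|[|[|[|t]]]]]]] //=; lia.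
- move=> [[t i] c] [[t' i'] c']; rewrite !mem_edges /src /dst /=.
  case: t => [|[|[|[|[|[|[|t]]]]]]] //= H; case: t' => [|[|[|[|[|[|[|t']]]]]]] //= H' [];
  move/eqP; rewrite xpair_eqE => /andP[E E'];
  first [by exfalso; lia | by apply/eqP; rewrite !xpair_eqE /=; lia].
Qed.

Lemma sum_if_eq n m (f : nat -> nat) :
  \sum_(i <- iota 0 n) (if i == m then f i else 0) = if m < n then f m else 0.
Proof.
case: ltnP => mn.
  rewrite (bigD1_seq m) ?iota_uniq ?mem_iota //= eqxx big1 ?addn0 // => i.
  by move/negPf->.
rewrite big_seq big1 // => i; rewrite mem_iota add0n => /= ni.
by rewrite ifF //; lia.
Qed.

Lemma sum0 (r : seq nat) (f : nat -> nat) :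
  {in r, forall i, f i = 0} -> \sum_(i <- r) f i = 0.
Proof. by move=> H; rewrite big_seq big1. Qed.

Lemma eq_if b (x y v : nat) :
  ((if b then x else y) == v) = (if b then x == v else y == v).
Proof. by case: b. Qed.

Lemma inflow_sum F v :
  \sum_(z <- edges | head_label src dst F z == v) wgt z =
  \sum_(i <- iota 0 I) (if (if F (0, i, 0) then J + i else J + I) == v
     then row_sum i else 0) +
  (\sum_(i <- iota 0 I) \sum_(c <- iota 0 J)
     (if (if F (1, i, c) then c else J + i) == v then w i c else 0) +
  (\sum_(c <- iota 0 J) (if (if F (2, 0, c) then J + I + 1 else c) == v then T c else 0) +
  ((if (if F (3, 0, 0) then J + I + 2 else J + I + 1) == v then goal_total else 0) +
   (((if F (4, 0, 0) then J + I + 3 else J + I + 2) == v) +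
   (((if F (5, 0, 0) then J + I + 4 else J + I + 3) == v) +
    ((if F (6, 0, 0) then J + I + 2 else J + I + 4) == v)))))).
Proof.
rewrite big_mkcond /edges !big_cat big_map big_allpairs_dep big_map !big_cons big_nil.
by rewrite /head_label /src /dst /wgt /=; do !congr (_ + _); rewrite ?addn0; case: ifP => //; case: ifP.
Qed.

(** [F z] says that [z] is reversed relative to the orientation in which every edge points to its
    [src]. [Y], the far end of the goal edge, [H] and [P] are the corners of the latch: as long as
    the goal edge is not reversed, latch edge 4 being turned implies 6, 6 implies 5, and 5 implies
    4. *)
Record legal_spec (F : label -> bool) : Prop := LegalSpec {
  legal_col : forall c, c < J -> T c <=
    \sum_(i <- iota 0 I) (if F (1, i, c) then w i c else 0) +
    (if F (2, 0, c) then 0 else T c);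
  legal_item : forall i, i < I -> row_sum i <=
    (if F (0, i, 0) then row_sum i else 0) +
    \sum_(c <- iota 0 J) (if F (1, i, c) then 0 else w i c);
  legal_pool : \sum_(i <- iota 0 I) row_sum i - goal_total <=
    \sum_(i <- iota 0 I) (if F (0, i, 0) then 0 else row_sum i);
  legal_goal : goal_total <= \sum_(c <- iota 0 J) (if F (2, 0, c) then T c else 0) +
    (if F (3, 0, 0) then 0 else goal_total);
  legal_Y : 0 < (if F (3, 0, 0) then goal_total else 0) + (~~ F (4, 0, 0) + F (6, 0, 0));
  legal_H : F (4, 0, 0) || ~~ F (5, 0, 0);
  legal_P : F (5, 0, 0) || ~~ F (6, 0, 0)
}.

Lemma legal_gadget F : legal (conf F) <-> legal_spec F.
Proof.
rewrite /conf list_legal; [|exact: src_lt|exact: dst_lt].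
have iota_lt n i : i \in iota 0 n -> i < n by rewrite mem_iota.
have Ecol c : c < J -> \sum_(z <- edges | head_label src dst F z == c) wgt z =
    \sum_(i <- iota 0 I) (if F (1, i, c) then w i c else 0) +
    (if F (2, 0, c) then 0 else T c).
  move=> cJ; rewrite inflow_sum sum0 => [|i /iota_lt iI]; last first.
    by rewrite ifF //; case: ifP; lia.
  have eJI j : 0 < j -> (J + I + j == c) = false by lia.
  rewrite !eq_if !eJI // !if_same !addn0 add0n; congr (_ + _).
    apply: eq_big_seq => i /iota_lt iI.
    have := sum_if_eq J c (fun c => if F (1, i, c) then w i c else 0).
    rewrite cJ => <-; apply: eq_bigr => d _.
    by case: (F _); [case: ifP | rewrite ifF; [rewrite if_same | lia]].
  have := sum_if_eq J c (fun c => if F (2, 0, c) then 0 else T c).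
  rewrite cJ => <-; apply: eq_bigr => d _.
  by case: (F _); [rewrite ifF; [rewrite if_same | lia] | case: ifP].
have Eitem m : m < I -> \sum_(z <- edges | head_label src dst F z == J + m) wgt z =
    (if F (0, m, 0) then row_sum m else 0) +
    \sum_(c <- iota 0 J) (if F (1, m, c) then 0 else w m c).
  move=> mI; rewrite inflow_sum.
  have eJI j : 0 < j -> (J + I + j == J + m) = false by lia.
  rewrite !eq_if !eJI // !if_same [X in _ + (_ + (X + _))]sum0 ?addn0; last first.
    by move=> c /iota_lt cJ; rewrite eq_if eJI // ifF //; case: (F _) => //; lia.
  congr (_ + _).
    have := sum_if_eq I m (fun i => if F (0, i, 0) then row_sum i else 0).
    rewrite mI => <-; apply: eq_bigr => i _; rewrite eq_if eqn_add2l.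
    by case: (F _); [case: ifP | rewrite ifF; [rewrite if_same | lia]].
  have := sum_if_eq I m (fun i => \sum_(c <- iota 0 J) if F (1, i, c) then 0 else w i c).
  rewrite mI => <-; apply: eq_bigr => i _; case: (eqVneq i m) => im.
    apply: eq_big_seq => c /iota_lt cJ; rewrite eq_if im eqxx.
    by case: (F _) => //; rewrite ifF //; lia.
  apply: sum0 => c /iota_lt cJ; rewrite eq_if ifF //.
  by case: (F _); move: im; lia.
have EA : \sum_(z <- edges | head_label src dst F z == J + I) wgt z =
    \sum_(i <- iota 0 I) (if F (0, i, 0) then 0 else row_sum i).
  rewrite inflow_sum.
  have eJI j : 0 < j -> (J + I + j == J + I) = false by lia.
  rewrite !eq_if !eJI // !if_same [X in _ + (_ + (X + _))]sum0 ?addn0; last first.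
    by move=> c /iota_lt cJ; rewrite eq_if eJI // ifF //; case: (F _) => //; lia.
  rewrite [X in _ + X]sum0 ?addn0; last first.
    move=> i /iota_lt iI; apply: sum0 => c /iota_lt cJ; rewrite eq_if ifF //.
    by case: (F _); lia.
  apply: eq_big_seq => i /iota_lt iI; rewrite eq_if eqxx.
  by case: (F _) => //; rewrite ifF //; lia.
have ES v : J + I < v -> \sum_(z <- edges | head_label src dst F z == v) wgt z =
    (if v == J + I + 1 then \sum_(c <- iota 0 J) (if F (2, 0, c) then T c else 0) else 0) +
    ((if (if F (3, 0, 0) then J + I + 2 else J + I + 1) == v then goal_total else 0) +
     (((if F (4, 0, 0) then J + I + 3 else J + I + 2) == v) +
      (((if F (5, 0, 0) then J + I + 4 else J + I + 3) == v) +
       ((if F (6, 0, 0) then J + I + 2 else J + I + 4) == v)))).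
  move=> vJI; rewrite inflow_sum sum0 ?add0n; last first.
    by move=> i /iota_lt iI; rewrite eq_if ifF //; case: (F _); lia.
  rewrite sum0 ?add0n; last first.
    move=> i /iota_lt iI; apply: sum0 => c /iota_lt cJ; rewrite eq_if ifF //.
    by case: (F _); lia.
  congr (_ + _); case: eqP => [->|ne].
    apply: eq_big_seq => c /iota_lt cJ; rewrite eq_if eqxx.
    by case: (F _) => //; rewrite ifF //; lia.
  apply: sum0 => c /iota_lt cJ; rewrite eq_if ifF //.
  by case: (F _); lia.
have Dcol c : c < J -> demand c = T c by rewrite /demand => ->.
have Ditem i : i < I -> demand (J + i) = row_sum i.
  by move=> iI; rewrite /demand ifF ?ifT ?addKn //; lia.
have DA : demand (J + I) = \sum_(i <- iota 0 I) row_sum i - goal_total.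
  by rewrite /demand; do 2![rewrite ifF; last by lia]; rewrite eqxx.
have DZ : demand (J + I + 1) = goal_total.
  by rewrite /demand; do 3![rewrite ifF; last by lia]; rewrite eqxx.
have DL j : 1 < j -> demand (J + I + j) = 1.
  by move=> j1; rewrite /demand; do 4![rewrite ifF; last by lia].
have eqJI j j' : (J + I + j == J + I + j') = (j == j') by rewrite eqn_add2l.
split=> [/allP H|[H1 H2 H3 H4 H5 H6 H7]].
  have {}H v : v < (J + I + 4).+1 -> demand v <= \sum_(z <- edges | head_label src dst F z == v) wgt z.
    by move=> vn; apply: H; rewrite mem_iota.
  split.
  - by move=> c cJ; rewrite -Ecol // -Dcol // H //; lia.
  - by move=> i iI; rewrite -Eitem // -Ditem // H //; lia.
  - by rewrite -EA // -DA H //; lia.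
  - have := H (J + I + 1); rewrite ES; last by lia.
    rewrite DZ !eq_if !eqJI /= !if_same !addn0.
    by case: (F (3, 0, 0)) => /=; apply; lia.
  - have := H (J + I + 2); rewrite ES; last by lia.
    rewrite DL // !eq_if !eqJI /= !if_same !add0n.
    move=> HH; have {}HH := HH (ltac:(lia)); move: HH.
    by case: (F (3, 0, 0)); case: (F (4, 0, 0)); case: (F (6, 0, 0)) => //=; lia.
  - have := H (J + I + 3); rewrite ES; last by lia.
    rewrite DL // !eq_if !eqJI /= !if_same !add0n.
    by case: (F (4, 0, 0)); case: (F (5, 0, 0)) => //=; apply; lia.
  - have := H (J + I + 4); rewrite ES; last by lia.
    rewrite DL // !eq_if !eqJI /= !if_same !add0n.
    by case: (F (5, 0, 0)); case: (F (6, 0, 0)) => //=; apply; lia.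
apply/allP => v /iota_lt vn.
case: (ltnP v J) => [vJ|Jv]; first by rewrite Ecol // Dcol // H1.
case: (ltnP v (J + I)) => [vI|Iv].
  have -> : v = J + (v - J) by lia.
  by rewrite Eitem ?Ditem ?H2 //; lia.
have : [\/ v = J + I, v = J + I + 1, v = J + I + 2 | v = J + I + 3 \/ v = J + I + 4].
  have : v - (J + I) < 5 by lia.
  case E : (v - (J + I)) => [|[|[|[|[|?]]]]] // _.
  - by apply: Or41; lia.
  - by apply: Or42; lia.
  - by apply: Or43; lia.
  - by apply: Or44; left; lia.
  - by apply: Or44; right; lia.
case=> [->|->|->|[]->]; first by rewrite EA DA.
all: rewrite ES ?DZ ?DL //; last by lia.
all: rewrite !eq_if !eqJI /= !if_same ?add0n ?addn0 //.
- by move: H4; case: (F (3, 0, 0)).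
- by move: H5; case: (F (3, 0, 0)); case: (F (4, 0, 0)); case: (F (6, 0, 0)).
- by move: H6; case: (F (4, 0, 0)); case: (F (5, 0, 0)).
- by move: H7; case: (F (5, 0, 0)); case: (F (6, 0, 0)).
Qed.

(** * Soundness: what a reversed goal edge or a moved latch implies *)

Definition exact_sum (X : pred nat) : Prop :=
  forall c, c < J -> \sum_(i <- iota 0 I | X i) w i c = T c.

Lemma iota_lt n i : i \in iota 0 n -> i < n.
Proof. by rewrite mem_iota. Qed.

Lemma sum_if_split (b : pred nat) n (f : nat -> nat) :
  \sum_(i <- iota 0 n) f i =
  \sum_(i <- iota 0 n) (if b i then f i else 0) +
  \sum_(i <- iota 0 n) (if b i then 0 else f i).
Proof. by rewrite -big_split; apply: eq_bigr => i _ /=; case: (b i); rewrite ?addn0. Qed.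

Lemma leq_sum_iota n (f g : nat -> nat) :
  (forall i, i < n -> f i <= g i) ->
  \sum_(i <- iota 0 n) f i <= \sum_(i <- iota 0 n) g i.
Proof.
move=> H; rewrite big_seq [X in _ <= X]big_seq; apply: leq_sum => i /iota_lt.
exact: H.
Qed.

(* The pool can lose at most the sum of the targets, every column must gain at
   least its target, and what a column gains the pool has lost. *)
Lemma goal_flipped_exact F :
  legal_spec F -> F (3, 0, 0) -> exact_sum (fun i => F (0, i, 0)).
Proof.
move=> [Hcol Hit Hpool Hgoal _ _ _] F3; rewrite F3 addn0 in Hgoal.
(* Without the goal edge the collector needs every column edge, since each [T c] is positive. *)
have E2 c : c < J -> F (2, 0, c).
  move=> cJ; apply: contraT => /negPf nF; move: Hgoal.
  rewrite leqNgt /goal_total (sum_if_split (fun c => F (2, 0, c)) J T).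
  rewrite -[X in X < _]addn0 ltn_add2l => /negP[].
  rewrite (bigD1_seq c) ?iota_uniq ?mem_iota //= nF.
  by have := T_gt0 cJ; lia.
(* An item that has given up a positive column weight must be fed by the pool. *)
have E1 i c : i < I -> c < J -> F (1, i, c) -> F (0, i, 0).
  move=> iI cJ F1; apply: contraT => /negPf nF; have := Hit i iI.
  rewrite nF add0n /row_sum leqNgt (sum_if_split (fun c => F (1, i, c)) J (w i)).
  rewrite -[X in X < _]add0n ltn_add2r => /negP[].
  rewrite (bigD1_seq c) ?iota_uniq ?mem_iota //= F1.
  by have := w_gt0 iI cJ; lia.
set X := fun i => F (0, i, 0).
have G c : c < J -> T c <= \sum_(i <- iota 0 I | X i) w i c.
  move=> cJ; have := Hcol c cJ; rewrite E2 // addn0 => /leq_trans; apply.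
  rewrite [X in _ <= X]big_mkcond /=; apply: leq_sum_iota => i iI.
  by case: ifP => // F1; rewrite /X (E1 i c).
have L : \sum_(c <- iota 0 J) \sum_(i <- iota 0 I | X i) w i c <= goal_total.
  rewrite exchange_big /= big_mkcond /=.
  rewrite (_ : \sum_(i <- iota 0 I) _ =
    \sum_(i <- iota 0 I) (if F (0, i, 0) then row_sum i else 0)) //.
  by have := Hpool; rewrite (sum_if_split (fun i => F (0, i, 0)) I row_sum); lia.
move=> c cJ; apply/eqP; rewrite eqn_leq G // andbT.
move: L; rewrite /goal_total !(bigD1_seq c) ?iota_uniq ?mem_iota //=.
set a := \sum_(i <- iota 0 J | _) _; set b := \sum_(i <- iota 0 J | _) _.
suff : b <= a by lia.
rewrite /a /b big_seq_cond [X in _ <= X]big_seq_cond.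
by apply: leq_sum => d /andP[/iota_lt dJ _]; exact: G.
Qed.

Lemma size_edges : size edges = I + I * J + J + 4.
Proof. by rewrite !size_cat !size_map size_allpairs !size_iota /=; lia. Qed.

Lemma goal_edge_lt : I + I * J + J < size edges.
Proof. by rewrite size_edges; lia. Qed.

Definition goal_edge : 'I_(ne gadget) := Ordinal goal_edge_lt.

Lemma nth_goal_edge : nth (0, 0, 0) edges goal_edge = (3, 0, 0).
Proof.
rewrite /= /edges !nth_cat !size_map size_allpairs !size_iota.
do 3![rewrite ifF; last by lia].
by rewrite (_ : _ - _ - _ - _ = 0); last by lia.
Qed.

Definition start : config gadget := conf (fun=> false).

Definition latch : seq label := [:: (4, 0, 0); (5, 0, 0); (6, 0, 0)].

Definition target : config gadget := conf (fun z => z \in latch).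

Lemma goal_reversed_exact s :
  all (@legal gadget) s -> has (fun D : config gadget => D goal_edge != start goal_edge) s ->
  exists X, exact_sum X.
Proof.
move=> /allP Hl /hasP[D Ds]; have := Hl D Ds.
have [F ->] := list_configP edges_uniq D; move=> /legal_gadget HF.
rewrite !ffunE nth_goal_edge => F3; exists (fun i => F (0, i, 0)).
by apply: goal_flipped_exact HF _; case: (F _) F3.
Qed.

(* While the goal edge is not reversed, the three latch edges block each other. *)
Lemma latch_reversed_exact s C : C = start \/ (exists2 F, C = conf F &
    ~~ [|| F (4, 0, 0), F (5, 0, 0) | F (6, 0, 0)]) ->
  all (@legal gadget) s -> path (@reversal gadget) C s -> last C s = target ->
  exists X, exact_sum X.
Proof.
move=> HC Hl Hp Hlast.
case: (boolP (has (fun D : config gadget => D goal_edge != start goal_edge) s)) => [|Hn].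
  exact: goal_reversed_exact.
have {HC} : exists2 F, C = conf F & ~~ [|| F (4, 0, 0), F (5, 0, 0) | F (6, 0, 0)].
  by case: HC => // ->; exists (fun=> false).
elim: s C Hl Hp Hlast Hn => [|D s IH] C /=.
  move=> _ _ -> _ [F /ffunP E] nF; exfalso.
  have i4 : index (4, 0, 0) edges < size edges by rewrite index_mem mem_edges.
  have := E (Ordinal i4); rewrite !ffunE /= nth_index ?mem_edges // !inE /=.
  by move=> F4; rewrite -F4 in nF.
case/andP => lD ls /andP[rD ps] Hlast; rewrite negb_or negbK => /andP[D3 Hn] [F CF nF].
apply: (IH D) => //; have [F' DF'] := list_configP edges_uniq D.
exists F' => //; move: lD; rewrite DF' => /legal_gadget[_ _ _ _ H5 H6 H7].
have F3 : F' (3, 0, 0) = false.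
  by apply/eqP; move: D3; rewrite DF' !ffunE nth_goal_edge.
move: rD; rewrite CF DF' => rD.
(* Legality makes the three latch bits of [F'] equal, so a change would turn edges 4 and 5 in a
   single move. *)
have := @reversal_inj _ _ _ _ _ _ _ _ _ _ (4, 0, 0) (5, 0, 0) rD.
rewrite !mem_edges /=; move: nF H5 H6 H7; rewrite F3 add0n.
case: (F (4, 0, 0)) => //; case: (F (5, 0, 0)) => //; case: (F (6, 0, 0)) => //.
case: (F' (4, 0, 0)); case: (F' (5, 0, 0)); case: (F' (6, 0, 0)) => //= _ _ _ _ H.
by have := H isT isT isT isT.
Qed.

(** * Completeness: reconfiguration sequences from an exact sum *)

Section Completeness.

Variable X : pred nat.
Hypothesis HX : exact_sum X.

Let chosen := filter X (iota 0 I).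

(** The order is that of dependence: the edges of a block may turn once the previous blocks have
    turned. The states of a sequence are given by the prefixes of this list. *)
Definition flips : seq label :=
  [seq (0, i, 0) | i <- chosen] ++
  [seq (1, i, c) | i <- chosen, c <- iota 0 J] ++
  [seq (2, 0, c) | c <- iota 0 J] ++ [:: (3, 0, 0)].

Lemma mem_flips t i c : ((t, i, c) \in flips) =
  match t with
  | 0 => [&& X i, i < I & c == 0] | 1 => [&& X i, i < I & c < J]
  | 2 => (i == 0) && (c < J) | 3 => (i == 0) && (c == 0) | _ => false
  end.
Proof.
have [E0 E1 E2] := mem_labels t chosen (iota 0 J) i c.
rewrite /flips !mem_cat E0 E1 E2 !inE !xpair_eqE !mem_filter !mem_iota -!andbA.
by case: t {E0 E1 E2} => [|[|[|[|t]]]] /=; rewrite ?orbF.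
Qed.

Lemma subseq_flips : subseq flips edges.
Proof.
rewrite /flips /edges; apply: cat_subseq; first exact/map_subseq/filter_subseq.
apply: cat_subseq; last by rewrite cat_subseq //= eqxx.
rewrite /chosen; elim: (iota 0 I) => //= i r IH; case: ifP => _ /=.
  by rewrite cat_subseq.
by apply: subseq_trans IH _; exact: suffix_subseq.
Qed.

Lemma flips_edges : {subset flips <= edges}.
Proof. exact: mem_subseq subseq_flips. Qed.

Lemma flips_uniq : uniq flips.
Proof. exact: subseq_uniq subseq_flips edges_uniq. Qed.

Definition state_of (l m : seq label) : config gadget :=
  conf (fun z => (z \in l) || (z \in m)).

(** A prefix that has passed the block [a] contains all of it; applied to [flips], this says that an
    edge turns only after all the edges on which it depends. *)
Lemma mem_take_cat (A : eqType) n (a b : seq A) z :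
  z \in take n (a ++ b) -> z \notin a -> {subset a <= take n (a ++ b)}.
Proof.
rewrite take_cat; case: ltnP => _ H za; first by rewrite (mem_take H) in za.
by move=> y ya; rewrite mem_cat ya.
Qed.

(* Before the goal edge is reversed, the latch is unmoved (m = 0) or moved
   completely (m = 3). *)
Lemma legal_state n m :
  m \in [:: 0; 3] \/ (3, 0, 0) \in take n flips ->
  legal (state_of (take n flips) (take m latch)).
Proof.
move=> Hm; set l := take n flips in Hm *.
have lf : {subset l <= flips} by move=> z; exact: mem_take.
have c1 i c : (1, i, c) \in l -> (0, i, 0) \in l.
  move=> H; apply: (mem_take_cat H); first by apply/mapP => -[].
  have := lf _ H; rewrite mem_flips => /and3P[Xi iI _].
  by apply/mapP; exists i; rewrite // mem_filter Xi mem_iota.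
have c2 i c : (2, 0, c) \in l -> X i -> i < I -> (1, i, c) \in l.
  move=> H Xi iI; have := lf _ H; rewrite mem_flips /= => cJ.
  rewrite /l /flips catA; rewrite /l /flips catA in H; apply: (mem_take_cat H).
    rewrite mem_cat; apply/negP => /orP[/mapP[]|/allpairsP[[? ?] []]] //.
  rewrite mem_cat; apply/orP; right; apply/allpairsP.
  by exists (i, c); rewrite mem_filter Xi !mem_iota.
have c3 c : (3, 0, 0) \in l -> c < J -> (2, 0, c) \in l.
  move=> H cJ; rewrite /l /flips !catA in H *; apply: (mem_take_cat H).
    rewrite !mem_cat; apply/negP => /orP[/orP[/mapP[]|/allpairsP[[? ?] []]]|/mapP[]] //.
  by rewrite !mem_cat; apply/orP; right; apply/mapP; exists c; rewrite ?mem_iota.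
have lm t i c : t < 4 -> ((t, i, c) \in take m latch) = false.
  by move=> t4; apply/negP => /mem_take; rewrite !inE !xpair_eqE; lia.
have ll t : 3 < t -> ((t, 0, 0) \in l) = false.
  by move=> t3; apply/negP => /lf; rewrite mem_flips; case: t t3 => [|[|[|[|]]]].
apply/legal_gadget; split.
- move=> c cJ; rewrite lm // orbF; case: ifP => H; last by rewrite leq_addl.
  rewrite addn0 -HX // big_mkcond /=; apply: leq_sum_iota => i iI.
  by case: ifP => // Xi; rewrite (c2 i c H).
- move=> i iI; rewrite lm // orbF; case: ifP => H; first by rewrite leq_addr.
  rewrite add0n; apply: leq_sum_iota => c cJ; rewrite lm // orbF ifF //.
  by apply/negP => /c1; rewrite H.
- rewrite (sum_if_split X I row_sum).
  (* Summed over the columns, exactness says that the chosen items weigh [goal_total], which is what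
     the pool can spare. *)
  have -> : goal_total = \sum_(i <- iota 0 I) if X i then row_sum i else 0.
    rewrite -big_mkcond /= /row_sum exchange_big /=; apply: eq_big_seq => c /iota_lt cJ.
    by rewrite HX.
  rewrite addKn; apply: leq_sum_iota => i iI; rewrite lm // orbF.
  case: ifP => // nX; rewrite ifF //; apply/negP => /lf.
  by rewrite mem_flips nX.
- rewrite !lm // !orbF; case: ifP => H; last by rewrite leq_addl.
  by rewrite addn0; apply: leq_sum_iota => c cJ; rewrite lm // orbF c3.
all: rewrite ?(lm 3) ?(ll 4) ?(ll 5) ?(ll 6) ?orbF // !orFb.
- case: Hm => [|->]; last by rewrite ltn_addr ?total_gt0.
  by rewrite !inE => /orP[] /eqP->; rewrite /= addnC.
- by case: m {Hm lm} => [|[|[|[|m]]]].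
- by case: m {Hm lm} => [|[|[|[|m]]]].
Qed.

Lemma latch_flips z : z \in latch -> (z \in flips) = false.
Proof. by rewrite !inE => /or3P[] /eqP->; rewrite mem_flips. Qed.

Lemma state_step n m : n < size flips ->
  reversal (state_of (take n flips) (take m latch))
           (state_of (take n.+1 flips) (take m latch)).
Proof.
move=> nN; have zin : nth (0, 0, 0) flips n \in flips by rewrite mem_nth.
have znm : (nth (0, 0, 0) flips n \in take m latch) = false.
  by apply/negP => /mem_take/latch_flips; rewrite zin.
apply: (list_reversal _ _ _ _ _ _ edges_uniq (flips_edges zin)) => /=.
  rewrite znm !orbF (take_nth (0, 0, 0)) // mem_rcons inE eqxx.
  apply/esym/negP => H; have := flips_uniq.
  rewrite -{1}(cat_take_drop n flips) cat_uniq => /and3P[_ /hasP[]].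
  exists (nth (0, 0, 0) flips n) => //.
  by rewrite (drop_nth (0, 0, 0)) // mem_head.
by move=> y _ /negPf yz; rewrite (take_nth (0, 0, 0)) // mem_rcons inE yz.
Qed.

Lemma latch_step m : m < 3 ->
  reversal (state_of flips (take m latch)) (state_of flips (take m.+1 latch)).
Proof.
move=> m3; have zin : nth (0, 0, 0) latch m \in latch by rewrite mem_nth.
have zz : nth (0, 0, 0) latch m \in edges.
  by case: m m3 {zin} => [|[|[|m]]] // _; rewrite mem_edges.
apply: (list_reversal _ _ _ _ _ _ edges_uniq zz).
- by rewrite latch_flips //=; case: m m3 {zin zz} => [|[|[|m]]].
- move=> y _ /negPf yz; congr (_ || _); rewrite (take_nth (0, 0, 0)) //.
  by rewrite mem_rcons inE yz.
Qed.

Definition run m a b : seq (config gadget) :=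
  [seq state_of (take n flips) (take m latch) | n <- iota a b].

Lemma run_path m a b : a + b <= size flips ->
  path (@reversal gadget) (state_of (take a flips) (take m latch)) (run m a.+1 b).
Proof.
elim: b a => //= b IH a ab; rewrite state_step /=; last by lia.
by apply: IH; lia.
Qed.

Lemma last_run m a b : last (state_of (take a flips) (take m latch)) (run m a.+1 b) =
  state_of (take (a + b) flips) (take m latch).
Proof. by elim: b a => [|b IH] a /=; rewrite ?addn0 // -addSnnS; exact: IH. Qed.

Lemma run_legal m a b : m \in [:: 0; 3] -> all (@legal gadget) (run m a b).
Proof.
by move=> Hm; apply/allP => D /mapP[n _ ->]; apply: legal_state; left.
Qed.

(** Prefixes only grow, so a turned edge stays turned. The bound is 0 for an edge that is already
    turned, which is the form the induction needs. *)
Lemma run_bounded a b e : times_reversed (state_of (take a flips) (take 0 latch))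
    (run 0 a.+1 b) e <= ~~ (state_of (take a flips) (take 0 latch) e).
Proof.
elim: b a => //= b IH a; rewrite /times_reversed /= -/(times_reversed _ _ _).
have := IH a.+1; rewrite !ffunE !orbF.
set y := nth _ edges _.
have : y \in take a flips -> y \in take a.+1 flips.
  by rewrite -{1}(take_takel flips (leqnSn a)) => /mem_take.
case: (y \in take a flips) => [/(_ isT)->|_]; first by [].
by case: (y \in _) => /=; rewrite ?add0n //; lia.
Qed.

Definition c2e_moves := run 0 1 (size flips).

Lemma c2e_complete :
  [/\ reconf start c2e_moves, bounded start c2e_moves,
      0 < times_reversed start c2e_moves goal_edge &
      size c2e_moves = size flips].
Proof.
have Es : start = state_of (take 0 flips) (take 0 latch) by rewrite take0.
split.
- rewrite /reconf Es run_path // andbT /= run_legal // andbT.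
  exact: (legal_state (or_introl (mem_head 0 [:: 3]))).
- move=> e; rewrite Es; apply: leq_trans (run_bounded 0 (size flips) e) _.
  by case: (~~ _).
- rewrite times_reversed_gt0; apply/hasP.
  exists (state_of (take (size flips) flips) (take 0 latch)).
    apply/mapP; exists (size flips) => //; rewrite mem_iota add1n ltnSn andbT.
    by rewrite lt0n size_eq0; apply/eqP => E; have := mem_flips 3 0 0; rewrite E.
  by rewrite !ffunE nth_goal_edge take_size mem_flips.
- by rewrite size_map size_iota.
Qed.

(** With the latch turned, the whole run is undone, so that only the latch remembers it. [belast]
    leaves out the full state, which the last latch move has already reached. *)
Definition c2c_moves := c2e_moves ++
  [seq state_of flips (take m latch) | m <- [:: 1; 2; 3]] ++
  rev (belast target (run 3 1 (size flips))).

Lemma c2c_complete :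
  [/\ reconf start c2c_moves, last start c2c_moves = target &
      size c2c_moves = (size flips).*2 + 3].
Proof.
have [/andP[L1 P1] _ _ S1] := c2e_complete.
have Es : start = state_of (take 0 flips) (take 0 latch) by rewrite take0.
have Et : target = state_of (take 0 flips) (take 3 latch) by rewrite take0.
have lastE : last start c2e_moves = state_of flips (take 0 latch).
  by rewrite Es /c2e_moves last_run add0n take_size.
have lastT : last target (run 3 1 (size flips)) = state_of flips (take 3 latch).
  by rewrite Et last_run add0n take_size.
have fl : (3, 0, 0) \in take (size flips) flips by rewrite take_size mem_flips.
have szb : size (belast target (run 3 1 (size flips))) = size flips.
  by rewrite size_belast size_map size_iota.
have s0 : 0 < size flips by case: flips fl.
split.
- have legalm m : legal (state_of flips (take m latch)).
    by rewrite -{1}[flips]take_size; apply: legal_state; right.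
  have pm : path (@reversal gadget) (state_of flips (take 0 latch))
      [seq state_of flips (take m latch) | m <- [:: 1; 2; 3]].
    by rewrite /= (@latch_step 0 isT) (@latch_step 1 isT) (@latch_step 2 isT).
  have lm : all (@legal gadget) [seq state_of flips (take m latch) | m <- [:: 1; 2; 3]].
    by rewrite all_map; apply/allP => m _; exact: legalm.
  rewrite /reconf /c2c_moves -cat_cons !all_cat L1 lm !cat_path P1 lastE pm.
  rewrite (_ : last _ [seq _ | m <- _] = last target (run 3 1 (size flips))); last by rewrite lastT.
  rewrite (eq_path (e' := fun x y => reversal y x)) => [|D D']; last exact: reversal_sym.
  rewrite rev_path Et run_path // !andbT /= all_rev.
  apply/allP => D /mem_belast; rewrite inE => /orP[/eqP->|].
    exact: (legal_state (or_introl (mem_last 0 [:: 3]))).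
  by apply/allP; exact: run_legal.
- rewrite /c2c_moves !last_cat lastE /=.
  case E : (run 3 1 (size flips)) szb s0 => [|D r] /=; first by move=> <-.
  by rewrite rev_cons last_rcons.
- by rewrite /c2c_moves size_cat size_cat size_rev szb S1 /= -addnn; lia.
Qed.

Lemma size_flips : size flips = count X (iota 0 I) + count X (iota 0 I) * J + J + 1.
Proof.
by rewrite !size_cat !size_map size_allpairs !size_iota /chosen !size_filter /=; lia.
Qed.

End Completeness.

(** * The encoded instances and their correctness *)

Lemma legal_start_target : legal start /\ legal target.
Proof.
by split; apply/legal_gadget; split=> //=; try (by move=> *; rewrite leq_addl);
  rewrite leq_subr.
Qed.

Definition gadget_word : seq nat :=
  [:: (J + I + 4).+1; I + I * J + J + 4] ++
  [seq demand v | v <- iota 0 (J + I + 4).+1] ++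
  flatten [seq [:: src z; dst z; wgt z] | z <- edges].

Lemma encode_gadget : encode_cgraph gadget = gadget_word.
Proof. by rewrite (encode_list_graph _ _ _ src_lt dst_lt) size_edges. Qed.

Definition c2e_word := gadget_word ++ (I + I * J + J) :: nseq (I + I * J + J + 4) 0.

Definition c2c_word :=
  gadget_word ++ nseq (I + I * J + J + 4) 0 ++
  nseq (I + I * J + J + 1) 0 ++ [:: 1; 1; 1].

Lemma encode_start : encode_config start = nseq (I + I * J + J + 4) 0.
Proof.
rewrite encode_list_config -size_edges.
by elim: edges => //= z r ->.
Qed.

Lemma encode_target :
  encode_config target = nseq (I + I * J + J + 1) 0 ++ [:: 1; 1; 1].
Proof.
rewrite encode_list_config.
pose r : seq label := [seq (0, i, 0) | i <- iota 0 I] ++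
  [seq (1, i, c) | i <- iota 0 I, c <- iota 0 J] ++
  [seq (2, 0, c) | c <- iota 0 J] ++ [:: (3, 0, 0)].
have Ez : edges = r ++ latch by rewrite /edges /r -!catA.
rewrite Ez map_cat; congr (_ ++ _).
have -> : I + I * J + J + 1 = size r.
  by rewrite !size_cat !size_map size_allpairs !size_iota !addnA.
have : {in r, forall z, z \notin latch}.
  move=> z zr; apply/negP => zl; have := edges_uniq.
  by rewrite Ez cat_uniq => /and3P[_ /hasP[]]; exists z.
elim: r {Ez} => //= z r IH H; rewrite (negPf (H z (mem_head _ _))) IH //.
by move=> y yr; apply: H; rewrite inE yr orbT.
Qed.

Section Correctness.

Variable l : nat.
Hypothesis Hl : forall X, exact_sum X -> (exists X, exact_sum X /\
  (count X (iota 0 I) + count X (iota 0 I) * J + J + 1).*2 + 3 <= l).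

(** The types of the edge and of the configuration depend on the graph, so all three are compared as
    one dependent pair, along which [c2e_word_sound] transports the statement for the gadget. *)
Lemma c2e_word_inj G e (C1 : config G) :
  c2e_word = encode_cgraph G ++ val e :: encode_config C1 ->
  existT (fun G => ('I_(ne G) * config G)%type) gadget (goal_edge, start) =
  existT (fun G => ('I_(ne G) * config G)%type) G (e, C1).
Proof.
rewrite /c2e_word -encode_gadget -encode_start => /encode_cgraph_inj[EG].
case: _ / EG in e C1 *; rewrite -[encode_config C1]cats0 -[encode_config start]cats0.
case=> Ee /encode_config_inj[<- _]; congr existT; congr (_, _).
exact: val_inj.
Qed.

Lemma c2e_word_sound G e (C1 : config G) s :
  c2e_word = encode_cgraph G ++ val e :: encode_config C1 ->
  reconf C1 s -> 0 < times_reversed C1 s e -> exists X, exact_sum X.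
Proof.
move=> /c2e_word_inj E.
have {E} : forall (P : forall G, 'I_(ne G) -> config G -> Prop),
    P gadget goal_edge start -> P G e C1.
  move=> P; rewrite -[P G e C1]/((fun T => P (projT1 T) (projT2 T).1 (projT2 T).2)
    (existT (fun G => ('I_(ne G) * config G)%type) G (e, C1))).
  by rewrite -E.
move=> /(_ (fun G e C1 => forall s, reconf C1 s -> 0 < times_reversed C1 s e ->
   exists X, exact_sum X)); apply => {}s /andP[/andP[_ Ls] _].
by rewrite times_reversed_gt0; exact: goal_reversed_exact.
Qed.

(** [exact_sum] does not limit the number of chosen items, on which the length of the sequence
    depends; [Hl] replaces a given exact sum by one that is short enough. *)
Lemma c2e_word_correct :
  (C2E_NCL c2e_word l <-> exists X, exact_sum X) /\
  (bounded_C2E_NCL c2e_word l <-> exists X, exact_sum X).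
Proof.
split; split=> [[G [e [C1 [_ _ E [s]]]]]|[X0 /Hl[X [HX lX]]]].
- by case=> rs ts _; exact: c2e_word_sound E rs ts.
- have [r b t sz] := c2e_complete HX; exists gadget, goal_edge, start.
  split; rewrite ?encode_gadget ?encode_start ?(proj1 legal_start_target) //.
    exact: gadget_wf.
  by exists (c2e_moves X); split; rewrite // sz size_flips; lia.
- by case=> rs _ ts _; exact: c2e_word_sound E rs ts.
have [r b t sz] := c2e_complete HX; exists gadget, goal_edge, start.
split; rewrite ?encode_gadget ?encode_start ?(proj1 legal_start_target) //.
  exact: gadget_wf.
by exists (c2e_moves X); split; rewrite // sz size_flips; lia.
Qed.

Lemma c2c_word_correct : C2C_NCL c2c_word l <-> exists X, exact_sum X.
Proof.
split=> [[G [C1 [C2 [_ _ _ E [s [rs ls _]]]]]]|[X0 /Hl[X [HX lX]]]].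
  move: E; rewrite /c2c_word -encode_gadget -encode_start -encode_target.
  case/encode_cgraph_inj => EG; case: _ / EG in C1 C2 s rs ls *.
  case/encode_config_inj => E1; rewrite -[encode_config C2]cats0 -[encode_config target]cats0.
  case/encode_config_inj => E2 _; move: rs ls; rewrite -E1 -E2 => /andP[/andP[_ Ls] Ps].
  exact: latch_reversed_exact (or_introl erefl) Ls Ps.
exists gadget, start, target; split;
  [exact: gadget_wf|exact: (proj1 legal_start_target)|
  exact: (proj2 legal_start_target)| |].
  by rewrite encode_gadget encode_start encode_target.
have [r t sz] := c2c_complete HX; exists (c2c_moves X); split=> //.
by rewrite sz size_flips.
Qed.

End Correctness.

End Gadget.

(** * Vectors of digits *)

(** The first digit runs fastest, so the position in the list is the value [rank] in mixed radix,
    least significant digit first. This translates between the numbered items and columns of the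
    gadget and the vectors that index the system. *)
Fixpoint vecs (rs : seq nat) : seq (seq nat) :=
  if rs is r :: rs' then [seq i :: t | t <- vecs rs', i <- iota 0 r] else [:: [::]].

Fixpoint rank (rs t : seq nat) : nat :=
  match rs, t with
  | r :: rs', i :: t' => r * rank rs' t' + i
  | _, _ => 0
  end.

Definition volume (rs : seq nat) : nat := foldr muln 1 rs.

Lemma size_vecs rs : size (vecs rs) = volume rs.
Proof. by elim: rs => //= r rs IH; rewrite size_allpairs size_iota IH mulnC. Qed.

Lemma mem_vecs rs t :
  (t \in vecs rs) = (size t == size rs) && all2 ltn t rs.
Proof.
elim: rs t => [|r rs IH] [|i t] //=.
  by apply/allpairsP => -[[? ?] []].
rewrite eqSS andbCA -IH; apply/allpairsP/andP => [[[t' j]] /= [Ht]|[ir Ht]].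
  by rewrite mem_iota => jr [-> ->].
by exists (t, i); rewrite mem_iota.
Qed.

Lemma vecs_uniq rs : uniq (vecs rs).
Proof.
elim: rs => //= r rs IH; rewrite allpairs_uniq ?iota_uniq //.
by move=> [? ?] [? ?] _ _ [-> ->].
Qed.

Lemma allpairs_muln_iota n r :
  [seq r * a + i | a <- iota 0 n, i <- iota 0 r] = iota 0 (n * r).
Proof.
elim: n => // n IH; rewrite -{1}addn1 iotaD map_cat flatten_cat IH /= cats0.
rewrite (_ : n.+1 * r = n * r + r); last by rewrite mulSn addnC.
by rewrite iotaD -[0 + n * r]addn0 iotaDl add0n mulnC.
Qed.

Lemma map_rank_vecs rs : [seq rank rs t | t <- vecs rs] = iota 0 (volume rs).
Proof.
elim: rs => //= r rs IH; rewrite map_allpairs /=.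
by rewrite mulnC -allpairs_muln_iota -IH allpairs_mapl.
Qed.

Lemma rank_nth rs i : i < volume rs -> rank rs (nth [::] (vecs rs) i) = i.
Proof.
move=> ir; rewrite -(nth_map [::] 0) ?size_vecs // map_rank_vecs nth_iota //.
Qed.

Lemma nth_rank rs t : t \in vecs rs -> nth [::] (vecs rs) (rank rs t) = t.
Proof.
move=> tr; have it : index t (vecs rs) < size (vecs rs) by rewrite index_mem.
rewrite -{1}(nth_index [::] tr) rank_nth -?size_vecs //; exact: nth_index.
Qed.

Lemma map_vecs (A : Type) rs (f : nat -> seq nat -> A) :
  [seq f (rank rs t) t | t <- vecs rs] =
  [seq f i (nth [::] (vecs rs) i) | i <- iota 0 (volume rs)].
Proof.
rewrite -map_rank_vecs -map_comp; apply/eq_in_map => t tr /=.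
by rewrite nth_rank.
Qed.

Lemma sum_vecs rs (P : pred (seq nat)) (f : seq nat -> nat) :
  \sum_(i <- iota 0 (volume rs) | P (nth [::] (vecs rs) i)) f (nth [::] (vecs rs) i) =
  \sum_(t <- vecs rs | P t) f t.
Proof.
by rewrite [RHS](big_nth [::]) /index_iota subn0 size_vecs.
Qed.

Lemma vecs_cat r1 r2 :
  vecs (r1 ++ r2) = [seq t1 ++ t2 | t2 <- vecs r2, t1 <- vecs r1].
Proof.
elim: r1 => [|r r1 IH] /=.
  by elim: (vecs r2) => //= t s {1}->.
rewrite IH; elim: (vecs r2) => //= t2 s IHs.
rewrite map_cat flatten_cat IHs; congr (_ ++ _).
by rewrite map_allpairs allpairs_mapl.
Qed.

Lemma sum_vecs_cat r1 r2 (f : seq nat -> nat) :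
  \sum_(t <- vecs (r1 ++ r2)) f t =
  \sum_(t2 <- vecs r2) \sum_(t1 <- vecs r1) f (t1 ++ t2).
Proof. by rewrite vecs_cat big_allpairs_dep. Qed.

Lemma mem_vecs_nseq q r t :
  (t \in vecs (nseq q r)) = (size t == q) && all (fun i => i < r) t.
Proof.
rewrite mem_vecs size_nseq; elim: q t => [|q IH] [|i t] //=.
by rewrite eqSS andbCA IH andbCA.
Qed.

Lemma volume_cat r1 r2 : volume (r1 ++ r2) = volume r1 * volume r2.
Proof. by elim: r1 => [|r r1 IH] /=; rewrite ?mul1n // IH mulnA. Qed.

Lemma volume_nseq q r : volume (nseq q r) = r ^ q.
Proof. by elim: q => //= q ->; rewrite expnS. Qed.

(** * Low degree expansion of a set function *)

Section Expansion.

Variable n : nat.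

(* mobius N true l Z - mobius N false l Z is the iterated difference of the set
   function N at Z in the directions l; the sentinel n is not a direction. *)
Fixpoint mobius (N : seq nat -> nat) (b : bool) (l Z : seq nat) : nat :=
  if l is v :: l' then
    if v == n then mobius N b l' Z
    else mobius N b l' (v :: Z) + mobius N (~~ b) l' Z
  else if b then N Z else 0.

Definition set_fun (N : seq nat -> nat) := forall Z Z', Z =i Z' -> N Z = N Z'.

Fixpoint subs (l : seq nat) : seq (seq nat) :=
  if l is v :: l' then [seq v :: s | s <- subs l'] ++ subs l' else [:: [::]].

(** Moebius inversion with the negative terms moved to the other side. The subsets of [v :: l] with
    and without [v] combine, since the difference in direction [v] at [Z] plus the value at [Z] is
    the value at [v :: Z]. *)
Lemma subs_sum N l Z : set_fun N -> n \notin l ->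
  \sum_(s <- subs l) mobius N true s Z =
  \sum_(s <- subs l) mobius N false s Z + N (l ++ Z).
Proof.
move=> HN; elim: l Z => [|v l IH] Z; first by rewrite /= !big_seq1 add0n.
rewrite inE negb_or eq_sym => /andP[vn nl]; rewrite /= !big_cat !big_map /=.
under eq_bigr do rewrite (negPf vn).
under [in RHS]eq_bigr do rewrite (negPf vn).
rewrite !big_split /= (IH (v :: Z) nl).
rewrite (HN (v :: l ++ Z) (l ++ v :: Z)).
  set A := \sum_(s <- subs l) mobius N false s (v :: Z).
  set B := \sum_(s <- subs l) mobius N false s Z.
  set D := \sum_(s <- subs l) mobius N true s Z; lia.
by move=> y; rewrite !(inE, mem_cat) orbCA.
Qed.

Lemma mobius_local N l Z Z' (V : seq nat) b :
  (forall Z Z', {in V, Z =i Z'} -> N Z = N Z') -> {in V, Z =i Z'} ->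
  mobius N b l Z = mobius N b l Z'.
Proof.
move=> HN; elim: l Z Z' b => [|v l IH] Z Z' b HZ /=.
  by case: b => //; exact: HN.
case: eqP => _; first exact: IH.
by congr (_ + _); apply: IH => // y yV; rewrite !inE HZ.
Qed.

(** A difference in a direction on which [N] does not depend is zero. *)
Lemma mobius_off N l Z (V : seq nat) v :
  (forall Z Z', {in V, Z =i Z'} -> N Z = N Z') ->
  v \in l -> v != n -> v \notin V ->
  mobius N true l Z = mobius N false l Z.
Proof.
move=> HN vl vn vV; elim: l Z vl => //= u l IH Z; rewrite inE => /predU1P[<-|vl].
  rewrite (negPf vn) addnC; congr (_ + _); apply: (mobius_local _ _ HN) => y yV;
  by rewrite inE; case: eqP => // yv; rewrite -yv yV in vV.
by case: eqP => _ /=; rewrite ?(IH (u :: Z) vl) (IH Z vl).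
Qed.

Lemma mobius_sum (I : Type) (r : seq I) (h : I -> seq nat -> nat) b l Z :
  mobius (fun Z => \sum_(i <- r) h i Z) b l Z = \sum_(i <- r) mobius (h i) b l Z.
Proof.
elim: l Z b => [|v l IH] Z b /=; first by case: b; rewrite // big1.
by case: eqP => _; rewrite !IH // big_split.
Qed.

Lemma mobius_bound N b l Z m :
  (forall Z, N Z <= m) -> mobius N b l Z <= 2 ^ size l * m.
Proof.
move=> HN; elim: l Z b => [|v l IH] Z b /=; first by rewrite mul1n; case: b.
rewrite expnS -mulnA mul2n -addnn; case: eqP => _.
  by rewrite (leq_trans (IH _ _)) ?leq_addr.
by rewrite leq_add.
Qed.

Lemma mobius_filter N b l Z :
  mobius N b [seq v <- l | v != n] Z = mobius N b l Z.
Proof.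
elim: l Z b => //= v l IH Z b; case: (eqVneq v n) => [->|vn] /=; first exact: IH.
by rewrite (negPf vn) !IH.
Qed.

Lemma mem_subs l s : (s \in subs l) = subseq s l.
Proof.
elim: l s => [|v l IH] s /=; first by rewrite inE; case: s.
rewrite mem_cat IH; case: s => [|u s]; first by rewrite sub0seq orbT.
have -> : (u :: s \in [seq v :: s | s <- subs l]) = (u == v) && subseq s l.
  apply/mapP/andP => [[s' Hs [-> ->]]|[/eqP-> Hs]]; first by rewrite eqxx -IH.
  by exists s; rewrite ?IH.
case: eqP => [->|_] //=; apply/orP/idP => [[//|]|]; last by left.
exact/subseq_trans/subseq_cons.
Qed.

Lemma subs_uniq l : uniq l -> uniq (subs l).
Proof.
elim: l => //= v l IH /andP[vl ul]; rewrite cat_uniq map_inj_uniq ?IH //=.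
  rewrite andbT; apply/hasPn => s; rewrite mem_subs => Hs.
  apply/mapP => -[s' _ E]; move: vl.
  by rewrite (mem_subseq Hs) // E mem_head.
by move=> ? ? [].
Qed.

Lemma subs_map f l : subs (map f l) = map (map f) (subs l).
Proof.
by elim: l => //= v l ->; rewrite map_cat -!map_comp.
Qed.

End Expansion.

(** * Increasing tuples of slots, padded with the sentinel slot *)

Section Canonical.

Variables (k q : nat).

Definition canon_rel (i j : nat) : bool := (i < j) || (i == k) && (j == k).

Definition canonical (t : seq nat) : bool := sorted canon_rel t.

Definition strip (t : seq nat) : seq nat := [seq i <- t | i != k].

Lemma canonical_strip t : all (fun i => i < k.+1) t -> canonical t ->
  t = strip t ++ nseq (size t - size (strip t)) k /\ sorted ltn (strip t).
Proof.
elim: t => //= i t IH /andP[ik tk] Hp; have /IH := path_sorted Hp.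
move=> /(_ tk) [E S]; case: (eqVneq i k) => [ik'|nik] /=.
  have at_ : all (pred1 k) t.
    elim: t i ik ik' tk Hp {IH E S} => //= j t IH i ik ik' /andP[jk tk] /andP[ij pj].
    have jk' : j = k by move: ij; rewrite /canon_rel ik'; lia.
    by rewrite jk' eqxx (IH j).
  have -> : strip t = [::].
    apply/eqP; rewrite -size_eq0 size_filter -leqn0 leqNgt -has_count.
    by apply/hasPn => j jt; rewrite negbK; exact: (allP at_).
  by rewrite subn0 /= ik'; split=> //; congr (_ :: _); apply/all_pred1P.
split; first by rewrite {1}E subSS.
have : path canon_rel i (strip t).
  by move: Hp; rewrite {1}E cat_path => /andP[].
case: (strip t) S => //= j s Hs /andP[ij _]; rewrite Hs andbT.
by move: ij nik; rewrite /canon_rel; lia.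
Qed.

Lemma strip_pad s : all (fun i => i < k) s -> strip (s ++ nseq (q - size s) k) = s.
Proof.
move=> sk; rewrite /strip filter_cat (eq_in_filter (a2 := predT)).
  rewrite filter_predT (_ : filter _ _ = [::]) ?cats0 //.
  by apply/eqP; rewrite -size_eq0 size_filter; elim: (q - size s) => //= m /eqP->; rewrite eqxx.
by move=> i /(allP sk) /= ik; rewrite ltn_eqF.
Qed.

Lemma canonical_pad s : all (fun i => i < k) s -> sorted ltn s ->
  canonical (s ++ nseq (q - size s) k).
Proof.
rewrite /canonical; have Hk m : sorted canon_rel (nseq m k).
  by case: m => //= m; elim: m => //= m ->; rewrite /canon_rel !eqxx orbT.
case: s => [|i s] sk Hs; first exact: Hk.
rewrite cat_cons /= cat_path; apply/andP; split.
  by apply: sub_path Hs => x y xy; rewrite /canon_rel (xy : x < y).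
have lk : last i s < k by apply: (allP sk); exact: mem_last.
by case: (_ - _) (Hk (q - size (i :: s))) => //= m ->; rewrite /canon_rel lk.
Qed.

(** Stripping the padding is a bijection from the canonical tuples to the sets of at most [q] slots,
    so every set is counted in one row only. *)
Lemma sum_canonical (G : seq nat -> nat) :
  \sum_(t <- vecs (nseq q k.+1) | canonical t) G (strip t) =
  \sum_(s <- subs (iota 0 k) | size s <= q) G s.
Proof.
rewrite -[LHS]big_filter -[RHS]big_filter -(big_map strip predT); apply: perm_big; apply: uniq_perm.
- rewrite map_inj_in_uniq ?filter_uniq ?vecs_uniq // => t t'.
  rewrite !mem_filter !mem_vecs_nseq => /and3P[ct /eqP st at_] /and3P[ct' /eqP st' at'] E.
  have [-> _] := canonical_strip at_ ct; have [-> _] := canonical_strip at' ct'.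
  by rewrite E st st'.
- by rewrite filter_uniq // subs_uniq // iota_uniq.
move=> s; rewrite mem_filter mem_subs; apply/mapP/andP => [[t]|[sq Hs]].
  rewrite mem_filter mem_vecs_nseq => /and3P[ct /eqP st at_] ->.
  have [E S] := canonical_strip at_ ct; split.
    by rewrite -st size_filter count_size.
  rewrite -[X in subseq X _](_ : [seq i <- iota 0 k | i \in strip t] = _) ?filter_subseq //.
  apply: (irr_sorted_eq (leT := ltn)) => //; first exact: ltn_trans.
  - by move=> i; exact: ltnn.
  - by apply: sorted_filter (iota_ltn_sorted 0 k); exact: ltn_trans.
  move=> i; rewrite !mem_filter mem_iota /= add0n; case: (eqVneq i k) => //= ik.
  case: (boolP (i \in t)) => //= it; have := allP at_ i it; lia.
have sk : all (fun i => i < k) s.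
  by apply/allP => i /(mem_subseq Hs); rewrite mem_iota.
have ss : sorted ltn s by apply: subseq_sorted Hs (iota_ltn_sorted 0 k); exact: ltn_trans.
exists (s ++ nseq (q - size s) k); last by rewrite strip_pad.
rewrite mem_filter canonical_pad // mem_vecs_nseq size_cat size_nseq subnKC // eqxx /=.
rewrite all_cat; apply/andP; split.
  by apply: sub_all sk => i /= /ltnW.
by apply/allP => i; rewrite mem_nseq => /andP[_ /eqP->].
Qed.

End Canonical.

(** A set with more than [q] elements has one outside [V], so the difference of [h i] in its
    directions vanishes and only the small terms of the Moebius inversion remain. The degree does
    not grow with the number of summands, which is what allows gates of unbounded arity. *)
Lemma truncated_subs_sum n q (I : eqType) (r : seq I) (h : I -> seq nat -> nat)
    (N : seq nat -> nat) l :
  (forall Z, N Z = \sum_(i <- r) h i Z) ->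
  {in r, forall i, exists V, size V <= q /\
     forall Z Z', {in V, Z =i Z'} -> h i Z = h i Z'} ->
  uniq l -> n \notin l ->
  \sum_(s <- subs l | size s <= q) mobius n N true s [::] =
  \sum_(s <- subs l | size s <= q) mobius n N false s [::] + N l.
Proof.
move=> EN Hh ul nl.
have HN : set_fun N.
  move=> Z Z' EZ; rewrite !EN big_seq [RHS]big_seq; apply: eq_bigr => i ir.
  by have [V [_ HV]] := Hh i ir; apply: HV => y _; exact: EZ.
have Emob b s : mobius n N b s [::] = \sum_(i <- r) mobius n (h i) b s [::].
  rewrite -mobius_sum.
  elim: s b [::] => [|v s IH] b Z /=; first by case: b; rewrite ?EN.
  by case: eqP => _; rewrite !IH.
have big_s : \sum_(s <- subs l | ~~ (size s <= q)) mobius n N true s [::] =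
    \sum_(s <- subs l | ~~ (size s <= q)) mobius n N false s [::].
  rewrite big_seq_cond [RHS]big_seq_cond; apply: eq_bigr => s /andP[].
  rewrite mem_subs -ltnNge => sl qs; rewrite !Emob big_seq [RHS]big_seq.
  apply: eq_bigr => i ir; have [V [sV HV]] := Hh i ir.
  have us := subseq_uniq sl ul.
  have /hasP[v vs vV] : has (fun v => v \notin V) s.
    rewrite -[has _ _]negbK -all_predC; apply: contraL qs => /allP H.
    rewrite -leqNgt; apply: leq_trans sV; apply: uniq_leq_size us _ => v vs.
    by have := H v vs; rewrite /= negbK.
  apply: (mobius_off [::] HV vs _ vV); apply: contraNneq nl => <-.
  exact: (mem_subseq sl vs).
have := subs_sum [::] HN nl; rewrite cats0.
rewrite (bigID (fun s => size s <= q)) /= [X in _ = X + _](bigID (fun s => size s <= q)) /=.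
by rewrite big_s addnAC => /addIn.
Qed.

(** * Circuits of weft one as systems of equations *)

Section Instance.

(* The circuit is given by the kinds (0: input, 1: not, 2: and, 3: or), the
   arities and the arguments of its nodes; node n - 1 is the output. *)
Variables (n k L : nat) (ty ar : nat -> nat) (arg : nat -> nat -> nat).

Let q := 2 ^ L.

Fixpoint node_val (f : nat) (Z : seq nat) (i : nat) : bool :=
  if ty i == 0 then i \in Z else
  if f is f'.+1 then
    if ty i == 1 then ~~ node_val f' Z (arg i 0)
    else if ty i == 2 then all (fun b => node_val f' Z (arg i b)) (iota 0 (ar i))
    else has (fun b => node_val f' Z (arg i b)) (iota 0 (ar i))
  else false.

(** Depth at most [f]. For nodes of such depth the next two functions express weft 0 and weft at
    most 1; see [depth_dle] and [weft_weft1]. *)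
Fixpoint dle (f i : nat) : bool :=
  if f is f'.+1 then
    (ty i == 0) || all (fun b => dle f' (arg i b)) (iota 0 (ar i))
  else ty i == 0.

Fixpoint small (f i : nat) : bool :=
  if f is f'.+1 then
    (ar i <= 2) && all (fun b => small f' (arg i b)) (iota 0 (ar i))
  else true.

Fixpoint weft1 (f i : nat) : bool :=
  if f is f'.+1 then
    if ar i <= 2 then all (fun b => weft1 f' (arg i b)) (iota 0 (ar i))
    else all (fun b => small f' (arg i b)) (iota 0 (ar i))
  else true.

Definition leaf (i : nat) : bool := (ty i == 0) || (2 < ar i).

(* The leaf number j of the binary tree of height f obtained by unfolding the
   gates of small arity from node u; a leaf of smaller depth is repeated. *)
Fixpoint lnode (f u j : nat) : nat :=
  if f is f'.+1 then
    if leaf u then u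
    else if j < 2 ^ f' then lnode f' (arg u 0) j
    else lnode f' (arg u (ar u).-1) (j - 2 ^ f')
  else u.

Definition cnt (u : nat) (Z : seq nat) : nat :=
  if ty u == 0 then nat_of_bool (u \in Z)
  else \sum_(b <- iota 0 (ar u)) node_val L Z (arg u b).

(** A leaf that is a gate is a conjunction or a disjunction, negations having arity 1, so the number
    of its true arguments determines its value. *)
Definition truth (u m : nat) : bool := if ty u == 2 then m == ar u else m != 0.

Fixpoint tree_val (v : seq nat) (f u o : nat) : bool :=
  if f is f'.+1 then
    if leaf u then truth u (nth 0 v o)
    else if ty u == 1 then ~~ tree_val v f' (arg u 0) o
    else if ty u == 2 then
      tree_val v f' (arg u 0) o && tree_val v f' (arg u (ar u).-1) (o + 2 ^ f')
    else tree_val v f' (arg u 0) o || tree_val v f' (arg u (ar u).-1) (o + 2 ^ f')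
  else truth u (nth 0 v o).

(** The bound [ar i <= n], true because the arguments of a gate are distinct nodes, makes every
    number of true arguments a digit below [n.+1]. *)
Definition node_ok (i : nat) : bool :=
  [&& match ty i with 0 => ar i == 0 | 1 => ar i == 1 | 2 | 3 => 1 < ar i <= n | _ => false end
    & all (fun b => arg i b < i) (iota 0 (ar i))].

Hypothesis nodes : forall i, i < n -> node_ok i.

Lemma node_arg i b : i < n -> b < ar i -> arg i b < n.
Proof.
move=> iN bi; have /andP[_ /allP H] := nodes iN.
by apply: ltn_trans iN; apply: H; rewrite mem_iota.
Qed.

Lemma node_ar i : i < n -> ar i <= n.
Proof.
by move=> iN; have /andP[] := nodes iN; case: (ty i) => [|[|[|[|t]]]] //; lia.
Qed.

Lemma node_ar_gt0 i : i < n -> ty i != 0 -> 0 < ar i.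
Proof.
by move=> iN; have /andP[] := nodes iN; case: (ty i) => [|[|[|[|t]]]] //; lia.
Qed.

Lemma node_ty1 i : i < n -> ty i = 1 -> ar i = 1.
Proof. by move=> iN t1; have /andP[] := nodes iN; rewrite t1 => /eqP. Qed.

Lemma node_small i : i < n -> ty i != 0 -> ty i != 1 -> ar i <= 2 -> ar i = 2.
Proof.
by move=> iN; have /andP[] := nodes iN; case: (ty i) => [|[|[|[|t]]]] //; lia.
Qed.

Lemma dle_mono f f' i : f <= f' -> dle f i -> dle f' i.
Proof.
elim: f f' i => [|f IH] [|f'] i //=; first by move=> _ ->.
move=> ff' /orP[->//|H]; apply/orP; right; apply: sub_all H => b.
exact: IH.
Qed.

Lemma val_fuel f f' Z i : i < n -> dle f i -> f <= f' -> node_val f' Z i = node_val f Z i.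
Proof.
elim: f f' i => [|f IH] f' i iN /=.
  by case: f' => [|f'] /= ->.
case: (eqVneq (ty i) 0) => [t0|t0] /=; first by case: f' => [|f']; rewrite /= t0.
move=> /allP Hd; case: f' => // f' ff' /=; rewrite (negPf t0).
have E b : b \in iota 0 (ar i) -> node_val f' Z (arg i b) = node_val f Z (arg i b).
  move=> bi; apply: IH (Hd b bi) ff'; apply: node_arg => //.
  by rewrite mem_iota in bi.
case: eqP => _; first by rewrite E // mem_iota node_ar_gt0.
by case: eqP => _; [apply: eq_in_all | apply: eq_in_has].
Qed.

(** The tree below a node of depth [f] whose gates have arity at most 2 has at most [2 ^ f] input
    leaves, and these determine the value. *)
Lemma val_local f f' i : i < n -> dle f i -> small f i -> f <= f' ->
  exists V, size V <= 2 ^ f /\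
    forall Z Z', {in V, Z =i Z'} -> node_val f' Z i = node_val f' Z' i.
Proof.
elim: f f' i => [|f IH] f' i iN /=.
  move=> t0 _ _; exists [:: i]; split=> // Z Z' H.
  by case: f' => [|f'] /=; rewrite t0; apply: H; rewrite mem_head.
case: (eqVneq (ty i) 0) => [t0|t0] /=.
  move=> _ _ _; exists [:: i]; split=> [|Z Z' H]; first by rewrite expn_gt0.
  by case: f' => [|f'] /=; rewrite t0; apply: H; rewrite mem_head.
move=> /allP Hd /andP[ar2 /allP Hs]; case: f' => // f' ff' /=; rewrite (negPf t0).
have HV b : b < ar i -> exists V, size V <= 2 ^ f /\
    forall Z Z', {in V, Z =i Z'} -> node_val f' Z (arg i b) = node_val f' Z' (arg i b).
  move=> bi; apply: IH ff'; first exact: node_arg.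
    by apply: Hd; rewrite mem_iota.
  by apply: Hs; rewrite mem_iota.
case: (eqVneq (ty i) 1) => t1.
  have [V [sV V0]] := HV 0 (node_ar_gt0 iN t0).
  exists V; split; first by rewrite expnS (leq_trans sV) ?leq_pmull.
  by move=> Z Z' HZ; rewrite (V0 Z Z').
have a2 := node_small iN t0 t1 ar2.
have [V [sV V0]] : exists V, size V <= 2 ^ f /\
    forall Z Z', {in V, Z =i Z'} -> node_val f' Z (arg i 0) = node_val f' Z' (arg i 0).
  by apply: HV; rewrite a2.
have [V' [sV' V1]] : exists V, size V <= 2 ^ f /\
    forall Z Z', {in V, Z =i Z'} -> node_val f' Z (arg i 1) = node_val f' Z' (arg i 1).
  by apply: HV; rewrite a2.
exists (V ++ V'); split; first by rewrite size_cat expnS mul2n -addnn leq_add.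
move=> Z Z' HZ; rewrite a2 /= (V0 Z Z') ?(V1 Z Z') // => y yV; apply: HZ;
by rewrite mem_cat yV ?orbT.
Qed.

(** Weft one enters here: a large gate reached by the unfolding has only small gates below it, so by
    [val_local] each of its arguments depends on at most [2 ^ f1] inputs. *)
Lemma lnode_ok f u j : u < n -> dle f u -> weft1 f u ->
  [/\ lnode f u j < n, leaf (lnode f u j) &
      ty (lnode f u j) != 0 -> exists2 f1, f1 < f & forall b, b < ar (lnode f u j) ->
        dle f1 (arg (lnode f u j) b) && small f1 (arg (lnode f u j) b)].
Proof.
elim: f u j => [|f IH] u j uN /=.
  by move=> t0 _; rewrite /leaf t0.
case: (boolP (leaf u)) => [lu du wu|]; first split=> // t0.
  move: lu du wu; rewrite /leaf (negPf t0) ltnNge => /= /negPf-> /allP Hd /allP Hs.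
  by exists f => // b bu; rewrite Hd ?Hs // mem_iota.
rewrite /leaf => /norP[t0]; rewrite (negPf t0) -leqNgt => ar2 /allP Hd.
rewrite ar2 => /allP Hw; have a0 := node_ar_gt0 uN t0.
have S b j' : b < ar u -> [/\ lnode f (arg u b) j' < n, leaf (lnode f (arg u b) j') &
    ty (lnode f (arg u b) j') != 0 -> exists2 f1, f1 < f.+1 &
    forall b', b' < ar (lnode f (arg u b) j') ->
    dle f1 (arg (lnode f (arg u b) j') b') && small f1 (arg (lnode f (arg u b) j') b')].
  move=> bu; have bi : b \in iota 0 (ar u) by rewrite mem_iota.
  have [H1 H2 H3] := IH (arg u b) j' (node_arg uN bu) (Hd b bi) (Hw b bi).
  split=> // /H3[f1 ff1 Hf]; exists f1 => //; exact: ltnW.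
by case: ifP => _; apply: S => //; rewrite prednK.
Qed.

Lemma cnt_le u Z : u < n -> cnt u Z <= n.
Proof.
move=> un; rewrite /cnt; case: eqP => _; first by case: (_ \in _); lia.
apply: leq_trans (node_ar un); rewrite -[X in _ <= X](size_iota 0) -sum1_size.
by apply: leq_sum => b _; case: (node_val _ _ _).
Qed.

Lemma truth_cnt u Z f : u < n -> leaf u -> dle f u -> f <= L ->
  truth u (cnt u Z) = node_val L Z u.
Proof.
move=> un lu du fL; rewrite (val_fuel _ un du fL) /truth /cnt.
case: (eqVneq (ty u) 0) => [t0|t0].
  by rewrite t0; case: f du fL => [|f] _ _ /=; rewrite t0; case: (_ \in _).
case: f du fL => [|f] /=; first by rewrite (negPf t0).
rewrite (negPf t0) => /= /allP Hd fL.
have E b : b \in iota 0 (ar u) -> node_val L Z (arg u b) = node_val f Z (arg u b).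
  move=> bu; apply: val_fuel (Hd b bu) (ltnW fL).
  by apply: node_arg => //; rewrite mem_iota in bu.
have -> : \sum_(b <- iota 0 (ar u)) node_val L Z (arg u b) =
    count (fun b => node_val f Z (arg u b)) (iota 0 (ar u)).
  rewrite -sum1_count [RHS]big_mkcond /=; apply: eq_big_seq => b bu.
  by rewrite E //; case: (node_val _ _ _).
have t1 : ty u != 1.
  apply: contraTneq lu => t1; rewrite /leaf t1 /=.
  by rewrite (node_ty1 un t1).
rewrite (negPf t1); case: eqP => _; last by rewrite -lt0n -has_count.
by rewrite all_count size_iota.
Qed.

Lemma tree_val_ok v Z f u o : u < n -> dle f u -> f <= L ->
  (forall j, j < 2 ^ f -> nth 0 v (o + j) = cnt (lnode f u j) Z) ->
  tree_val v f u o = node_val L Z u.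
Proof.
elim: f u o => [|f IH] u o un du fL H.
  have := H 0 isT; rewrite addn0 /= => ->; apply: (truth_cnt _ _ _ du fL) => //.
  by move: du; rewrite /leaf /= => ->.
have pf : 0 < 2 ^ f by rewrite expn_gt0.
move=> /=; case: ifP => lu.
  have := H 0; rewrite addn0 /= lu => ->; first exact: truth_cnt du fL.
  by rewrite expn_gt0.
rewrite (val_fuel _ un du fL) /=; move: (lu) (du); rewrite /leaf => /norP[t0].
rewrite -leqNgt => ar2 /=; rewrite (negPf t0) => /allP Hd.
have S b o' : b < ar u ->
   (forall j, j < 2 ^ f -> nth 0 v (o' + j) = cnt (lnode f (arg u b) j) Z) ->
   tree_val v f (arg u b) o' = node_val f Z (arg u b).
  move=> bu Hb; have bi : b \in iota 0 (ar u) by rewrite mem_iota.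
  have an := node_arg un bu.
  rewrite (IH _ o' an (Hd b bi) (ltnW fL) Hb).
  by apply: val_fuel (ltnW fL) => //; exact: Hd.
have S0 : tree_val v f (arg u 0) o = node_val f Z (arg u 0).
  apply: S => [|j jf]; first exact: node_ar_gt0.
  have /= := H j; rewrite lu jf; apply.
  by rewrite expnS; lia.
case: (eqVneq (ty u) 1) => t1; first by rewrite S0.
have a2 := node_small un t0 t1 ar2.
have S1 : tree_val v f (arg u (ar u).-1) (o + 2 ^ f) = node_val f Z (arg u 1).
  rewrite a2 /=; apply: S => [|j jf]; first by rewrite a2.
  have /= := H (2 ^ f + j); rewrite lu ifF; last by lia.
  rewrite a2 /= addKn addnA; apply.
  by rewrite expnS; lia.
by rewrite S0 S1 a2 /= andbT orbF.
Qed.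

(* An item is a vector v ++ rho: the row rho = g :: tau of the item is a tuple
   tau of q slots if g = 0, and then v lists the inputs in these slots, slot k
   holding the sentinel n; if g = 1, then v lists the numbers of true arguments
   of the q leaves.  Exactly one item of each row is chosen.  The columns
   a :: rho' force this (a = q), the consistency of the tuples (g' = 0), and the
   correctness of the numbers of true arguments (g' = 1). *)
Definition row_range : seq nat := 2 :: nseq q k.+1.
Definition opt_range : seq nat := nseq q n.+1.
Definition item_range : seq nat := opt_range ++ row_range.
Definition col_range : seq nat := q.+1 :: row_range.

(** For a tuple of slots, the inputs must increase where neighbouring slots do, which makes the
    chosen inputs distinct, and slot [k] must hold the sentinel. For guessed numbers of true
    arguments, the unfolded tree must evaluate to true. *)
Definition admissible (v rho : seq nat) : bool :=
  if nth 0 rho 0 == 0 then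
    all (fun a => (nth 0 rho a.+1 < nth 0 rho a.+2) ==> (nth 0 v a < nth 0 v a.+1))
        (iota 0 q.-1) &&
    all (fun a => if nth 0 rho a.+1 < k then (nth 0 v a < n) && (ty (nth 0 v a) == 0)
                  else nth 0 v a == n) (iota 0 q)
  else tree_val v L n.-1 0.

Definition canon (rho : seq nat) : bool :=
  all (fun a => canon_rel k (nth 0 rho a.+1) (nth 0 rho a.+2)) (iota 0 q.-1).

(** A bound on the subtracted part of a difference in [q] directions of a function with values at
    most [n]. *)
Definition offset : nat := 2 ^ q * n.

Definition leaf_cnt (a : nat) : seq nat -> nat := cnt (lnode L n.-1 a).

(** The column [q :: rho'] counts the items of row [rho'], inadmissible ones twice. A column with
    [g' = 0] compares entry [a] with the input held by the same slot in a constant tuple: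
    [v_a + (n - v'_0) = n]. A column with [g' = 1] sums the differences of leaf [a] over all tuples;
    up to the offsets, this sum plus [n - v_a] must be [n]. Every row with [g = 1] carries a guess
    of its own, so that rows and columns have a uniform range. *)
Definition weight (v rho : seq nat) (a : nat) (rho' : seq nat) : nat :=
  if a == q then
    if rho == rho' then if admissible v rho then 1 else 2 else 0
  else if nth 0 rho' 0 == 0 then
    (if rho == rho' then nth 0 v a else 0) +
    (if rho == 0 :: nseq q (nth 0 rho' a.+1) then n - nth 0 v 0 else 0)
  else
    (if nth 0 rho 0 == 0 then
       if canon rho then
         offset + mobius n (leaf_cnt a) true v [::] - mobius n (leaf_cnt a) false v [::]
       else offset
     else 0) +
    (if rho == rho' then n - nth 0 v a else 0).

Definition goal (a : nat) (rho' : seq nat) : nat :=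
  if a == q then 1
  else if nth 0 rho' 0 == 0 then n
  else k.+1 ^ q * offset + n.

Definition rows := vecs row_range.
Definition opts := vecs opt_range.

Hypotheses (n_gt0 : 0 < n) (L_gt0 : 0 < L) (out_dle : dle L n.-1) (out_w : weft1 L n.-1).

(** Admissibility compares slots at neighbouring positions of a tuple, so two positions are wanted;
    this is the use of a positive [L], later [d.+1]. *)
Lemma q_gt1 : 1 < q.
Proof. by rewrite /q -{1}(expn0 2) ltn_exp2l. Qed.

Lemma sum_rows (F : seq nat -> nat) :
  \sum_(rho <- rows) F rho =
  \sum_(t <- vecs (nseq q k.+1)) (F (0 :: t) + F (1 :: t)).
Proof.
rewrite -[rows]/[seq i :: t | t <- vecs (nseq q k.+1), i <- iota 0 2].
rewrite big_allpairs_dep; apply: eq_bigr => t _.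
by rewrite /= !big_cons big_nil addn0.
Qed.

Lemma mem_rows g t :
  (g :: t \in rows) = [&& g < 2, size t == q & all (fun i => i < k.+1) t].
Proof.
rewrite /rows /row_range mem_vecs /= size_nseq eqSS andbCA; congr (_ && _).
by rewrite -mem_vecs_nseq mem_vecs size_nseq.
Qed.

Lemma mem_opts v : (v \in opts) = (size v == q) && all (fun i => i < n.+1) v.
Proof. exact: mem_vecs_nseq. Qed.

Lemma size_rows : size rows = 2 * k.+1 ^ q.
Proof. by rewrite size_vecs /= volume_nseq. Qed.

Lemma sum_if_rows rho (F : seq nat -> nat) : rho \in rows ->
  \sum_(r <- rows) (if r == rho then F r else 0) = F rho.
Proof.
move=> Hr; rewrite (bigD1_seq rho) ?vecs_uniq //= eqxx big1 ?addn0 // => r.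
by move/negPf->.
Qed.

(* The items chosen are ch rho ++ rho. *)
Definition solves (ch : seq nat -> seq nat) : Prop :=
  forall rho, rho \in rows -> [/\ ch rho \in opts, admissible (ch rho) rho &
    forall a, a < q -> \sum_(r <- rows) weight (ch r) r a rho = goal a rho].

Lemma out_lt : n.-1 < n. Proof. by rewrite prednK. Qed.

Lemma leaf_cnt_le a Z : leaf_cnt a Z <= n.
Proof. by apply: cnt_le; have [] := lnode_ok a out_lt out_dle out_w. Qed.

Lemma mobius_false_le a v : size v = q ->
  mobius n (leaf_cnt a) false v [::] <= offset.
Proof. by move=> sv; rewrite /offset -sv; apply: mobius_bound => Z; exact: leaf_cnt_le. Qed.

Lemma leaf_cnt_expansion a l : uniq l -> n \notin l ->
  \sum_(s <- subs l | size s <= q) mobius n (leaf_cnt a) true s [::] =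
  \sum_(s <- subs l | size s <= q) mobius n (leaf_cnt a) false s [::] + leaf_cnt a l.
Proof.
have [un _ Hu] := lnode_ok a out_lt out_dle out_w.
rewrite /leaf_cnt; set u := lnode L n.-1 a in un Hu *.
case: (eqVneq (ty u) 0) => [t0|t0].
  apply: (truncated_subs_sum (r := [:: u]) (h := fun u Z => nat_of_bool (u \in Z))).
    by move=> Z; rewrite /cnt t0 big_seq1.
  move=> i _; exists [:: i]; split; first by rewrite expn_gt0.
  by move=> Z Z' H; rewrite H ?mem_head.
have [f fL Hf] := Hu t0.
apply: (truncated_subs_sum (r := iota 0 (ar u)) (h := fun b Z => nat_of_bool (node_val L Z (arg u b)))).
  by move=> Z; rewrite /cnt (negPf t0).
move=> b; rewrite mem_iota => bu; have /andP[Hd Hs] := Hf b bu.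
have [V [sV HV]] := val_local (node_arg un bu) Hd Hs (ltnW fL).
exists V; split; last by move=> Z Z' /HV->.
by apply: leq_trans sV _; rewrite leq_pexp2l // ltnW.
Qed.

Lemma canonE g t : size t = q -> canon (g :: t) = canonical k t.
Proof.
move=> st; apply/allP/(sortedP 0) => H i.
  by move=> ist; apply: H; rewrite mem_iota; move: ist; rewrite st; lia.
rewrite mem_iota => iq; apply: H; rewrite st; have := q_gt1; lia.
Qed.

Section Slots.

Variable sg : nat -> nat.
Hypotheses (sgk : sg k = n) (sgn : forall i, i < k -> sg i < n).

Lemma filter_map_slots t : all (fun i => i < k.+1) t ->
  [seq v <- map sg t | v != n] = map sg (strip k t).
Proof.
elim: t => //= i t IH /andP[ik tk]; rewrite IH //.
case: (eqVneq i k) => [->|ik']; first by rewrite sgk eqxx.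
by rewrite ltn_eqF // sgn //; lia.
Qed.

Lemma sum_canonical_slots a b :
  \sum_(t <- vecs (nseq q k.+1) | canonical k t)
     mobius n (leaf_cnt a) b (map sg t) [::] =
  \sum_(s <- subs (map sg (iota 0 k)) | size s <= q) mobius n (leaf_cnt a) b s [::].
Proof.
rewrite subs_map big_map; under [RHS]eq_bigl do rewrite size_map.
rewrite -(sum_canonical k q (fun s => mobius n (leaf_cnt a) b (map sg s) [::])).
rewrite big_seq_cond [RHS]big_seq_cond; apply: eq_bigr => t /andP[].
rewrite mem_vecs_nseq => /andP[_ tk] _.
by rewrite -filter_map_slots // mobius_filter.
Qed.

(** Every tuple contributes an offset, and the canonical ones also the differences, whose sum over
    all sets of at most [q] slots is the number of true arguments at the chosen inputs. *)
Lemma count_column a : uniq (map sg (iota 0 k)) ->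
  \sum_(t <- vecs (nseq q k.+1))
    (if canonical k t then
       offset + mobius n (leaf_cnt a) true (map sg t) [::]
              - mobius n (leaf_cnt a) false (map sg t) [::]
     else offset) = k.+1 ^ q * offset + leaf_cnt a (map sg (iota 0 k)).
Proof.
move=> us; have nl : n \notin map sg (iota 0 k).
  by apply/mapP => -[i]; rewrite mem_iota => /sgn; lia.
have := leaf_cnt_expansion a us nl; rewrite -!sum_canonical_slots.
set S := map sg _.
have E (F : seq nat -> nat) : \sum_(t <- vecs (nseq q k.+1) | canonical k t) F t =
    \sum_(t <- vecs (nseq q k.+1)) if canonical k t then F t else 0.
  by rewrite big_mkcond.
(* The subtracted parts are added on both sides; the offset ensures that the subtractions do not
   truncate. *)
rewrite !E => E1; apply/eqP; rewrite -(eqn_add2r (\sum_(t <- vecs (nseq q k.+1))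
  if canonical k t then mobius n (leaf_cnt a) false (map sg t) [::] else 0)).
rewrite -addnA [leaf_cnt a S + _]addnC -E1.
have -> : k.+1 ^ q * offset = \sum_(t <- vecs (nseq q k.+1)) offset.
  by rewrite big_const_seq count_predT size_vecs volume_nseq iter_addn_0 mulnC.
rewrite -!big_split /=; apply/eqP/eq_big_seq => t; rewrite mem_vecs_nseq => /andP[/eqP st _].
case: ifP => // _; rewrite subnK //.
by apply: leq_trans (mobius_false_le _ _) (leq_addr _ _); rewrite size_map.
Qed.

End Slots.

(** * Equivalence of the system with satisfiability by [k] inputs *)

Lemma solves_sound ch : solves ch -> exists sl, [/\ sorted ltn sl,
  all (fun i => (i < n) && (ty i == 0)) sl, size sl = k & node_val L sl n.-1].
Proof.
move=> Hch; have q0 := ltnW q_gt1; have q1 := q_gt1.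
(* The input in slot [i] is read off the constant tuple; the columns with [g' = 0] tie all other
   tuples to it. *)
pose diag i := 0 :: nseq q i; pose sg i := nth 0 (ch (diag i)) 0.
have diag_row i : i <= k -> diag i \in rows.
  by move=> ik; rewrite mem_rows size_nseq eqxx all_nseq /=; lia.
have opt_nth rho a : rho \in rows -> nth 0 (ch rho) a <= n.
  move=> /Hch[+ _ _]; rewrite mem_opts => /andP[/eqP sv /allP H].
  case: (ltnP a q) => aq; last by rewrite nth_default ?sv.
  by have := H (nth 0 (ch rho) a); rewrite mem_nth ?sv // => /(_ isT).
have tup t : 0 :: t \in rows -> ch (0 :: t) = map sg t.
  move=> tr; have [Ho Ha Hg] := Hch _ tr.
  move: (tr); rewrite mem_rows => /and3P[_ /eqP st /allP tk].
  move: (Ho); rewrite mem_opts => /andP[/eqP sv _].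
  apply: (@eq_from_nth _ 0) => [|a]; rewrite ?size_map ?sv ?st // => aq.
  have tak : nth 0 t a <= k by apply: tk; rewrite mem_nth ?st.
  have := Hg a aq; rewrite /goal ltn_eqF //= (eq_bigr (fun r =>
     (if r == 0 :: t then nth 0 (ch r) a else 0) +
     (if r == diag (nth 0 t a) then n - nth 0 (ch r) 0 else 0))); last first.
    by move=> r _; rewrite /weight ltn_eqF.
  rewrite big_split /= !sum_if_rows ?diag_row //.
  rewrite (nth_map 0) ?st // -/(sg _).
  have := opt_nth _ 0 (diag_row _ tak); rewrite -/(sg _).
  by have := opt_nth _ a tr; lia.
have slot i : i <= k -> if i < k then (sg i < n) && (ty (sg i) == 0) else sg i == n.
  move=> ik; have [_ Ha _] := Hch _ (diag_row i ik).
  move: Ha; rewrite /admissible /= => /andP[_ /allP/(_ 0)].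
  rewrite mem_iota q0 tup ?diag_row // (nth_map 0) ?size_nseq //.
  by rewrite nth_nseq q0; apply.
have sgk : sg k = n by have := slot k (leqnn k); rewrite ltnn => /eqP.
have sgn i : i < k -> sg i < n.
  by move=> ik; have := slot i (ltnW ik); rewrite ik => /andP[].
have sg_lt i : i.+1 < k -> sg i < sg i.+1.
  (* In this tuple admissibility compares slot [i] with slot [i.+1] at the first two positions. *)
  move=> ik; pose t := i :: nseq q.-1 i.+1.
  have tr : 0 :: t \in rows.
    by rewrite mem_rows /= size_nseq prednK // eqxx all_nseq /=; lia.
  have [_ Ha _] := Hch _ tr.
  move: Ha; rewrite /admissible /= => /andP[/allP/(_ 0) + _].
  rewrite mem_iota tup //= nth_nseq (_ : 0 < q.-1); last by lia.
  rewrite ltnSn /= (nth_map 0) ?size_nseq; last by lia.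
  by rewrite nth_nseq (_ : 0 < q.-1) ?add0n; [apply|lia].
pose sl := map sg (iota 0 k).
have sl_sorted : sorted ltn sl.
  apply/(sortedP 0) => i; rewrite size_map size_iota => ik.
  rewrite !(nth_map 0) ?size_iota //; last by lia.
  by rewrite !nth_iota ?add0n //; [exact: sg_lt | lia].
have sl_uniq : uniq sl by apply: sorted_uniq sl_sorted; [exact: ltn_trans | exact: ltnn].
exists sl; split=> //.
- apply/allP => i /mapP[j]; rewrite mem_iota => /= jk ->.
  by have := slot j (ltnW jk); rewrite jk.
- by rewrite size_map size_iota.
(* All rows with first digit 1 satisfy the same equations; any of them recovers the numbers of true
   arguments. *)
have r1 : 1 :: nseq q 0 \in rows.
  by rewrite mem_rows size_nseq eqxx all_nseq /=; lia.
have [Ho Ha Hg] := Hch _ r1.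
move: Ha; rewrite /admissible /= (tree_val_ok (Z := sl) out_lt out_dle (leqnn L)) // => j jq.
rewrite add0n; have := Hg j jq; rewrite /goal ltn_eqF //= sum_rows.
rewrite big_seq (eq_bigr (fun t =>
   (if canonical k t then
       offset + mobius n (leaf_cnt j) true (map sg t) [::]
              - mobius n (leaf_cnt j) false (map sg t) [::]
     else offset) + (if 1 :: t == 1 :: nseq q 0 then n - nth 0 (ch (1 :: t)) j else 0))); last first.
  move=> t; rewrite mem_vecs_nseq => /andP[/eqP st tk].
  rewrite /weight ltn_eqF //= !add0n addn0 canonE // tup //.
  by rewrite mem_rows st eqxx tk.
rewrite -big_seq big_split /= (count_column sgk sgn) //.
rewrite (_ : \sum_(t <- _) (if 1 :: t == _ then _ else _) = n - nth 0 (ch (1 :: nseq q 0)) j).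
  have := opt_nth _ j r1; rewrite -/(leaf_cnt j) -/sl; lia.
rewrite -(sum_if_rows (fun r => n - nth 0 (ch r) j) r1) sum_rows.
by apply: eq_bigr.
Qed.

Lemma solves_complete sl : sorted ltn sl ->
  all (fun i => (i < n) && (ty i == 0)) sl -> size sl = k -> node_val L sl n.-1 ->
  exists ch, solves ch.
Proof.
move=> sl_s /allP sl_i sl_k Hv; have q0 := ltnW q_gt1; have q1 := q_gt1.
pose sg := nth n sl.
have sgk : sg k = n by rewrite /sg nth_default ?sl_k.
have sgi i : i < k -> (sg i < n) && (ty (sg i) == 0).
  by move=> ik; apply: sl_i; rewrite mem_nth ?sl_k.
have sgn i : i < k -> sg i < n by move=> /sgi/andP[].
have sg_le i : i <= k -> sg i <= n.
  by rewrite leq_eqVlt => /predU1P[->|/sgn/ltnW]; rewrite ?sgk.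
have sg_lt i j : i < j -> j <= k -> sg i < sg j.
  move=> ij; rewrite leq_eqVlt => /predU1P[jk|jk].
    by rewrite jk sgk sgn // -jk.
  by apply: (sorted_ltn_nth ltn_trans n sl_s) (ij); rewrite inE sl_k //; lia.
have sl_E : map sg (iota 0 k) = sl by rewrite map_nth_iota0 -?sl_k // take_size.
pose ch rho := if nth 0 rho 0 == 0 then map sg (behead rho)
  else [seq leaf_cnt j sl | j <- iota 0 q].
have diag_row i : i <= k -> 0 :: nseq q i \in rows.
  by move=> ik; rewrite mem_rows size_nseq eqxx all_nseq /=; lia.
exists ch => -[|g t]; first by rewrite /rows /row_range mem_vecs.
rewrite mem_rows => /and3P[g2 /eqP st /allP tk].
have tk' a : a < q -> nth 0 t a <= k.
  by move=> aq; have := tk (nth 0 t a); rewrite ltnS mem_nth ?st //; apply.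
have tr : g :: t \in rows by rewrite mem_rows g2 st eqxx; apply/allP.
have cle a rho : rho \in rows -> nth 0 (ch rho) a <= n.
  case: rho => [|h u]; first by rewrite /rows /row_range mem_vecs.
  rewrite mem_rows /ch /= => /and3P[_ /eqP su /allP uk]; case: eqP => _.
    case: (ltnP a q) => aq; last by rewrite nth_default // size_map su.
    rewrite (nth_map 0) ?su //; apply: sg_le; rewrite -ltnS; apply: uk.
    by rewrite mem_nth ?su.
  case: (ltnP a q) => aq; last by rewrite nth_default ?size_map ?size_iota.
  by rewrite (nth_map 0) ?size_iota // leaf_cnt_le.
split.
- rewrite mem_opts; apply/andP; split.
    by rewrite /ch /=; case: (g == 0); rewrite size_map ?size_iota ?st.
  apply/(all_nthP 0) => a _; rewrite ltnS; exact: cle.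
- rewrite /admissible /ch /=; case: eqP => g0.
    apply/andP; split; apply/allP => a; rewrite mem_iota => /andP[_ aq].
      apply/implyP => ta; rewrite !(nth_map 0) ?st; try lia.
      by apply: sg_lt ta _; apply: tk'; lia.
    rewrite (nth_map 0) ?st //; case: ifP => ta; first exact: sgi.
    by have -> : nth 0 t a = k by [have := tk' a aq; lia]; rewrite sgk.
  rewrite (tree_val_ok (Z := sl) out_lt out_dle (leqnn L)) // => j jq.
  by rewrite add0n (nth_map 0) ?size_iota // nth_iota.
move=> a aq; rewrite /goal ltn_eqF //=; case: eqP => g0.
  rewrite g0 in tr *; rewrite (eq_bigr (fun r =>
     (if r == 0 :: t then nth 0 (ch r) a else 0) +
     (if r == 0 :: nseq q (nth 0 t a) then n - nth 0 (ch r) 0 else 0))); last first.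
    by move=> r _; rewrite /weight ltn_eqF.
  rewrite big_split /= !sum_if_rows ?diag_row ?tk' // /ch /=.
  rewrite !(nth_map 0) ?size_nseq ?st // nth_nseq q0.
  by rewrite subnKC // sg_le ?tk'.
have g1 : g = 1 by lia.
rewrite g1 in tr *; rewrite sum_rows big_seq (eq_bigr (fun u =>
   (if canonical k u then
       offset + mobius n (leaf_cnt a) true (map sg u) [::]
              - mobius n (leaf_cnt a) false (map sg u) [::]
     else offset) + (if 1 :: u == 1 :: t then n - nth 0 (ch (1 :: u)) a else 0))); last first.
  move=> u; rewrite mem_vecs_nseq => /andP[/eqP su _].
  by rewrite /weight ltn_eqF //= !add0n addn0 canonE.
rewrite -big_seq big_split /= (count_column sgk sgn) ?sl_E //; last first.
  by apply: sorted_uniq sl_s; [exact: ltn_trans | exact: ltnn].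
have -> : \sum_(u <- vecs (nseq q k.+1)) (if 1 :: u == 1 :: t then
    n - nth 0 (ch (1 :: u)) a else 0) = n - nth 0 (ch (1 :: t)) a.
  have := sum_if_rows (fun r => n - nth 0 (ch r) a) tr.
  by rewrite sum_rows => H; apply: etrans H; apply: eq_bigr.
rewrite /ch /= (nth_map 0) ?size_iota // nth_iota // add0n.
by have := leaf_cnt_le a sl; lia.
Qed.

(** * The system as an exact sum problem *)

Definition items := vecs item_range.
Definition cols := vecs col_range.

(* Adding 1 makes all weights positive; the group columns still force exactly one
   item per row. *)
Definition item_weight (t c : seq nat) : nat :=
  (weight (take q t) (drop q t) (nth 0 c 0) (behead c)).+1.

(** The ones added to the weights sum up to the number of chosen items, which is the number
    [2 * k.+1 ^ q] of rows. *)
Definition col_goal (c : seq nat) : nat := goal (nth 0 c 0) (behead c) + 2 * k.+1 ^ q.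

Definition exact_vecs (P : pred (seq nat)) : Prop :=
  forall c, c \in cols -> \sum_(t <- items | P t) item_weight t c = col_goal c.

Lemma mem_cols a rho : (a :: rho \in cols) = (a < q.+1) && (rho \in rows).
Proof.
by rewrite /cols /rows !mem_vecs [size (_ :: _) == _]eqSS andbCA.
Qed.

Lemma sum_items (P : pred (seq nat)) (F : seq nat -> nat) :
  \sum_(t <- items | P t) F t =
  \sum_(rho <- rows) \sum_(v <- opts | P (v ++ rho)) F (v ++ rho).
Proof.
rewrite big_mkcond /items /item_range sum_vecs_cat; apply: eq_bigr => rho _.
by rewrite [RHS]big_mkcond.
Qed.

Lemma take_opt v rho : v \in opts -> (take q (v ++ rho) = v) * (drop q (v ++ rho) = rho).
Proof.
by rewrite mem_opts => /andP[/eqP sv _]; rewrite -sv take_size_cat ?drop_size_cat.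
Qed.

Lemma sum_item_weight (P : pred (seq nat)) a rho' :
  \sum_(t <- items | P t) item_weight t (a :: rho') =
  \sum_(rho <- rows) \sum_(v <- opts | P (v ++ rho)) weight v rho a rho' +
  \sum_(rho <- rows) count (fun v => P (v ++ rho)) opts.
Proof.
rewrite sum_items -big_split /=; apply: eq_bigr => rho _.
rewrite -sum1_count -big_split /= big_seq_cond [RHS]big_seq_cond.
by apply: eq_bigr => v /andP[vo _]; rewrite /item_weight !take_opt // addn1.
Qed.

Lemma exact_vecs_complete ch : solves ch ->
  exact_vecs (fun t => take q t == ch (drop q t)) /\
  count (fun t => take q t == ch (drop q t)) items = 2 * k.+1 ^ q.
Proof.
move=> Hch; set P := fun t : seq nat => _.
have S (F : seq nat -> seq nat -> nat) rho : rho \in rows ->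
    \sum_(v <- opts | P (v ++ rho)) F v rho = F (ch rho) rho.
  move=> /Hch[ho _ _]; rewrite big_seq_cond (eq_bigl (fun v => (v \in opts) && (v == ch rho))).
    rewrite -big_seq_cond -big_filter (_ : [seq v <- opts | v == ch rho] = [:: ch rho]) ?big_seq1 //.
    by apply: filter_pred1_uniq => //; exact: vecs_uniq.
  by move=> v; case: (boolP (v \in opts)) => // vo; rewrite /P !take_opt.
have C : \sum_(rho <- rows) count (fun v => P (v ++ rho)) opts = 2 * k.+1 ^ q.
  rewrite -size_rows -sum1_size big_seq [RHS]big_seq; apply: eq_bigr => rho hr.
  by rewrite -sum1_count (S (fun _ _ => 1)).
split=> [[|a rho]|]; last first.
- by rewrite -sum1_count sum_items -C; apply: eq_bigr => rho _; rewrite -sum1_count.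
- rewrite mem_cols ltnS => /andP[aq hr].
  rewrite sum_item_weight C /col_goal /=; congr (_ + _).
  have [_ Ha Hg] := Hch _ hr; move: aq; rewrite leq_eqVlt => /predU1P[aq|aq].
    rewrite aq /goal eqxx (eq_big_seq (fun r => if r == rho then 1 else 0)).
      by rewrite sum_if_rows.
    move=> r rr; rewrite (S (fun v r => weight v r q rho)) // /weight eqxx.
    by case: eqP => // ->; rewrite Ha.
  by rewrite -Hg //; apply: eq_big_seq => r rr; rewrite (S (fun v r => weight v r a rho)).
by rewrite /cols mem_vecs.
Qed.

(** Let [R] be the number of rows. The group columns give [m rho + N = 1 + R] for every row; as the
    [m rho] sum to at least [N], adding these equations gives [N <= R]. Then every [m rho] is
    positive, so no row is empty and [N >= R]. Hence [N = R] and each [m rho] is 1, which means one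
    admissible item per row. *)
Lemma exact_vecs_sound P : exact_vecs P -> exists ch, solves ch.
Proof.
move=> HP; pose N := \sum_(rho <- rows) count (fun v => P (v ++ rho)) opts.
pose m rho := \sum_(v <- opts | P (v ++ rho)) if admissible v rho then 1 else 2.
have G a rho : a <= q -> rho \in rows ->
    \sum_(r <- rows) \sum_(v <- opts | P (v ++ r)) weight v r a rho + N =
    goal a rho + 2 * k.+1 ^ q.
  move=> aq hr; have := HP (a :: rho); rewrite mem_cols ltnS aq hr => /(_ isT).
  by rewrite sum_item_weight.
have Gm rho : rho \in rows -> m rho + N = 1 + 2 * k.+1 ^ q.
  move=> hr; have := G q rho (leqnn q) hr; rewrite {1}/goal eqxx => <-; congr (_ + _).
  rewrite -(sum_if_rows m hr); apply: eq_bigr => r _; rewrite /m /weight eqxx.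
  by case: eqP => // _; rewrite big1.
have mN rho : count (fun v => P (v ++ rho)) opts <= m rho.
  by rewrite -sum1_count /m; apply: leq_sum => v _; case: ifP.
have NG : N <= 2 * k.+1 ^ q.
  have : \sum_(rho <- rows) (m rho + N) = \sum_(rho <- rows) (1 + 2 * k.+1 ^ q).
    by apply: eq_big_seq.
  have sumc c : \sum_(rho <- rows) c = 2 * k.+1 ^ q * c.
    by rewrite big_const_seq count_predT size_rows iter_addn_0 mulnC.
  rewrite big_split /= !sumc => E.
  have : N + 2 * k.+1 ^ q * N <= 2 * k.+1 ^ q * (1 + 2 * k.+1 ^ q).
    by rewrite -E leq_add2r; apply: leq_sum => rho _; exact: mN.
  by rewrite -mulSn add1n [X in _ <= X]mulnC leq_pmul2l.
have m1 rho : rho \in rows -> 0 < m rho by move=> hr; have := Gm rho hr; lia.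
have N_ge : 2 * k.+1 ^ q <= N.
  rewrite -size_rows -sum1_size /N big_seq [X in _ <= X]big_seq.
  apply: leq_sum => rho hr; have := m1 rho hr; rewrite -has_count.
  apply: contraTT; rewrite -all_predC => /allP H.
  rewrite /m big_seq_cond big_pred0 // => v; apply/negP => /andP[vo Pv].
  by have := H v vo; rewrite /= Pv.
have NE : N = 2 * k.+1 ^ q by apply/eqP; rewrite eqn_leq NG.
have mE rho : rho \in rows -> m rho = 1 by move=> hr; have := Gm rho hr; lia.
pose chosen rho := [seq v <- opts | P (v ++ rho)].
pose ch rho := head [::] (chosen rho).
have one rho : rho \in rows -> chosen rho = [:: ch rho] /\ admissible (ch rho) rho.
  move=> hr; have := mE rho hr; rewrite /m -big_filter -/(chosen rho) /ch.
  case: (chosen rho) => [|v [|v' r]]; rewrite ?big_nil // !big_cons ?big_nil.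
    by case: ifP.
  by case: ifP; case: ifP; lia.
exists ch => rho hr; have [E A] := one rho hr; split=> //.
  have : ch rho \in chosen rho by rewrite E mem_head.
  by rewrite mem_filter => /andP[].
move=> a aq; have := G a rho (ltnW aq) hr; rewrite NE => /addIn <-.
apply: eq_big_seq => r rr; rewrite -big_filter -/(chosen r).
by have [-> _] := one r rr; rewrite big_seq1.
Qed.

End Instance.

(** * Reading a circuit from its encoding *)

Section Decode.

Variable x : seq nat.

(** Numbers of the word that serve as loop bounds are cut off at its length, as every loop is
    capped; on a [valid] word this has no effect. *)
Definition nnodes : nat := minn (nth 0 x 0) (size x).

Definition glen (p : nat) : nat :=
  if nth 0 x p == 0 then 1 else if nth 0 x p == 1 then 2 else (nth 0 x p.+1).+2.

Definition pos (i : nat) : nat :=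
  iteri (minn i (size x)) (fun _ p => p + glen p) 1.

Definition tyx (i : nat) : nat := nth 0 x (pos i).

Definition arx (i : nat) : nat :=
  if tyx i == 0 then 0 else if tyx i == 1 then 1
  else minn (nth 0 x (pos i).+1) (size x).

Definition argx (i b : nat) : nat :=
  nth 0 x (pos i + (if tyx i == 1 then 1 else 2) + b).

Definition args_uniq (i : nat) : bool :=
  all (fun b => all (fun c => (b < c) ==> (argx i b != argx i c)) (iota 0 (arx i)))
      (iota 0 (arx i)).

(** A test that a program can carry out, in place of the existence of a circuit in [WCS]. The third
    condition says that the codes of the gates fill the word exactly. *)
Definition valid (d : nat) : bool :=
  [&& 0 < nnodes, nth 0 x 0 == nnodes, pos nnodes == size x,
      all (fun i => node_ok nnodes tyx arx argx i && args_uniq i) (iota 0 nnodes),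
      dle tyx arx argx d nnodes.-1 & weft1 arx argx d nnodes.-1].

Definition kind (g : gate) : nat :=
  match g with GIn => 0 | GNot _ => 1 | GAnd _ => 2 | GOr _ => 3 end.

Record reads (C : circuit) : Prop := Reads {
  reads_nn : nnodes = size C;
  reads_ty : forall i, i < size C -> tyx i = kind (nth GIn C i);
  reads_ar : forall i, i < size C -> arx i = size (gate_args (nth GIn C i));
  reads_arg : forall i b, i < size C -> b < arx i ->
    argx i b = nth 0 (gate_args (nth GIn C i)) b
}.

Lemma pos0 : pos 0 = 1.
Proof. by rewrite /pos min0n. Qed.

Lemma posS i : i < size x -> pos i.+1 = pos i + glen (pos i).
Proof.
move=> ix; rewrite /pos (minn_idPl ix) (minn_idPl (ltnW ix)).
by [].
Qed.

Lemma pos_mono i j : i <= j -> j <= size x -> pos i <= pos j.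
Proof.
move=> /subnK <-; elim: (j - i) => // m IH; rewrite addSn => mx.
by rewrite posS //; apply: leq_trans (IH (ltnW mx)) (leq_addr _ _).
Qed.

Section Encoded.

Variable C : circuit.
Hypothesis xE : x = encode_circuit C.

Let off i := (size (flatten [seq encode_gate g | g <- take i C])).+1.

Lemma nth_off i j : i < size C -> j < size (encode_gate (nth GIn C i)) ->
  nth 0 x (off i + j) = nth 0 (encode_gate (nth GIn C i)) j.
Proof.
move=> iC jg; have E : x = (size C :: flatten [seq encode_gate g | g <- take i C]) ++
    encode_gate (nth GIn C i) ++ flatten [seq encode_gate g | g <- drop i.+1 C].
  rewrite xE /encode_circuit cat_cons; congr (_ :: _).
  by rewrite -{1}(cat_take_drop i C) (drop_nth GIn iC) map_cat flatten_cat.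
by rewrite E nth_cat ltnNge leq_addr /= addKn nth_cat jg.
Qed.

Lemma offS i : i < size C -> off i.+1 = off i + size (encode_gate (nth GIn C i)).
Proof.
move=> iC; rewrite /off (take_nth GIn iC) map_rcons flatten_rcons size_cat; lia.
Qed.

Lemma off_size : off (size C) = size x.
Proof. by rewrite /off take_size xE. Qed.

Lemma size_encode_gate g : 0 < size (encode_gate g). Proof. by case: g. Qed.

Lemma off_ge i : i <= size C -> i < off i.
Proof.
elim: i => // i IH iC; rewrite offS //; have := IH (ltnW iC).
by have := size_encode_gate (nth GIn C i); lia.
Qed.

Lemma pos_off i : i <= size C -> pos i = off i.
Proof.
have sx : size C < size x by rewrite -off_size; exact: off_ge.
elim: i => [_|i IH iC]; first by rewrite pos0 /off take0.
rewrite posS; last by lia.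
rewrite IH ?(ltnW iC) // offS //; congr (_ + _).
have H0 := @nth_off i 0 iC (size_encode_gate _); rewrite addn0 in H0.
rewrite /glen H0; have := @nth_off i 1 iC; rewrite addn1.
by case: (nth GIn C i) => //= [a|a] ->.
Qed.

Lemma encoded_reads : reads C.
Proof.
have sx : size C < size x by rewrite -off_size; exact: off_ge.
have nE : nnodes = size C by rewrite /nnodes (_ : nth 0 x 0 = size C); [lia | rewrite xE].
have tyE i : i < size C -> tyx i = kind (nth GIn C i).
  move=> iC; rewrite /tyx pos_off ?(ltnW iC) // -[off i]addn0 nth_off ?size_encode_gate //.
  by case: (nth GIn C i).
have arE i : i < size C -> arx i = size (gate_args (nth GIn C i)).
  move=> iC; rewrite /arx tyE // pos_off ?(ltnW iC) //.
  have := @nth_off i 1 iC; have := offS iC.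
  have : off i.+1 <= size x.
    by rewrite -off_size -!pos_off //; apply: pos_mono => //; exact: ltnW.
  by rewrite addn1; case: (nth GIn C i) => //= [a|a] H1 H2 ->; lia.
split=> // i b iC; rewrite arE // => bi; rewrite /argx tyE // pos_off ?(ltnW iC) // -addnA.
have := @nth_off i ((if kind (nth GIn C i) == 1 then 1 else 2) + b) iC.
by case: (nth GIn C i) bi => //= [j|a|a] bi -> //; case: b bi.
Qed.

Lemma encoded_pos : pos nnodes = size x.
Proof. by rewrite (reads_nn encoded_reads) pos_off // off_size. Qed.

End Encoded.

Section Valid.

Variable d : nat.
Hypothesis vx : valid d.

Definition gate_of (i : nat) : gate :=
  let a := [seq argx i b | b <- iota 0 (arx i)] in
  match tyx i with 0 => GIn | 1 => GNot (argx i 0) | 2 => GAnd a | _ => GOr a end.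

Definition decoded : circuit := mkseq gate_of nnodes.

Lemma encode_gate_of i : i < nnodes ->
  encode_gate (gate_of i) = [seq nth 0 x b | b <- iota (pos i) (glen (pos i))].
Proof.
move=> iN; have /and5P[n0 _ /eqP pn /allP ok _] := vx.
have /andP[/andP[Hty _] _] := ok i (ltac:(by rewrite mem_iota)).
have nx : nnodes <= size x by exact: geq_minr.
have px : pos i.+1 <= size x by rewrite -pn; apply: pos_mono => //.
rewrite posS in px; last exact: leq_trans nx.
have gE : glen (pos i) = if tyx i == 0 then 1 else if tyx i == 1 then 2
    else (nth 0 x (pos i).+1).+2 by [].
have tE : nth 0 x (pos i) = tyx i by [].
move: px Hty; rewrite /gate_of /arx /argx gE.
case E : (tyx i) => [|[|[|[|t]]]] //= px _; rewrite ?addn0 ?addn1 tE E //.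
all: rewrite (minn_idPl _); last by lia.
all: rewrite size_map size_iota; congr [:: _, _ & _].
all: rewrite -[in RHS](addn0 (pos i).+2) iotaDl -map_comp.
all: by apply: eq_map => b /=; congr (nth _ _ _); lia.
Qed.

Lemma decoded_reads : [/\ x = encode_circuit decoded, circuit_wf decoded & reads decoded].
Proof.
have /and5P[n0 /eqP xn /eqP pn /allP ok _] := vx.
have nx : nnodes <= size x by exact: geq_minr.
have xE : x = encode_circuit decoded.
  have E i : i <= nnodes -> flatten [seq encode_gate g | g <- mkseq gate_of i] =
      [seq nth 0 x b | b <- iota 1 (pos i).-1].
    elim: i => [_|i IH iN]; first by rewrite pos0.
    have p0 : 0 < pos i by have := pos_mono (leq0n i) (leq_trans (ltnW iN) nx); rewrite pos0.
    rewrite mkseqS map_rcons flatten_rcons IH ?(ltnW iN) // encode_gate_of // -map_cat.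
    rewrite posS; last exact: leq_trans nx.
    have -> : iota (pos i) (glen (pos i)) = iota (1 + (pos i).-1) (glen (pos i)).
      by rewrite add1n prednK.
    by rewrite -iotaD; congr (map _ (iota _ _)); lia.
  have sx : 0 < size x by apply: leq_trans nx.
  rewrite /encode_circuit /decoded size_mkseq E // pn -xn.
  apply: (@eq_from_nth _ 0) => [|[|i] ix] //=.
    by rewrite size_map size_iota prednK.
  by rewrite (nth_map 0) ?size_iota ?nth_iota //; move: ix; lia.
have wf : circuit_wf decoded.
  split; first by rewrite size_mkseq.
  rewrite size_mkseq => i iN; rewrite nth_mkseq //.
  have /andP[/andP[Hty /allP Hlt] /allP Hu] := ok i (ltac:(by rewrite mem_iota)).
  have U : uniq [seq argx i b | b <- iota 0 (arx i)].
    rewrite map_inj_in_uniq ?iota_uniq // => b c bi ci Ebc.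
    have := allP (Hu b bi) c ci; have := allP (Hu c ci) b bi.
    by rewrite Ebc eqxx; case: ltngtP.
  have A : all (fun j => j < i) [seq argx i b | b <- iota 0 (arx i)].
    by apply/allP => j /mapP[b bi ->]; exact: Hlt.
  move: Hty Hlt; rewrite /gate_of; case: (tyx i) => [|[|[|[|t]]]] //= => [/eqP->|ai _|ai _].
  - by move=> /(_ 0 isT) ->.
  - by rewrite size_map size_iota U A andbT; lia.
  - by rewrite size_map size_iota U A andbT; lia.
by split=> //; exact: encoded_reads.
Qed.

End Valid.

(** * Value, depth and weft of a circuit in terms of the decoded functions *)

Lemma scan_gates_rcons (A : Type) (f : seq A -> gate -> A) C g :
  scan_gates f (rcons C g) = rcons (scan_gates f C) (f (scan_gates f C) g).
Proof. by rewrite /scan_gates foldl_rcons. Qed.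

Lemma size_scan_gates (A : Type) (f : seq A -> gate -> A) C :
  size (scan_gates f C) = size C.
Proof. by elim/last_ind: C => // C g IH; rewrite scan_gates_rcons !size_rcons IH. Qed.

Lemma nth_scan_gates (A : Type) (a0 : A) (f : seq A -> gate -> A) C i : i < size C ->
  nth a0 (scan_gates f C) i = f (take i (scan_gates f C)) (nth GIn C i).
Proof.
elim/last_ind: C => // C g IH; rewrite size_rcons ltnS => iC.
rewrite scan_gates_rcons !nth_rcons size_scan_gates -cats1 takel_cat ?size_scan_gates //.
move: iC; rewrite leq_eqVlt => /predU1P[->|iC]; last by rewrite iC IH.
by rewrite ltnn eqxx -(size_scan_gates f C) take_size.
Qed.

Section Reads.

Variable C : circuit.
Hypotheses (Cwf : circuit_wf C) (rC : reads C).

Let n := size C.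

Lemma args_lt i : i < n -> all (fun j => j < i) (gate_args (nth GIn C i)).
Proof. by move=> iC; have [_ /(_ i iC)[]] := Cwf. Qed.

Lemma map_argx i : i < n ->
  [seq argx i b | b <- iota 0 (arx i)] = gate_args (nth GIn C i).
Proof.
move=> iC; apply: (@eq_from_nth _ 0); rewrite size_map size_iota ?(reads_ar rC) // => b bi.
by rewrite (nth_map 0) ?size_iota // nth_iota // (reads_arg rC) // (reads_ar rC).
Qed.

Lemma all_argx i (P : pred nat) : i < n ->
  all (fun b => P (argx i b)) (iota 0 (arx i)) = all P (gate_args (nth GIn C i)).
Proof. by move=> iC; rewrite -map_argx // all_map. Qed.

Lemma has_argx i (P : pred nat) : i < n ->
  has (fun b => P (argx i b)) (iota 0 (arx i)) = has P (gate_args (nth GIn C i)).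
Proof. by move=> iC; rewrite -map_argx // has_map. Qed.

Lemma reads_node_ok i : i < n -> node_ok n tyx arx argx i && args_uniq i.
Proof.
move=> iC; have Hlt := args_lt iC; have [_ /(_ i iC)[Hw _]] := Cwf.
rewrite /node_ok (all_argx (fun j => j < i) iC) Hlt andbT.
have sz : uniq (gate_args (nth GIn C i)) -> size (gate_args (nth GIn C i)) <= n.
  move=> U'; rewrite -(size_iota 0 n); apply: uniq_leq_size U' _ => j /(allP Hlt) ji.
  by rewrite mem_iota; exact: ltn_trans iC.
have Hu : uniq (gate_args (nth GIn C i)) -> args_uniq i.
  rewrite -map_argx // => U'; apply/allP => b; rewrite mem_iota => bi.
  apply/allP => c; rewrite mem_iota => ci; apply/implyP => bc.
  apply: contraTneq bc => Ebc; rewrite -leqNgt.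
  have := nth_uniq 0 (s := [seq argx i b | b <- iota 0 (arx i)]) (i := b) (j := c).
  rewrite size_map size_iota !(nth_map 0) ?size_iota // !nth_iota // => /(_ bi ci U').
  by rewrite !add0n Ebc eqxx => /esym/eqP->.
rewrite (reads_ty rC) // (reads_ar rC) //.
case: (nth GIn C i) Hw sz Hu => [|j|a|a] /=; first by move=> _ _ ->.
- by move=> _ _ ->.
- by move=> /andP[-> ua] sz ->; rewrite ?sz.
- by move=> /andP[-> ua] sz ->; rewrite ?sz.
Qed.

Lemma nodes_ok i : i < n -> node_ok n tyx arx argx i.
Proof. by case/reads_node_ok/andP. Qed.

Lemma eq_all_take (A : Type) (a0 : A) (vs : seq A) i (P : A -> bool) l :
  all (fun j => j < i) l ->
  all (fun j => P (nth a0 (take i vs) j)) l = all (fun j => P (nth a0 vs j)) l.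
Proof. by move=> /allP li; apply: eq_in_all => j /li ji; rewrite nth_take. Qed.

Lemma eq_has_take (A : Type) (a0 : A) (vs : seq A) i (P : A -> bool) l :
  all (fun j => j < i) l ->
  has (fun j => P (nth a0 (take i vs) j)) l = has (fun j => P (nth a0 vs j)) l.
Proof. by move=> /allP li; apply: eq_in_has => j /li ji; rewrite nth_take. Qed.

Lemma last_scan (A : Type) (a0 : A) (f : seq A -> gate -> A) :
  last a0 (scan_gates f C) = nth a0 (scan_gates f C) n.-1.
Proof. by rewrite -nth_last size_scan_gates. Qed.

Lemma n_gt0 : 0 < n. Proof. by case: Cwf. Qed.

Lemma pred_lt : n.-1 < n. Proof. by rewrite prednK // n_gt0. Qed.

Lemma circuit_eval_val f (S : seq nat) : dle tyx arx argx f n.-1 ->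
  circuit_eval C (mem S) = node_val tyx arx argx f S n.-1.
Proof.
rewrite /circuit_eval last_scan; set F := fun vs g => _; set vs := scan_gates F C.
elim: f n.-1 pred_lt => [|f IH] i iC /=.
  rewrite nth_scan_gates // /F (reads_ty rC) //; case: (nth GIn C i) => //= _.
  by rewrite size_takel ?size_scan_gates // ltnW.
rewrite all_argx // all_argx // has_argx //.
have Hlt := args_lt iC; rewrite nth_scan_gates // -/vs /F (reads_ty rC) //.
case: (eqVneq (kind (nth GIn C i)) 0) => [k0 _|k0] /=.
  case: (nth GIn C i) k0 Hlt => //= _ _.
  by rewrite size_takel ?size_scan_gates // ltnW.
move=> /allP Hd; have IH' j : j \in gate_args (nth GIn C i) ->
    nth false vs j = node_val tyx arx argx f S j.
  move=> ja; apply: IH (Hd j ja); apply: ltn_trans (iC).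
  exact: (allP Hlt).
have A1 : kind (nth GIn C i) = 1 -> argx i 0 = nth 0 (gate_args (nth GIn C i)) 0.
  move=> k1; rewrite (reads_arg rC) // (reads_ar rC) //.
  by case: (nth GIn C i) k1.
case: (nth GIn C i) Hlt IH' A1 k0 => [|j|a|a] //= Hlt IH' A1 _.
- by rewrite A1 // nth_take ?IH' ?mem_head //; case/andP: Hlt.
- rewrite (eq_all_take false vs id) //; exact: eq_in_all.
- rewrite (eq_has_take false vs id) //; exact: eq_in_has.
Qed.

Lemma bigmax_leq_seq (l : seq nat) (F : nat -> nat) m :
  (\max_(i <- l) F i <= m) = all (fun i => F i <= m) l.
Proof.
apply/idP/allP => [H i il|H]; last by apply/bigmax_leqP_seq => i il _; exact: H.
by apply: leq_trans H; apply: (leq_bigmax_seq _ il).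
Qed.

Lemma depth_dle f : (depth C <= f) = dle tyx arx argx f n.-1.
Proof.
rewrite /depth last_scan; set F := fun ds g => _; set ds := scan_gates F C.
have E i : i < n -> nth 0 ds i = if kind (nth GIn C i) == 0 then 0
    else (\max_(j <- gate_args (nth GIn C i)) nth 0 ds j).+1.
  move=> iC; rewrite nth_scan_gates // -/ds /F.
  have M : \max_(j <- gate_args (nth GIn C i)) nth 0 (take i ds) j =
      \max_(j <- gate_args (nth GIn C i)) nth 0 ds j.
    by apply: eq_big_seq => j /(allP (args_lt iC)) ji; rewrite nth_take.
  by case: (nth GIn C i) M => //= *; congr _.+1.
elim: f n.-1 pred_lt => [|f IH] i iC /=; rewrite E // (reads_ty rC) //.
  by case: eqP.
rewrite all_argx //; case: eqP => //= _; rewrite ltnS bigmax_leq_seq.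
apply: eq_in_all => j /(allP (args_lt iC)) ji.
by apply: IH; exact: ltn_trans iC.
Qed.

(** [weft1] and [small] accept when the fuel runs out; within the depth bound this happens at inputs
    only. *)
Lemma weft_weft1 f : dle tyx arx argx f n.-1 ->
  (weft C <= 1) = weft1 arx argx f n.-1.
Proof.
rewrite /weft last_scan; set F := fun ws g => _; set ws := scan_gates F C.
have E i : i < n -> nth 0 ws i = (2 < arx i) +
    \max_(j <- gate_args (nth GIn C i)) nth 0 ws j.
  move=> iC; rewrite nth_scan_gates // -/ws /F (reads_ar rC) //; congr (_ + _).
  by apply: eq_big_seq => j /(allP (args_lt iC)) ji; rewrite nth_take.
have E0 i : i < n -> tyx i = 0 -> nth 0 ws i = 0.
  move=> iC; rewrite E // (reads_ty rC) // (reads_ar rC) //.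
  by case: (nth GIn C i) => //= _; rewrite big_nil.
have S g i : i < n -> dle tyx arx argx g i -> (nth 0 ws i <= 0) = small arx argx g i.
  elim: g i => [|g IH] i iC /=; first by move/eqP/(E0 i iC)->.
  case: (eqVneq (tyx i) 0) => [t0 _|t0] /=.
    rewrite (E0 i iC t0); have : arx i = 0 by rewrite /arx t0.
    by move->.
  rewrite !all_argx // => /allP Hd; rewrite E // leqn0 addn_eq0 eqb0 -leqNgt -leqn0 bigmax_leq_seq.
  congr (_ && _); apply: eq_in_all => j ja; apply: IH (Hd j ja).
  by apply: ltn_trans (iC); exact: (allP (args_lt iC)).
elim: f n.-1 pred_lt => [|f IH] i iC /=; first by move/eqP/(E0 i iC)->.
case: (eqVneq (tyx i) 0) => [t0 _|t0] /=.
  rewrite (E0 i iC t0); have : arx i = 0 by rewrite /arx t0.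
  by move->.
rewrite !all_argx // => /allP Hd; rewrite E // ltnNge; case: (arx i <= 2) => /=.
  rewrite add0n bigmax_leq_seq; apply: eq_in_all => j ja; apply: IH (Hd j ja).
  by apply: ltn_trans (iC); exact: (allP (args_lt iC)).
rewrite addnC addn1 ltnS bigmax_leq_seq; apply: eq_in_all => j ja; apply: S (Hd j ja).
by apply: ltn_trans (iC); exact: (allP (args_lt iC)).
Qed.

End Reads.

Lemma validP d : valid d <-> exists C, [/\ circuit_wf C, weft C <= 1, depth C <= d &
  x = encode_circuit C].
Proof.
split=> [vx|[C [Cwf Cw Cd xE]]].
  have [xE wf rC] := decoded_reads vx; exists decoded.
  have := vx; rewrite /valid (reads_nn rC) => /and5P[_ _ _ _ /andP[Hd Hw]].
  by rewrite (depth_dle wf rC) (weft_weft1 wf rC Hd).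
have rC := encoded_reads xE; have nE := reads_nn rC.
have Hd : dle tyx arx argx d nnodes.-1 by rewrite nE -depth_dle.
rewrite /valid (encoded_pos xE) eqxx Hd nE.
rewrite -(weft_weft1 Cwf rC) -?nE // Cw {1}nE (n_gt0 Cwf) /=.
apply/andP; split; first by rewrite nE xE.
rewrite andbT; apply/allP => i; rewrite mem_iota nE => iC.
exact: reads_node_ok.
Qed.

End Decode.

(** * Functions computed by expressions *)

Section Computed.

Variable beta : nat.

Notation cap := (cap beta).

(* x is the word, k the parameter, and s the values of the variables. *)
Definition Cx (f : seq nat -> nat -> seq nat -> nat) : Prop :=
  exists e, forall x k s, eden beta x k s e = f x k s.

Definition Bx (b : seq nat -> nat -> seq nat -> bool) : Prop :=
  Cx (fun x k s => nat_of_bool (b x k s)).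

(** Values are numbers, so a list is given by one expression per entry; its length [m] is fixed
    independently of the input. *)
Definition Lx (m : nat) (F : seq nat -> nat -> seq nat -> seq nat) : Prop :=
  exists2 es, size es = m & forall x k s, [seq eden beta x k s e | e <- es] = F x k s.

Definition Sx (F : seq nat -> nat -> seq nat -> seq nat) : Prop :=
  exists c, forall x k s, sden beta x k s c = F x k s.

Lemma Cx_eden e : Cx (fun x k s => eden beta x k s e).
Proof. by exists e. Qed.

Lemma Cx_var i : Cx (fun x k s => nth 0 s i).
Proof. by exists (EVar i). Qed.

Lemma Cx_cst c : Cx (fun x k s => c).
Proof. by exists (ECst c). Qed.

Lemma Cx_par : Cx (fun x k s => k).
Proof. by exists EK. Qed.

Lemma Cx_size : Cx (fun x k s => size x).
Proof. by exists ESz. Qed.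

Lemma Cx_add f g : Cx f -> Cx g -> Cx (fun x k s => f x k s + g x k s).
Proof. by move=> [e He] [e' He']; exists (EAdd e e') => x k s /=; rewrite He He'. Qed.

Lemma Cx_sub f g : Cx f -> Cx g -> Cx (fun x k s => f x k s - g x k s).
Proof. by move=> [e He] [e' He']; exists (ESub e e') => x k s /=; rewrite He He'. Qed.

Lemma Cx_succ f : Cx f -> Cx (fun x k s => (f x k s).+1).
Proof. by move=> [e He]; exists (EAdd (ECst 1) e) => x k s /=; rewrite He. Qed.

Lemma Cx_pred f : Cx f -> Cx (fun x k s => (f x k s).-1).
Proof. by move=> [e He]; exists (ESub e (ECst 1)) => x k s /=; rewrite He subn1. Qed.

Lemma Cx_get f : Cx f -> Cx (fun x k s => nth 0 x (f x k s)).
Proof. by move=> [e He]; exists (EGet e) => x k s /=; rewrite He. Qed.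

Lemma Cx_if b f g : Bx b -> Cx f -> Cx g ->
  Cx (fun x k s => if b x k s then f x k s else g x k s).
Proof.
move=> [e He] [e1 H1] [e2 H2]; exists (EIf e e1 e2) => x k s /=.
by rewrite He H1 H2; case: (b x k s).
Qed.

Lemma Cx_drop n f : Cx f -> Cx (fun x k s => f x k (drop n s)).
Proof. by move=> [e He]; exists (EDrop n e) => x k s /=; rewrite He. Qed.

Lemma Cx_iter f g0 (g : seq nat -> nat -> seq nat -> nat -> nat -> nat) :
  Cx f -> Cx g0 ->
  Cx (fun x k s => g x k (drop 2 s) (nth 0 s 0) (nth 0 s 1)) ->
  Cx (fun x k s => iteri (minn (f x k s) (cap x k)) (g x k s) (g0 x k s)).
Proof.
move=> [e He] [e0 H0] [e1 H1]; exists (EIter e e0 e1) => x k s /=.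
rewrite He H0; elim: (minn _ _) => //= i ->.
by rewrite H1 /= drop0.
Qed.

Lemma Bx_leq f g : Cx f -> Cx g -> Bx (fun x k s => f x k s <= g x k s).
Proof.
move=> [e He] [e' He']; exists (ESub (ECst 1) (ESub e e')) => x k s /=.
by rewrite He He'; lia.
Qed.

Lemma Bx_eq f g : Cx f -> Cx g -> Bx (fun x k s => f x k s == g x k s).
Proof.
move=> [e He] [e' He'].
exists (ESub (ECst 1) (EAdd (ESub e e') (ESub e' e))) => x k s /=.
by rewrite He He'; lia.
Qed.

Lemma Bx_cst (b : bool) : Bx (fun x k s => b).
Proof. exact: Cx_cst. Qed.

Lemma Bx_if b f g : Bx b -> Bx f -> Bx g ->
  Bx (fun x k s => if b x k s then f x k s else g x k s).
Proof.
by move=> Hb Hf Hg; have [e He] := Cx_if Hb Hf Hg; exists e => x k s; rewrite He; case: ifP.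
Qed.

Lemma Bx_and b c : Bx b -> Bx c -> Bx (fun x k s => b x k s && c x k s).
Proof. by move=> Hb Hc; apply: Bx_if Hb Hc (Bx_cst false). Qed.

Lemma Bx_or b c : Bx b -> Bx c -> Bx (fun x k s => b x k s || c x k s).
Proof. by move=> Hb Hc; apply: Bx_if Hb (Bx_cst true) Hc. Qed.

Lemma Bx_not b : Bx b -> Bx (fun x k s => ~~ b x k s).
Proof. by move=> Hb; apply: Bx_if Hb (Bx_cst false) (Bx_cst true). Qed.

Lemma Bx_imp b c : Bx b -> Bx c -> Bx (fun x k s => b x k s ==> c x k s).
Proof. by move=> Hb Hc; apply: Bx_if Hb Hc (Bx_cst true). Qed.

Lemma Cx_min f g : Cx f -> Cx g -> Cx (fun x k s => minn (f x k s) (g x k s)).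
Proof.
move=> Hf Hg; have [e He] := Cx_sub Hf (Cx_sub Hf Hg).
by exists e => x k s; rewrite He; lia.
Qed.

Lemma Cx_mulc c f : Cx f -> Cx (fun x k s => c * f x k s).
Proof.
move=> Hf; elim: c => [|c IH]; first by have [e He] := Cx_cst 0; exists e.
by have [e He] := Cx_add Hf IH; exists e => x k s; rewrite He mulSn.
Qed.

(** A loop with such a bound makes all its rounds in spite of the cap. *)
Definition small_fun (f : seq nat -> nat -> seq nat -> nat) : Prop :=
  forall x k s, f x k s <= cap x k.

(** Multiplication is repeated addition, as the machine has none; the first factor is the number of
    rounds. *)
Lemma Cx_mul f g : small_fun f -> Cx f -> Cx g -> Cx (fun x k s => f x k s * g x k s).
Proof.
move=> sf Hf Hg.
have [e He] := @Cx_iter f (fun _ _ _ => 0) (fun x k s _ a => g x k s + a) Hf (Cx_cst 0)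
  (Cx_add (Cx_drop 2 Hg) (Cx_var 1)).
exists e => x k s; rewrite He (minn_idPl (sf x k s)).
by elim: (f x k s) => //= i ->; rewrite mulSn.
Qed.

Lemma Cx_sum f g : small_fun f -> Cx f ->
  Cx (fun x k s => g x k (drop 2 s) (nth 0 s 0)) ->
  Cx (fun x k s => \sum_(i <- iota 0 (f x k s)) g x k s i).
Proof.
move=> sf Hf Hg.
have [e He] := @Cx_iter f (fun _ _ _ => 0) (fun x k s i a => a + g x k s i) Hf (Cx_cst 0)
  (Cx_add (Cx_var 1) Hg).
exists e => x k s; rewrite He (minn_idPl (sf x k s)).
elim: (f x k s) => [|i IH]; first by rewrite big_nil.
by rewrite [LHS]/= IH -[in RHS]addn1 iotaD big_cat /= big_seq1.
Qed.

Lemma Bx_all f p : small_fun f -> Cx f ->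
  Bx (fun x k s => p x k (drop 2 s) (nth 0 s 0)) ->
  Bx (fun x k s => all (p x k s) (iota 0 (f x k s))).
Proof.
move=> sf Hf Hp; have [e He] := Bx_eq
  (@Cx_sum f (fun x k s i => nat_of_bool (~~ p x k s i)) sf Hf (Bx_not Hp)) (Cx_cst 0).
exists e => x k s; rewrite He; congr nat_of_bool.
elim: (iota _ _) => [|i r IH]; first by rewrite big_nil.
by rewrite big_cons addn_eq0 IH /=; case: (p x k s i).
Qed.

Lemma Bx_has f p : small_fun f -> Cx f ->
  Bx (fun x k s => p x k (drop 2 s) (nth 0 s 0)) ->
  Bx (fun x k s => has (p x k s) (iota 0 (f x k s))).
Proof.
move=> sf Hf Hp.
have [e He] := Bx_not (@Bx_all f (fun x k s i => ~~ p x k s i) sf Hf (Bx_not Hp)).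
by exists e => x k s; rewrite He -has_predC; congr nat_of_bool; apply: eq_has => i /=; rewrite negbK.
Qed.

Lemma Lx_nil : Lx 0 (fun x k s => [::]).
Proof. by exists [::]. Qed.

Lemma Lx_cons m f F : Cx f -> Lx m F -> Lx m.+1 (fun x k s => f x k s :: F x k s).
Proof.
move=> [e He] [es se Hes]; exists (e :: es); first by rewrite /= se.
by move=> x k s /=; rewrite He Hes.
Qed.

Lemma Lx_cat m m' F F' : Lx m F -> Lx m' F' -> Lx (m + m') (fun x k s => F x k s ++ F' x k s).
Proof.
move=> [es se H] [es' se' H']; exists (es ++ es'); first by rewrite size_cat se se'.
by move=> x k s; rewrite map_cat H H'.
Qed.

Lemma Lx_nseq m f : Cx f -> Lx m (fun x k s => nseq m (f x k s)).
Proof.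
move=> [e He]; exists (nseq m e); first by rewrite size_nseq.
by move=> x k s; rewrite map_nseq He.
Qed.

Lemma Lx_drop m n F : Lx m F -> Lx m (fun x k s => F x k (drop n s)).
Proof.
move=> [es se H]; exists (map (EDrop n) es); first by rewrite size_map.
by move=> x k s; rewrite -map_comp -H; apply: eq_map.
Qed.

Lemma Lx_take m n F : Lx m F -> Lx (minn n m) (fun x k s => take n (F x k s)).
Proof.
move=> [es se H]; exists (take n es); first by rewrite size_take_min se.
by move=> x k s; rewrite -H map_take.
Qed.

Lemma Lx_dropl m n F : Lx m F -> Lx (m - n) (fun x k s => drop n (F x k s)).
Proof.
move=> [es se H]; exists (drop n es); first by rewrite size_drop se.
by move=> x k s; rewrite -H map_drop.
Qed.

Lemma Lx_vars m (h : nat -> nat) : Lx m (fun x k s => mkseq (fun a => nth 0 s (h a)) m).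
Proof.
exists (mkseq (fun a => EVar (h a)) m); first by rewrite size_mkseq.
by move=> x k s; rewrite /mkseq -map_comp.
Qed.

Lemma Cx_nth m F f : Lx m F -> Cx f -> Cx (fun x k s => nth 0 (F x k s) (f x k s)).
Proof.
move=> [es _ H] Hf; elim: es F H f Hf => [|e es IH] F H f Hf.
  by exists (ECst 0) => x k s; rewrite -H nth_nil.
have [g Hg] := Cx_if (Bx_eq Hf (Cx_cst 0)) (Cx_eden e)
  (IH _ (fun _ _ _ => erefl) _ (Cx_pred Hf)).
exists g => x k s; rewrite Hg -H.
by case: (f x k s).
Qed.

Lemma Bx_mem m F f : Lx m F -> Cx f -> Bx (fun x k s => f x k s \in F x k s).
Proof.
move=> [es _ H] Hf; elim: es F H => [|e es IH] F H.
  by exists (ECst 0) => x k s; rewrite -H.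
have [g Hg] := Bx_or (Bx_eq Hf (Cx_eden e)) (IH _ (fun _ _ _ => erefl)).
by exists g => x k s; rewrite Hg -H.
Qed.

Lemma Bx_eqseq m m' F G : Lx m F -> Lx m' G -> Bx (fun x k s => F x k s == G x k s).
Proof.
move=> [es _ H] [fs _ H']; elim: es fs F G H H' => [|e es IH] [|f fs] F G H H'.
- by exists (ECst 1) => x k s; rewrite -H -H'.
- by exists (ECst 0) => x k s; rewrite -H -H'.
- by exists (ECst 0) => x k s; rewrite -H -H'.
have [g Hg] := Bx_and (Bx_eq (Cx_eden e) (Cx_eden f)) (IH fs _ _ (fun _ _ _ => erefl) (fun _ _ _ => erefl)).
by exists g => x k s; rewrite Hg -H -H' /= eqseq_cons.
Qed.

Lemma mkseqSl (A : Type) (f : nat -> A) m :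
  mkseq f m.+1 = f 0 :: mkseq (fun a => f a.+1) m.
Proof. by rewrite /mkseq /= -[1]addn0 iotaDl -map_comp. Qed.

Definition small_list (F : seq nat -> nat -> seq nat -> seq nat) : Prop :=
  forall x k s, all (fun r => r <= cap x k) (F x k s).

Lemma small_list_cons e es F : small_list F ->
  (forall x k s, [seq eden beta x k s e | e <- e :: es] = F x k s) ->
  small_fun (fun x k s => eden beta x k s e) /\
  small_list (fun x k s => [seq eden beta x k s e | e <- es]).
Proof. by move=> sF H; split=> x k s; have := sF x k s; rewrite -H => /andP[]. Qed.

Lemma Cx_volume m F : small_list F -> Lx m F -> Cx (fun x k s => volume (F x k s)).
Proof.
move=> sF [es _ H]; elim: es F sF H => [|e es IH] F sF H.
  by exists (ECst 1) => x k s; rewrite -H.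
have [s1 s2] := small_list_cons sF H.
have [g Hg] := Cx_mul s1 (Cx_eden e) (IH _ s2 (fun _ _ _ => erefl)).
by exists g => x k s; rewrite Hg -H.
Qed.

Lemma Cx_rank m F m' G : small_list F -> Lx m F -> Lx m' G ->
  Cx (fun x k s => rank (F x k s) (G x k s)).
Proof.
move=> sF [es _ H] [fs _ H']; elim: es fs F G sF H H' => [|e es IH] [|f fs] F G sF H H'.
- by exists (ECst 0) => x k s; rewrite -H.
- by exists (ECst 0) => x k s; rewrite -H.
- by exists (ECst 0) => x k s; rewrite -H -H'.
have [s1 s2] := small_list_cons sF H.
have [g Hg] := Cx_add (Cx_mul s1 (Cx_eden e)
  (IH fs _ _ s2 (fun _ _ _ => erefl) (fun _ _ _ => erefl))) (Cx_eden f).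
by exists g => x k s; rewrite Hg -H -H'.
Qed.

(** Nested sums, one per digit, the first digit belonging to the innermost. Each sum binds an index
    and an accumulator, so the digits are the variables of even index; in [Sx_vecs] a loop binds its
    index only. *)
Lemma Cx_sum_vecs m F g : small_list F -> Lx m F ->
  Cx (fun x k s => g x k (drop m.*2 s) (mkseq (fun a => nth 0 s a.*2) m)) ->
  Cx (fun x k s => \sum_(t <- vecs (F x k s)) g x k s t).
Proof.
move=> sF [es <- H]; elim: es F g sF H => [|e es IH] F g sF H Hg.
  have [e He] := Hg; exists e => x k s; rewrite He /= drop0 -H /=.
  by rewrite big_seq1.
have [s1 s2] := small_list_cons sF H.
pose h x k s t := \sum_(i <- iota 0 (eden beta x k s e)) g x k s (i :: t).
have Hh : Cx (fun x k s => h x k (drop (size es).*2 s) (mkseq (fun a => nth 0 s a.*2) (size es))).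
  apply: (@Cx_sum (fun x k s => eden beta x k (drop (size es).*2 s) e)
    (fun x k s i => g x k (drop (size es).*2 s) (i :: mkseq (fun a => nth 0 s a.*2) (size es)))).
  - by move=> x k s; exact: s1.
  - exact: Cx_drop _ (Cx_eden e).
  case: Hg => e' He'; exists e' => x k s; rewrite He' drop_drop addn2.
  congr (g x k _ _); rewrite [size (e :: es)]/= mkseqSl; congr (_ :: _).
  by apply: eq_mkseq => a; rewrite nth_drop.
have [g' Hg'] := IH _ _ s2 (fun _ _ _ => erefl) Hh.
exists g' => x k s; rewrite Hg' -H /= big_allpairs_dep.
by apply: eq_bigr.
Qed.

Lemma Sx_nil : Sx (fun x k s => [::]).
Proof. by exists SNil. Qed.

Lemma Sx_cat F G : Sx F -> Sx G -> Sx (fun x k s => F x k s ++ G x k s).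
Proof. by move=> [c Hc] [c' Hc']; exists (SSeq c c') => x k s /=; rewrite Hc Hc'. Qed.

Lemma Sx_cons f G : Cx f -> Sx G -> Sx (fun x k s => f x k s :: G x k s).
Proof.
by move=> [e He] [c Hc]; exists (SSeq (SEmit e) c) => x k s /=; rewrite He Hc.
Qed.

Lemma Sx_if b F G : Bx b -> Sx F -> Sx G ->
  Sx (fun x k s => if b x k s then F x k s else G x k s).
Proof.
move=> [e He] [c Hc] [c' Hc']; exists (SIf e c c') => x k s /=.
by rewrite He Hc Hc'; case: (b x k s).
Qed.

Lemma Sx_for f G : small_fun f -> Cx f ->
  Sx (fun x k s => G x k (drop 1 s) (nth 0 s 0)) ->
  Sx (fun x k s => flatten [seq G x k s i | i <- iota 0 (f x k s)]).
Proof.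
move=> sf [e He] [c Hc]; exists (SFor e c) => x k s /=.
rewrite He (minn_idPl (sf x k s)); congr flatten; apply: eq_map => i.
by rewrite Hc /= drop0.
Qed.

Lemma Sx_vecs m F G : small_list F -> Lx m F ->
  Sx (fun x k s => G x k (drop m s) (mkseq (nth 0 s) m)) ->
  Sx (fun x k s => flatten [seq G x k s t | t <- vecs (F x k s)]).
Proof.
move=> sF [es <- H]; elim: es F G sF H => [|e es IH] F G sF H HG.
  have [c Hc] := HG; exists c => x k s; rewrite Hc /= drop0 -H /=.
  by rewrite cats0.
have [s1 s2] := small_list_cons sF H.
pose h x k s t := flatten [seq G x k s (i :: t) | i <- iota 0 (eden beta x k s e)].
have Hh : Sx (fun x k s => h x k (drop (size es) s) (mkseq (nth 0 s) (size es))).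
  apply: (@Sx_for (fun x k s => eden beta x k (drop (size es) s) e)
    (fun x k s i => G x k (drop (size es) s) (i :: mkseq (nth 0 s) (size es)))).
  - by move=> x k s; exact: s1.
  - exact: Cx_drop _ (Cx_eden e).
  case: HG => c Hc; exists c => x k s; rewrite Hc drop_drop addn1.
  congr (G x k _ _); rewrite [size (e :: es)]/= mkseqSl; congr (_ :: _).
  by apply: eq_mkseq => a; rewrite nth_drop.
have [c Hc] := IH _ _ s2 (fun _ _ _ => erefl) Hh.
exists c => x k s; rewrite Hc -H /=; elim: (vecs _) => //= t r ->.
by rewrite map_cat flatten_cat /h -map_comp.
Qed.

End Computed.

(** * The encoding of the gadget of a system indexed by vectors *)

Section VecWord.

Variables (RI RC : seq nat) (W : seq nat -> seq nat -> nat) (T : seq nat -> nat).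

Let I := volume RI.
Let J := volume RC.
Let w i c := W (nth [::] (vecs RI) i) (nth [::] (vecs RC) c).
Let g c := T (nth [::] (vecs RC) c).

Definition vec_row t := \sum_(c <- vecs RC) W t c.
Definition vec_total := \sum_(c <- vecs RC) T c.

(** The number of edges between items and columns is written [volume (RI ++ RC)], since [Cx_mul]
    asks for a factor below the cap, which the single digit ranges are and [volume RI] in general is
    not. *)
Definition vec_word : seq nat :=
  (volume RC + volume RI + 4).+1 :: volume RI + volume (RI ++ RC) + volume RC + 4 ::
  flatten [seq [:: T c] | c <- vecs RC] ++
  flatten [seq [:: vec_row t] | t <- vecs RI] ++
  [:: \sum_(t <- vecs RI) vec_row t - vec_total; vec_total; 1; 1; 1] ++
  flatten [seq [:: volume RC + volume RI; volume RC + rank RI t; vec_row t] | t <- vecs RI] ++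
  flatten [seq flatten [seq [:: volume RC + rank RI t; rank RC c; W t c] | c <- vecs RC]
          | t <- vecs RI] ++
  flatten [seq [:: rank RC c; volume RC + volume RI + 1; T c] | c <- vecs RC] ++
  [:: volume RC + volume RI + 1; volume RC + volume RI + 2; vec_total;
      volume RC + volume RI + 2; volume RC + volume RI + 3; 1;
      volume RC + volume RI + 3; volume RC + volume RI + 4; 1;
      volume RC + volume RI + 4; volume RC + volume RI + 2; 1].

Lemma total_vec : goal_total J g = vec_total.
Proof. by rewrite /goal_total /vec_total -(sum_vecs RC predT). Qed.

Lemma row_sum_vec i : row_sum J w i = vec_row (nth [::] (vecs RI) i).
Proof. by rewrite /row_sum /vec_row -(sum_vecs RC predT). Qed.

Lemma flatten_vecs (R : seq nat) (f : nat -> seq nat -> seq nat) :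
  flatten [seq f i (nth [::] (vecs R) i) | i <- iota 0 (volume R)] =
  flatten [seq f (rank R t) t | t <- vecs R].
Proof. by rewrite map_vecs. Qed.

Lemma map_flatten1 (A : Type) (f : A -> nat) s : [seq f a | a <- s] = flatten [seq [:: f a] | a <- s].
Proof. by elim: s => //= a s ->. Qed.

Lemma gadget_word_vec : gadget_word I J w g = vec_word.
Proof.
have volE : I * J = volume (RI ++ RC) by rewrite volume_cat.
rewrite /gadget_word /vec_word -volE -/I -/J; congr [:: _, _ & _].
have -> : [seq demand I J w g v | v <- iota 0 (J + I + 4).+1] =
   flatten [seq [:: T c] | c <- vecs RC] ++ flatten [seq [:: vec_row t] | t <- vecs RI] ++
   [:: \sum_(t <- vecs RI) vec_row t - vec_total; vec_total; 1; 1; 1].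
  rewrite (_ : (J + I + 4).+1 = J + (I + 5)); last by lia.
  rewrite iotaD map_cat iotaD map_cat add0n; congr (_ ++ (_ ++ _)).
  - rewrite -(flatten_vecs RC (fun _ c => [:: T c])) -map_flatten1.
    by apply/eq_in_map => c; rewrite mem_iota /demand => /andP[_ ->].
  - rewrite -(flatten_vecs RI (fun _ t => [:: vec_row t])) -map_flatten1.
    have -> : iota J I = map (addn J) (iota 0 I) by rewrite -iotaDl addn0.
    rewrite -map_comp; apply/eq_in_map => i; rewrite mem_iota => /= iI.
    by rewrite /demand ltnNge leq_addr ltn_add2l iI addKn row_sum_vec.
  have rows : \sum_(i <- iota 0 I) row_sum J w i = \sum_(t <- vecs RI) vec_row t.
    rewrite -(sum_vecs RI predT); apply: eq_bigr => i _; exact: row_sum_vec.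
  rewrite /= /demand total_vec rows; do ![rewrite ifF; last by lia].
  rewrite !eqxx ifF; last by lia.
  rewrite (_ : (J + I).+1 == J + I + 1); last by lia.
  by do ![rewrite ifF; last by lia].
rewrite /edges !map_cat !flatten_cat -!catA; do 3!congr (_ ++ _).
rewrite -map_comp -(flatten_vecs RI (fun i t => [:: J + I; J + i; vec_row t])).
congr (flatten _ ++ _); first by apply: eq_map => i; rewrite /= /wgt /= row_sum_vec.
rewrite map_allpairs -(flatten_vecs RI (fun i t => flatten [seq [:: J + i; rank RC c; W t c] | c <- vecs RC])).
congr (_ ++ _).
  rewrite -/I; elim: (iota 0 I) => //= i s IH; rewrite flatten_cat IH; congr (_ ++ _).
  by rewrite -(flatten_vecs RC (fun c d => [:: J + i; c; W _ d])).
rewrite -map_comp -(flatten_vecs RC (fun c d => [:: c; J + I + 1; T d])).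
congr (_ ++ _).
by rewrite /= /wgt /= total_vec.
Qed.

End VecWord.

(** * The reduction is computed by bounded iteration *)

Section Reduction.

Variable L : nat.

Let q := 2 ^ L.
Let beta := q.+2.

Notation cap := (cap beta).
Notation Cx := (Cx beta).
Notation Bx := (Bx beta).
Notation Lx := (Lx beta).
Notation Sx := (Sx beta).
Notation small_fun := (small_fun beta).
Notation small_list := (small_list beta).

(** The summand [beta = q.+2] of the cap makes room for loops of constant length, such as the [q.+1]
    values of the first digit of a column. *)
Lemma small_cst c : c <= q.+2 -> small_fun (fun x k s => c).
Proof. by move=> cq x k s; rewrite /cap; lia. Qed.

Lemma small_nn : small_fun (fun x k s => nnodes x).
Proof. by move=> x k s; rewrite /cap /nnodes; lia. Qed.

Lemma small_nnS : small_fun (fun x k s => (nnodes x).+1).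
Proof. by move=> x k s; rewrite /cap /nnodes; lia. Qed.

Lemma small_parS : small_fun (fun x k s => k.+1).
Proof. by move=> x k s; rewrite /cap; lia. Qed.

Lemma small_arx f : small_fun (fun x k s => arx x (f x k s)).
Proof.
by move=> x k s; rewrite /cap /arx; case: ifP => // _; case: ifP => _; lia.
Qed.

Lemma Cx_nn : Cx (fun x k s => nnodes x).
Proof. exact: Cx_min (Cx_get (Cx_cst _ 0)) (Cx_size _). Qed.

Lemma Cx_glen f : Cx f -> Cx (fun x k s => glen x (f x k s)).
Proof.
move=> Hf; apply: (Cx_if (Bx_eq (Cx_get Hf) (Cx_cst _ 0)) (Cx_cst _ 1) _).
apply: (Cx_if (Bx_eq (Cx_get Hf) (Cx_cst _ 1)) (Cx_cst _ 2) _).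
exact: Cx_succ (Cx_succ (Cx_get (Cx_succ Hf))).
Qed.

Lemma Cx_pos f : Cx f -> Cx (fun x k s => pos x (f x k s)).
Proof.
move=> Hf.
have [e He] := @Cx_iter beta (fun x k s => minn (f x k s) (size x)) (fun _ _ _ => 1)
  (fun x k s _ p => p + glen x p) (Cx_min Hf (Cx_size _)) (Cx_cst _ 1)
  (Cx_add (Cx_var _ 1) (Cx_glen (Cx_var _ 1))).
exists e => x k s; rewrite He (minn_idPl _) //.
by rewrite /cap; lia.
Qed.

Lemma Cx_tyx f : Cx f -> Cx (fun x k s => tyx x (f x k s)).
Proof. by move=> Hf; apply: (Cx_get (Cx_pos Hf)). Qed.

Lemma Cx_arx f : Cx f -> Cx (fun x k s => arx x (f x k s)).
Proof.
move=> Hf; apply: (Cx_if (Bx_eq (Cx_tyx Hf) (Cx_cst _ 0)) (Cx_cst _ 0) _).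
apply: (Cx_if (Bx_eq (Cx_tyx Hf) (Cx_cst _ 1)) (Cx_cst _ 1) _).
exact: Cx_min (Cx_get (Cx_succ (Cx_pos Hf))) (Cx_size _).
Qed.

Lemma Cx_argx f g : Cx f -> Cx g -> Cx (fun x k s => argx x (f x k s) (g x k s)).
Proof.
move=> Hf Hg; apply: Cx_get; apply: (Cx_add _ Hg); apply: (Cx_add (Cx_pos Hf) _).
exact: Cx_if (Bx_eq (Cx_tyx Hf) (Cx_cst _ 1)) (Cx_cst _ 1) (Cx_cst _ 2).
Qed.

Lemma Cx_argx_drop f : Cx f -> Cx (fun x k s => argx x (f x k (drop 2 s)) (nth 0 s 0)).
Proof. by move=> Hf; apply: (Cx_argx (Cx_drop 2 Hf) (Cx_var _ 0)). Qed.

(** The recursion on the fuel, a constant, is unfolded in the expression; loops serve only for the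
    arguments of a gate. *)
Lemma Bx_node_val f m Z g : Lx m Z -> Cx g ->
  Bx (fun x k s => node_val (tyx x) (arx x) (argx x) f (Z x k s) (g x k s)).
Proof.
move=> HZ Hg; elim: f m Z g HZ Hg => [|f IH] m Z g HZ Hg /=.
  exact: Bx_if (Bx_eq (Cx_tyx Hg) (Cx_cst _ 0)) (Bx_mem HZ Hg) (Bx_cst _ false).
apply: (Bx_if (Bx_eq (Cx_tyx Hg) (Cx_cst _ 0)) (Bx_mem HZ Hg) _).
apply: (Bx_if (Bx_eq (Cx_tyx Hg) (Cx_cst _ 1)) _ _).
  exact: Bx_not (IH _ _ _ HZ (Cx_argx Hg (Cx_cst _ 0))).
have H := IH _ _ _ (Lx_drop 2 HZ) (Cx_argx_drop Hg).
apply: (Bx_if (Bx_eq (Cx_tyx Hg) (Cx_cst _ 2)) _ _).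
  exact: (Bx_all (@small_arx g) (Cx_arx Hg) H).
exact: (Bx_has (@small_arx g) (Cx_arx Hg) H).
Qed.

Lemma Bx_dle f g : Cx g -> Bx (fun x k s => dle (tyx x) (arx x) (argx x) f (g x k s)).
Proof.
elim: f g => [|f IH] g Hg /=; first exact: Bx_eq (Cx_tyx Hg) (Cx_cst _ 0).
apply: (Bx_or (Bx_eq (Cx_tyx Hg) (Cx_cst _ 0)) _).
exact: (Bx_all (@small_arx g) (Cx_arx Hg) (IH _ (Cx_argx_drop Hg))).
Qed.

Lemma Bx_small f g : Cx g -> Bx (fun x k s => small (arx x) (argx x) f (g x k s)).
Proof.
elim: f g => [|f IH] g Hg /=; first exact: Bx_cst.
apply: (Bx_and (Bx_leq (Cx_arx Hg) (Cx_cst _ 2)) _).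
exact: (Bx_all (@small_arx g) (Cx_arx Hg) (IH _ (Cx_argx_drop Hg))).
Qed.

Lemma Bx_weft1 f g : Cx g -> Bx (fun x k s => weft1 (arx x) (argx x) f (g x k s)).
Proof.
elim: f g => [|f IH] g Hg /=; first exact: Bx_cst.
apply: (Bx_if (Bx_leq (Cx_arx Hg) (Cx_cst _ 2)) _ _).
  exact: (Bx_all (@small_arx g) (Cx_arx Hg) (IH _ (Cx_argx_drop Hg))).
exact: (Bx_all (@small_arx g) (Cx_arx Hg) (Bx_small f (Cx_argx_drop Hg))).
Qed.

Lemma Bx_leaf g : Cx g -> Bx (fun x k s => leaf (tyx x) (arx x) (g x k s)).
Proof.
move=> Hg; exact: Bx_or (Bx_eq (Cx_tyx Hg) (Cx_cst _ 0)) (Bx_leq (Cx_cst _ 3) (Cx_arx Hg)).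
Qed.

Lemma Cx_last_arg g : Cx g -> Cx (fun x k s => argx x (g x k s) (arx x (g x k s)).-1).
Proof. by move=> Hg; apply: (Cx_argx Hg (Cx_pred (Cx_arx Hg))). Qed.

Lemma Cx_lnode f u j : Cx u -> Cx j ->
  Cx (fun x k s => lnode (tyx x) (arx x) (argx x) f (u x k s) (j x k s)).
Proof.
elim: f u j => [|f IH] u j Hu Hj //=.
apply: (Cx_if (Bx_leaf Hu) Hu _).
apply: (Cx_if (Bx_leq (Cx_succ Hj) (Cx_cst _ (2 ^ f))) _ _).
  exact: IH (Cx_argx Hu (Cx_cst _ 0)) Hj.
exact: IH (Cx_last_arg Hu) (Cx_sub Hj (Cx_cst _ (2 ^ f))).
Qed.

Lemma Cx_cnt m u Z : Cx u -> Lx m Z ->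
  Cx (fun x k s => cnt L (tyx x) (arx x) (argx x) (u x k s) (Z x k s)).
Proof.
move=> Hu HZ; apply: (Cx_if (Bx_eq (Cx_tyx Hu) (Cx_cst _ 0)) (Bx_mem HZ Hu) _).
exact: (Cx_sum (@small_arx u) (Cx_arx Hu) (Bx_node_val L (Lx_drop 2 HZ) (Cx_argx_drop Hu))).
Qed.

Lemma Bx_truth u v : Cx u -> Cx v -> Bx (fun x k s => truth (tyx x) (arx x) (u x k s) (v x k s)).
Proof.
move=> Hu Hv; apply: (Bx_if (Bx_eq (Cx_tyx Hu) (Cx_cst _ 2)) (Bx_eq Hv (Cx_arx Hu)) _).
exact: Bx_not (Bx_eq Hv (Cx_cst _ 0)).
Qed.

Lemma Bx_tree_val m v f u o : Lx m v -> Cx u ->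
  Bx (fun x k s => tree_val (tyx x) (arx x) (argx x) (v x k s) f (u x k s) o).
Proof.
move=> Hv; elim: f u o => [|f IH] u o Hu /=.
  exact: Bx_truth Hu (Cx_nth Hv (Cx_cst _ o)).
apply: (Bx_if (Bx_leaf Hu) (Bx_truth Hu (Cx_nth Hv (Cx_cst _ o))) _).
have H0 := IH _ o (Cx_argx Hu (Cx_cst _ 0)).
have H1 := IH _ (o + 2 ^ f) (Cx_last_arg Hu).
apply: (Bx_if (Bx_eq (Cx_tyx Hu) (Cx_cst _ 1)) (Bx_not H0) _).
exact: Bx_if (Bx_eq (Cx_tyx Hu) (Cx_cst _ 2)) (Bx_and H0 H1) (Bx_or H0 H1).
Qed.

(** The recursion is unfolded along the directions; the size of the expression is exponential in
    their number, which is the constant [q] in the weights. *)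
Lemma Cx_mobius (N : seq nat -> nat -> seq nat -> seq nat -> nat) b m l m' Z :
  (forall m Z, Lx m Z -> Cx (fun x k s => N x k s (Z x k s))) ->
  Lx m l -> Lx m' Z ->
  Cx (fun x k s => mobius (nnodes x) (N x k s) b (l x k s) (Z x k s)).
Proof.
move=> HN [es _ H]; elim: es b l H m' Z => [|e es IH] b l H m' Z HZ.
  have [e He] := Cx_if (Bx_cst _ b) (HN _ _ HZ) (Cx_cst _ 0).
  by exists e => x k s; rewrite He -H.
have He := Cx_eden beta e.
have [g Hg] := Cx_if (Bx_eq He Cx_nn) (IH b _ (fun _ _ _ => erefl) _ _ HZ)
  (Cx_add (IH b _ (fun _ _ _ => erefl) _ _ (Lx_cons He HZ))
          (IH (~~ b) _ (fun _ _ _ => erefl) _ _ HZ)).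
by exists g => x k s; rewrite Hg -H.
Qed.

Lemma Cx_out : Cx (fun x k s => (nnodes x).-1).
Proof. exact: Cx_pred Cx_nn. Qed.

Definition leaf_cntx x := leaf_cnt (nnodes x) L (tyx x) (arx x) (argx x).

Lemma Cx_leaf_cnt a m Z : Cx a -> Lx m Z -> Cx (fun x k s => leaf_cntx x (a x k s) (Z x k s)).
Proof. by move=> Ha HZ; apply: (Cx_cnt (Cx_lnode L Cx_out Ha) HZ). Qed.

Lemma Cx_pow m f : Cx f -> Cx (fun x k s => k.+1 ^ m * f x k s).
Proof.
move=> Hf; elim: m => [|m IH]; first by have [e He] := Hf; exists e => x k s; rewrite mul1n.
have [e He] := Cx_mul small_parS (Cx_succ (Cx_par _)) IH.
by exists e => x k s; rewrite He expnS mulnA.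
Qed.

Lemma Bx_admissible m v m' r : Lx m v -> Lx m' r ->
  Bx (fun x k s => admissible (nnodes x) k L (tyx x) (arx x) (argx x) (v x k s) (r x k s)).
Proof.
move=> Hv Hr.
have small_q : small_fun (fun _ _ _ => q) by apply: small_cst; lia.
have small_q1 : small_fun (fun _ _ _ => q.-1) by apply: small_cst; lia.
have Hv' := Lx_drop 2 Hv; have Hr' := Lx_drop 2 Hr; have H0 := Cx_var beta 0.
apply: (Bx_if (Bx_eq (Cx_nth Hr (Cx_cst _ 0)) (Cx_cst _ 0)) _ (Bx_tree_val L 0 Hv Cx_out)).
apply: Bx_and.
  apply: (@Bx_all _ _ (fun x k s a => (nth 0 (r x k s) a.+1 < nth 0 (r x k s) a.+2) ==>
    (nth 0 (v x k s) a < nth 0 (v x k s) a.+1)) small_q1 (Cx_cst _ _)).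
  apply: (Bx_imp (Bx_leq (Cx_succ (Cx_nth Hr' (Cx_succ H0))) (Cx_nth Hr' (Cx_succ (Cx_succ H0)))) _).
  exact: Bx_leq (Cx_succ (Cx_nth Hv' H0)) (Cx_nth Hv' (Cx_succ H0)).
apply: (@Bx_all _ _ (fun x k s a => if nth 0 (r x k s) a.+1 < k then
    (nth 0 (v x k s) a < nnodes x) && (tyx x (nth 0 (v x k s) a) == 0)
  else nth 0 (v x k s) a == nnodes x) small_q (Cx_cst _ _)).
have Hva := Cx_nth Hv' H0.
apply: (Bx_if (Bx_leq (Cx_succ (Cx_nth Hr' (Cx_succ H0))) (Cx_par _)) _ (Bx_eq Hva Cx_nn)).
exact: Bx_and (Bx_leq (Cx_succ Hva) Cx_nn) (Bx_eq (Cx_tyx Hva) (Cx_cst _ 0)).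
Qed.

Lemma Bx_canon m r : Lx m r -> Bx (fun x k s => canon k L (r x k s)).
Proof.
move=> Hr; have small_q1 : small_fun (fun _ _ _ => q.-1) by apply: small_cst; lia.
have Hr' := Lx_drop 2 Hr; have H0 := Cx_var beta 0.
apply: (@Bx_all _ _ (fun x k s a => canon_rel k (nth 0 (r x k s) a.+1) (nth 0 (r x k s) a.+2))
  small_q1 (Cx_cst _ _)).
have H1 := Cx_nth Hr' (Cx_succ H0); have H2 := Cx_nth Hr' (Cx_succ (Cx_succ H0)).
exact: Bx_or (Bx_leq (Cx_succ H1) H2) (Bx_and (Bx_eq H1 (Cx_par _)) (Bx_eq H2 (Cx_par _))).
Qed.

Lemma Cx_offset : Cx (fun x k s => offset (nnodes x) L).
Proof. exact: Cx_mulc Cx_nn. Qed.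

Lemma Cx_weight m v m' r m'' r' a : Lx m v -> Lx m' r -> Cx a -> Lx m'' r' ->
  Cx (fun x k s => weight (nnodes x) k L (tyx x) (arx x) (argx x)
    (v x k s) (r x k s) (a x k s) (r' x k s)).
Proof.
move=> Hv Hr Ha Hr'; have Heq := Bx_eqseq Hr Hr'; have c0 := Cx_cst beta 0.
apply: (Cx_if (Bx_eq Ha (Cx_cst _ q)) _ _).
  exact: Cx_if Heq (Cx_if (Bx_admissible Hv Hr) (Cx_cst _ 1) (Cx_cst _ 2)) c0.
apply: (Cx_if (Bx_eq (Cx_nth Hr' c0) c0) _ _).
  apply: (Cx_add (Cx_if Heq (Cx_nth Hv Ha) c0) _).
  apply: (Cx_if _ (Cx_sub Cx_nn (Cx_nth Hv c0)) c0).
  exact: (Bx_eqseq Hr (Lx_cons c0 (Lx_nseq q (Cx_nth Hr' (Cx_succ Ha))))).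
apply: (Cx_add _ (Cx_if Heq (Cx_sub Cx_nn (Cx_nth Hv Ha)) c0)).
apply: (Cx_if (Bx_eq (Cx_nth Hr c0) c0) _ c0).
apply: (Cx_if (Bx_canon Hr) _ Cx_offset).
have HM b := @Cx_mobius (fun x k s => leaf_cntx x (a x k s)) b _ _ _ _
  (fun m Z HZ => Cx_leaf_cnt Ha HZ) Hv (Lx_nil _).
exact: Cx_sub (Cx_add Cx_offset (HM true)) (HM false).
Qed.

Lemma Cx_goal m r a : Cx a -> Lx m r ->
  Cx (fun x k s => goal (nnodes x) k L (a x k s) (r x k s)).
Proof.
move=> Ha Hr; have c0 := Cx_cst beta 0.
apply: (Cx_if (Bx_eq Ha (Cx_cst _ q)) (Cx_cst _ 1) _).
apply: (Cx_if (Bx_eq (Cx_nth Hr c0) c0) Cx_nn _).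
exact: Cx_add (Cx_pow q Cx_offset) Cx_nn.
Qed.

Definition item_weightx x k := item_weight (nnodes x) k L (tyx x) (arx x) (argx x).

Definition col_goalx x k := col_goal (nnodes x) k L.

Lemma Lx_behead m F : Lx m F -> Lx m.-1 (fun x k s => behead (F x k s)).
Proof.
move=> /(Lx_dropl 1)[es se H]; exists es; first by rewrite se subn1.
by move=> x k s; rewrite H drop1.
Qed.

Lemma Cx_item_weight m t m' c : Lx m t -> Lx m' c ->
  Cx (fun x k s => item_weightx x k (t x k s) (c x k s)).
Proof.
move=> Ht Hc; apply: Cx_succ.
exact: Cx_weight (Lx_take q Ht) (Lx_dropl q Ht) (Cx_nth Hc (Cx_cst _ 0)) (Lx_behead Hc).
Qed.

Lemma Cx_rows : Cx (fun x k s => 2 * k.+1 ^ q).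
Proof.
have [e He] := Cx_mulc 2 (Cx_pow q (Cx_cst _ 1)).
by exists e => x k s; rewrite He muln1.
Qed.

Lemma Cx_col_goal m c : Lx m c -> Cx (fun x k s => col_goalx x k (c x k s)).
Proof.
move=> Hc; apply: (Cx_add _ Cx_rows).
exact: Cx_goal (Cx_nth Hc (Cx_cst _ 0)) (Lx_behead Hc).
Qed.

Definition RI x k := item_range (nnodes x) k L.
Definition RC (x : seq nat) k := col_range k L.

Lemma Lx_row_range : Lx q.+1 (fun x k s => row_range k L).
Proof. exact: Lx_cons (Cx_cst _ 2) (Lx_nseq q (Cx_succ (Cx_par _))). Qed.

Lemma Lx_RI : Lx (q + q.+1) (fun x k s => RI x k).
Proof. exact: Lx_cat (Lx_nseq q (Cx_succ Cx_nn)) Lx_row_range. Qed.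

Lemma Lx_RC : Lx q.+2 (fun x k s => RC x k).
Proof. exact: Lx_cons (Cx_cst _ q.+1) Lx_row_range. Qed.

Lemma small_row_range : small_list (fun x k s => row_range k L).
Proof.
move=> x k s; rewrite /row_range /= all_nseq (@small_parS x k s) orbT andbT.
by rewrite /cap; lia.
Qed.

Lemma small_RI : small_list (fun x k s => RI x k).
Proof.
move=> x k s; rewrite /RI /item_range /opt_range all_cat all_nseq (@small_nnS x k s) orbT.
exact: (@small_row_range x k s).
Qed.

Lemma small_RC : small_list (fun x k s => RC x k).
Proof.
move=> x k s; rewrite /RC /col_range /=; apply/andP; split; last exact: (@small_row_range x k s).
by rewrite /cap; lia.
Qed.

Lemma small_cat F G : small_list F -> small_list G ->
  small_list (fun x k s => F x k s ++ G x k s).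
Proof. by move=> HF HG x k s; rewrite all_cat HF HG. Qed.

Lemma Cx_vec_row m t : Lx m t ->
  Cx (fun x k s => vec_row (RC x k) (item_weightx x k) (t x k s)).
Proof.
move=> Ht; apply: (@Cx_sum_vecs _ _ _ (fun x k s c => item_weightx x k (t x k s) c)
  small_RC Lx_RC).
exact: Cx_item_weight (Lx_drop _ Ht) (Lx_vars _ _ double).
Qed.

Lemma Cx_vec_total : Cx (fun x k s => vec_total (RC x k) (col_goalx x k)).
Proof.
apply: (@Cx_sum_vecs _ _ _ (fun x k s c => col_goalx x k c) small_RC Lx_RC).
exact: Cx_col_goal (Lx_vars _ _ double).
Qed.

Definition wordx x k := vec_word (RI x k) (RC x k) (item_weightx x k) (col_goalx x k).

Lemma Sx_word : Sx (fun x k s => wordx x k).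
Proof.
have HI := Cx_volume small_RI Lx_RI; have HJ := Cx_volume small_RC Lx_RC.
have HIJ := Cx_volume (small_cat small_RI small_RC) (Lx_cat Lx_RI Lx_RC).
have c n := Cx_cst beta n; have nil := Sx_nil beta.
have HT := Cx_vec_total.
have vI := Lx_vars beta (q + q.+1) id; have vC := Lx_vars beta q.+2 id.
have HJI n : Cx (fun x k s => volume (RC x k) + volume (RI x k) + n).
  exact: Cx_add (Cx_add HJ HI) (c n).
have rI m t : Lx m t -> Cx (fun x k s => volume (RC x k) + rank (RI x k) (t x k s)).
  by move=> Ht; apply: (Cx_add HJ (Cx_rank small_RI Lx_RI Ht)).
have rC m t : Lx m t -> Cx (fun x k s => rank (RC x k) (t x k s)).
  by move=> Ht; apply: (Cx_rank small_RC Lx_RC Ht).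
apply: Sx_cons; first exact: Cx_succ (HJI 4).
apply: Sx_cons; first exact: Cx_add (Cx_add (Cx_add HI HIJ) HJ) (c 4).
apply: Sx_cat.
  apply: (@Sx_vecs _ _ _ (fun x k s t => [:: col_goalx x k t]) small_RC Lx_RC).
  exact: Sx_cons (Cx_col_goal vC) nil.
apply: Sx_cat.
  apply: (@Sx_vecs _ _ _ (fun x k s t => [:: vec_row (RC x k) (item_weightx x k) t]) small_RI Lx_RI).
  exact: Sx_cons (Cx_vec_row vI) nil.
apply: Sx_cat.
  apply: Sx_cons.
    apply: (Cx_sub _ HT).
    apply: (@Cx_sum_vecs _ _ _ (fun x k s t => vec_row (RC x k) (item_weightx x k) t) small_RI Lx_RI).
    exact: Cx_vec_row (Lx_vars _ _ double).
  exact: Sx_cons HT (Sx_cons (c 1) (Sx_cons (c 1) (Sx_cons (c 1) nil))).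
apply: Sx_cat.
  apply: (@Sx_vecs _ _ _ (fun x k s t => [:: volume (RC x k) + volume (RI x k);
    volume (RC x k) + rank (RI x k) t; vec_row (RC x k) (item_weightx x k) t]) small_RI Lx_RI).
  exact: Sx_cons (Cx_add HJ HI) (Sx_cons (rI _ _ vI) (Sx_cons (Cx_vec_row vI) nil)).
apply: Sx_cat.
  apply: (@Sx_vecs _ _ _ (fun x k s t => flatten [seq [:: volume (RC x k) + rank (RI x k) t;
    rank (RC x k) c; item_weightx x k t c] | c <- vecs (RC x k)]) small_RI Lx_RI).
  have vI' := Lx_drop q.+2 vI.
  apply: (@Sx_vecs _ _ _ (fun x k s c => [:: volume (RC x k) + rank (RI x k) (mkseq (nth 0 s) (q + q.+1));
    rank (RC x k) c; item_weightx x k (mkseq (nth 0 s) (q + q.+1)) c]) small_RC Lx_RC).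
  exact: Sx_cons (rI _ _ vI') (Sx_cons (rC _ _ vC) (Sx_cons (Cx_item_weight vI' vC) nil)).
apply: Sx_cat.
  apply: (@Sx_vecs _ _ _ (fun x k s c => [:: rank (RC x k) c; volume (RC x k) + volume (RI x k) + 1;
    col_goalx x k c]) small_RC Lx_RC).
  exact: Sx_cons (rC _ _ vC) (Sx_cons (HJI 1) (Sx_cons (Cx_col_goal vC) nil)).
do 12!(apply: Sx_cons; first by [exact: HJI | exact: HT | exact: c]).
exact: nil.
Qed.

Lemma Sx_zeros m F : small_list F -> Lx m F -> Sx (fun x k s => nseq (volume (F x k s)) 0).
Proof.
move=> sF HF; have [c Hc] := @Sx_vecs _ _ _ (fun x k s t => [:: 0]) sF HF
  (Sx_cons (Cx_cst _ 0) (Sx_nil _)).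
exists c => x k s; rewrite Hc -size_vecs.
by elim: (vecs _) => //= t r ->.
Qed.

Lemma Sx_valid d F : Sx F -> Sx (fun x k s => if valid x d then F x k s else [::]).
Proof.
move=> HF; apply: (Sx_if _ HF (Sx_nil _)).
have H0 := Cx_var beta 0.
apply: (Bx_and (Bx_leq (Cx_cst _ 1) Cx_nn) _).
apply: (Bx_and (Bx_eq (Cx_get (Cx_cst _ 0)) Cx_nn) _).
apply: (Bx_and (Bx_eq (Cx_pos Cx_nn) (Cx_size _)) _).
apply: (Bx_and _ (Bx_and (Bx_dle d Cx_out) (Bx_weft1 d Cx_out))).
apply: (@Bx_all _ _ (fun x k s i => node_ok (nnodes x) (tyx x) (arx x) (argx x) i && args_uniq x i)
  small_nn Cx_nn).
apply: Bx_and.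
  apply: Bx_and; last first.
    apply: (@Bx_all _ _ (fun x k s b => argx x (nth 0 s 0) b < nth 0 s 0)
      (@small_arx (fun x k s => nth 0 s 0)) (Cx_arx H0)).
    exact: Bx_leq (Cx_succ (Cx_argx_drop H0)) (Cx_drop 2 H0).
  have [e He] := Bx_if (Bx_eq (Cx_tyx H0) (Cx_cst _ 0)) (Bx_eq (Cx_arx H0) (Cx_cst _ 0))
    (Bx_if (Bx_eq (Cx_tyx H0) (Cx_cst _ 1)) (Bx_eq (Cx_arx H0) (Cx_cst _ 1))
      (Bx_and (Bx_leq (Cx_tyx H0) (Cx_cst _ 3))
        (Bx_and (Bx_leq (Cx_cst _ 2) (Cx_arx H0)) (Bx_leq (Cx_arx H0) Cx_nn)))).
  by exists e => x k s; rewrite He; case: (tyx _ _) => [|[|[|[|t]]]].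
apply: (@Bx_all _ _ (fun x k s b => all (fun c => (b < c) ==>
  (argx x (nth 0 s 0) b != argx x (nth 0 s 0) c)) (iota 0 (arx x (nth 0 s 0))))
  (@small_arx (fun x k s => nth 0 s 0)) (Cx_arx H0)).
have H2 := Cx_drop 2 H0.
apply: (@Bx_all _ _ (fun x k s c => (nth 0 s 0 < c) ==>
  (argx x (nth 0 (drop 2 s) 0) (nth 0 s 0) != argx x (nth 0 (drop 2 s) 0) c))
  (@small_arx (fun x k s => nth 0 (drop 2 s) 0)) (Cx_arx H2)).
have H4 := Cx_drop 2 H2.
apply: (Bx_imp (Bx_leq (Cx_succ H2) H0) _).
exact: Bx_not (Bx_eq (Cx_argx H4 H2) (Cx_argx H4 H0)).
Qed.

End Reduction.

(** * Hardness *)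

Lemma enum_sorted_set n sl : sorted ltn sl -> all (fun i => i < n) sl ->
  [seq val i | i <- enum [set i : 'I_n | val i \in sl]] = sl.
Proof.
move=> ss /allP sn; have E : [seq val i | i <- enum [set i : 'I_n | val i \in sl]] =
    [seq i <- iota 0 n | i \in sl].
  rewrite -val_enum_ord filter_map; congr map.
  by rewrite enumT; apply: eq_filter => i; rewrite /= inE.
rewrite E; apply: (irr_sorted_eq (leT := ltn)) => //; first exact: ltn_trans.
- by move=> i; exact: ltnn.
- by apply: sorted_filter (iota_ltn_sorted 0 n); exact: ltn_trans.
move=> i; rewrite mem_filter mem_iota /=; case: (boolP (i \in sl)) => //= /sn.
by rewrite add0n.
Qed.

Lemma sorted_enum_set n (S : {set 'I_n}) : sorted ltn [seq val i | i <- enum S].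
Proof.
apply: (subseq_sorted ltn_trans) (iota_ltn_sorted 0 n).
by rewrite -val_enum_ord enumT; apply/map_subseq/filter_subseq.
Qed.

Lemma is_inputE (C : circuit) (i : 'I_(size C)) :
  is_input C i = (kind (nth GIn C i) == 0).
Proof. by rewrite /is_input (set_nth_default GIn) //; case: (nth _ _ _). Qed.

Section Hardness.

Variable d : nat.

Let L := d.+1.
Let q := 2 ^ L.

(** A set of [k] inputs is represented by its increasing enumeration, the form in which the system
    delivers it. *)
Lemma WCS_valid x k : WCS 1 d x k <-> valid x d /\ exists sl,
  [/\ sorted ltn sl, all (fun i => (i < nnodes x) && (tyx x i == 0)) sl, size sl = k &
      node_val (tyx x) (arx x) (argx x) L sl (nnodes x).-1].
Proof.
split=> [[C [Cwf Cw Cd xE [S [Si Sk Sv]]]]|[vx [sl [ss si sk sv]]]].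
  have vx : valid x d by apply/validP; exists C.
  have rC := encoded_reads xE; have nE := reads_nn rC.
  split=> //; exists [seq val i | i <- enum S]; split.
  - exact: sorted_enum_set.
  - apply/allP => j /mapP[i]; rewrite mem_enum => iS ->.
    rewrite nE ltn_ord (reads_ty rC) //=.
    by have := Si i iS; rewrite is_inputE.
  - by rewrite size_map -cardE.
  rewrite nE -(circuit_eval_val Cwf rC) //.
  by rewrite -(depth_dle Cwf rC) ltnW.
have [xE wf rC] := decoded_reads vx; have nE := reads_nn rC.
have := vx; rewrite /valid nE => /and5P[_ _ _ _ /andP[Hd Hw]].
exists (decoded x); split=> //; first by rewrite (weft_weft1 wf rC Hd).
  by rewrite (depth_dle wf rC).
have sE : [seq val i | i <- enum [set i : 'I_(size (decoded x)) | val i \in sl]] = sl.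
  by apply: enum_sorted_set => //; apply: sub_all si => i /andP[]; rewrite nE.
exists [set i : 'I_(size (decoded x)) | val i \in sl]; split.
- move=> i; rewrite inE => /(allP si)/andP[_]; by rewrite (reads_ty rC (ltn_ord i)) is_inputE.
- by rewrite cardE -(size_map val) sE.
rewrite /image_mem sE (circuit_eval_val wf rC (f := L)) -?nE //.
by rewrite nE; apply: dle_mono Hd.
Qed.

Definition sys_weight x k i c :=
  item_weightx L x k (nth [::] (vecs (RI L x k)) i) (nth [::] (vecs (RC L x k)) c).

Definition sys_goal x k c := col_goalx L x k (nth [::] (vecs (RC L x k)) c).

Section System.

Variables (x : seq nat) (k : nat).
Hypothesis vx : valid x d.

Let n := nnodes x.
Let I := volume (RI L x k).
Let J := volume (RC L x k).
Let w := sys_weight x k.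
Let g := sys_goal x k.

(** The length [(size flips).*2 + 3] of the longest sequence used, for [u] chosen items, one per
    row, and [q.+1 * u] columns. *)
Definition flip_bound (k : nat) : nat :=
  let u := 2 * k.+1 ^ q in (u + u * (q.+1 * u) + q.+1 * u + 1).*2 + 3.

Let exactv := exact_vecs n k L (tyx x) (arx x) (argx x).

Lemma exact_sum_vecs X : exact_sum I J w g X -> exactv (fun t => X (rank (RI L x k) t)).
Proof.
move=> HX c cin; have cJ : rank (RC L x k) c < J.
  have : rank (RC L x k) c \in [seq rank (RC L x k) t | t <- vecs (RC L x k)] by apply: map_f.
  by rewrite map_rank_vecs mem_iota.
have := HX _ cJ; rewrite /w /g /sys_weight /sys_goal nth_rank // => E.
rewrite -[RHS]/(col_goalx L x k c) -E.
rewrite -[LHS](sum_vecs (RI L x k) (fun t => X (rank (RI L x k) t))).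
rewrite big_seq_cond [RHS]big_seq_cond; apply: eq_bigl => i.
by rewrite mem_iota /=; case: ltnP => //= iI; rewrite rank_nth.
Qed.

Lemma vecs_exact_sum P : exactv P -> exact_sum I J w g (fun i => P (nth [::] (vecs (RI L x k)) i)).
Proof.
move=> HP c cJ; apply: etrans (HP (nth [::] (vecs (RC L x k)) c) _).
  exact: (sum_vecs (RI L x k) P).
by rewrite mem_nth // size_vecs.
Qed.

Lemma valid_parts : [/\ 0 < n, forall i, i < n -> node_ok n (tyx x) (arx x) (argx x) i,
  dle (tyx x) (arx x) (argx x) L n.-1 & weft1 (arx x) (argx x) L n.-1].
Proof.
have [xE wf rC] := decoded_reads vx; have nE := reads_nn rC.
have := vx; rewrite /valid -/n => /and5P[n0 _ _ _ /andP[Hd Hw]].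
have HL : dle (tyx x) (arx x) (argx x) L n.-1 by apply: dle_mono Hd.
split=> //; first by rewrite /n nE; exact: nodes_ok.
rewrite /n nE in Hd Hw HL *.
by rewrite -(weft_weft1 wf rC HL) (weft_weft1 wf rC Hd).
Qed.

Lemma solvable_exact : (exists ch, solves n k L (tyx x) (arx x) (argx x) ch) ->
  exists X, exact_sum I J w g X /\
    (count X (iota 0 I) + count X (iota 0 I) * J + J + 1).*2 + 3 <= flip_bound k.
Proof.
move=> [ch /exact_vecs_complete[HP cP]].
set P := (fun t : seq nat => _) in HP cP.
exists (fun i => P (nth [::] (vecs (RI L x k)) i)); split; first exact: vecs_exact_sum.
have -> : count (fun i => P (nth [::] (vecs (RI L x k)) i)) (iota 0 I) = 2 * k.+1 ^ q.
  by rewrite -cP -!sum1_count (sum_vecs (RI L x k) P (fun=> 1)).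
by rewrite /flip_bound /J /= volume_nseq.
Qed.

Lemma exact_solvable X : exact_sum I J w g X ->
  exists ch, solves n k L (tyx x) (arx x) (argx x) ch.
Proof.
have [n0 _ Hd Hw] := valid_parts.
by move=> /exact_sum_vecs; apply: exact_vecs_sound.
Qed.

Lemma exact_WCS : (exists X, exact_sum I J w g X) <-> WCS 1 d x k.
Proof.
have [n0 Hn Hd Hw] := valid_parts; split=> [[X /exact_solvable[ch Hch]]|].
  by apply/WCS_valid; split=> //; apply: solves_sound Hch.
move=> /WCS_valid[_ [sl [ss si sk sv]]].
have [X [HX _]] := solvable_exact (solves_complete Hn n0 (ltn0Sn d : 0 < L) Hd Hw ss si sk sv).
by exists X.
Qed.

(** The exact sum is turned into a solution of the system and back, and the sum obtained is known to
    have one item per row. *)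
Lemma exact_bounded X : exact_sum I J w g X -> exists X, exact_sum I J w g X /\
  (count X (iota 0 I) + count X (iota 0 I) * J + J + 1).*2 + 3 <= flip_bound k.
Proof. by move=> /exact_solvable; exact: solvable_exact. Qed.

Lemma weights_gt0 i c : i < I -> c < J -> 0 < w i c.
Proof. by []. Qed.

Lemma goals_gt0 c : c < J -> 0 < g c.
Proof. by move=> _; rewrite /g /sys_goal /col_goalx /col_goal ltn_addl // muln_gt0 expn_gt0. Qed.

Lemma volume_RC_gt0 : 0 < J.
Proof. by rewrite /J /= volume_nseq !muln_gt0 expn_gt0. Qed.

Lemma c2e_word_WCS :
  (C2E_NCL (c2e_word I J w g) (flip_bound k) <-> WCS 1 d x k) /\
  (bounded_C2E_NCL (c2e_word I J w g) (flip_bound k) <-> WCS 1 d x k).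
Proof.
rewrite -exact_WCS.
exact: (c2e_word_correct weights_gt0 goals_gt0 volume_RC_gt0 exact_bounded).
Qed.

Lemma c2c_word_WCS : C2C_NCL (c2c_word I J w g) (flip_bound k) <-> WCS 1 d x k.
Proof.
rewrite -exact_WCS.
exact: (c2c_word_correct weights_gt0 goals_gt0 volume_RC_gt0 exact_bounded).
Qed.

End System.

Let beta := q.+2.

Definition zeros x k : seq nat :=
  nseq (volume (RI L x k)) 0 ++ nseq (volume (RI L x k ++ RC L x k)) 0 ++
  nseq (volume (RC L x k)) 0.

Definition c2e_image x k : seq nat :=
  wordx L x k ++
  volume (RI L x k) + volume (RI L x k ++ RC L x k) + volume (RC L x k) ::
  zeros x k ++ [:: 0; 0; 0; 0].

Definition c2c_image x k : seq nat :=
  wordx L x k ++ (zeros x k ++ [:: 0; 0; 0; 0]) ++ zeros x k ++ [:: 0; 1; 1; 1].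

Lemma Sx_zeros_all : Sx beta (fun x k s => zeros x k).
Proof.
have zI := Sx_zeros (@small_RI L) (Lx_RI L).
have zC := Sx_zeros (@small_RC L) (Lx_RC L).
have zIC := Sx_zeros (small_cat (@small_RI L) (@small_RC L)) (Lx_cat (Lx_RI L) (Lx_RC L)).
exact: Sx_cat zI (Sx_cat zIC zC).
Qed.

Lemma Sx_four a b c e : Sx beta (fun x k s => [:: a; b; c; e]).
Proof. by do 4![apply: (Sx_cons (Cx_cst beta _))]; exact: Sx_nil. Qed.

Lemma Sx_c2e : Sx beta (fun x k s => if valid x d then c2e_image x k else [::]).
Proof.
apply: Sx_valid; apply: (Sx_cat (Sx_word L)).
have HI := Cx_volume (@small_RI L) (Lx_RI L).
have HJ := Cx_volume (@small_RC L) (Lx_RC L).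
have HIJ := Cx_volume (small_cat (@small_RI L) (@small_RC L))
  (Lx_cat (Lx_RI L) (Lx_RC L)).
apply: (Sx_cons (Cx_add (Cx_add HI HIJ) HJ)).
exact: Sx_cat Sx_zeros_all (Sx_four _ _ _ _).
Qed.

Lemma Sx_c2c : Sx beta (fun x k s => if valid x d then c2c_image x k else [::]).
Proof.
apply: Sx_valid; apply: (Sx_cat (Sx_word L)).
apply: (Sx_cat (Sx_cat Sx_zeros_all (Sx_four _ _ _ _))).
exact: Sx_cat Sx_zeros_all (Sx_four _ _ _ _).
Qed.

Lemma Cx_flip_bound : Cx beta (fun x k s => flip_bound k).
Proof.
have Hu := Cx_rows L; have Hqu := Cx_mulc q.+1 Hu.
have Huqu := Cx_mulc 2 (Cx_pow q Hqu).
have H := Cx_add (Cx_add (Cx_add Hu Huqu) Hqu) (Cx_cst beta 1).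
have [e He] := Cx_add (Cx_add H H) (Cx_cst beta 3).
by exists e => x k s; rewrite He /flip_bound -/q addnn !mulnA.
Qed.

Lemma flip_bound_poly k : flip_bound k <= (12 * q.+1 + 9) * (k + 1) ^ (q * 2).
Proof.
rewrite addn1 expnM /flip_bound; set v := k.+1 ^ q.
have v0 : 0 < v by rewrite expn_gt0.
have v2 : v <= v ^ 2 by rewrite -{1}[v]expn1 leq_pexp2l.
have E : 2 * v * (q.+1 * (2 * v)) = 4 * (q.+1 * v ^ 2) by rewrite -mulnn; nia.
have F : q.+1 * v <= q.+1 * v ^ 2 by rewrite leq_mul2l v2 orbT.
rewrite E mulnDl -mulnA; have : q.+1 * (2 * v) = 2 * (q.+1 * v) by rewrite mulnCA.
lia.
Qed.

Lemma nseq3 a b c e :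
  nseq (a + b + c + e) 0 = nseq a 0 ++ nseq b 0 ++ nseq c 0 ++ nseq e 0.
Proof. by rewrite !nseqD -!catA. Qed.

Lemma c2e_imageE x k : c2e_image x k =
  c2e_word (volume (RI L x k)) (volume (RC L x k)) (sys_weight x k) (sys_goal x k).
Proof.
rewrite /c2e_word gadget_word_vec -volume_cat nseq3.
by rewrite /c2e_image /zeros -!(catA (nseq _ _)).
Qed.

Lemma c2c_imageE x k : c2c_image x k =
  c2c_word (volume (RI L x k)) (volume (RC L x k)) (sys_weight x k) (sys_goal x k).
Proof.
rewrite /c2c_word gadget_word_vec -volume_cat !nseq3.
by rewrite /c2c_image /zeros -!(catA (nseq _ _)).
Qed.

(** The given reduction may produce words that encode no circuit of the class; these go to the empty
    word, a negative instance of [Q]. *)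
Lemma fpt_reduces_image P Q (F : seq nat -> nat -> seq nat) :
  Sx beta (fun x k s => if valid x d then F x k else [::]) ->
  (forall x k, valid x d -> Q (F x k) (flip_bound k) <-> WCS 1 d x k) ->
  (forall l, ~ Q [::] l) ->
  fpt_reduces P (WCS 1 d) -> fpt_reduces P Q.
Proof.
move=> [S HS] HQ Q0; have [e He] := Cx_flip_bound.
apply: (@fpt_reduces_stm beta S e (12 * q.+1 + 9) 1 (q * 2)) => x k; last first.
  by rewrite He flip_bound_poly.
rewrite HS He; case: (boolP (valid x d)) => vx; first by rewrite HQ.
by split=> [/WCS_valid[H]|/Q0 //]; rewrite H in vx.
Qed.

End Hardness.

Theorem theorem13 :
  [/\ W_hard 1 C2E_NCL, W_hard 1 C2C_NCL & W_hard 1 bounded_C2E_NCL].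
Proof.
split=> P [d]; apply: fpt_reduces_image.
- exact: Sx_c2e.
- by move=> x k vx; rewrite c2e_imageE; have [] := c2e_word_WCS k vx.
- by move=> l [G [e [C1 []]]].
- exact: Sx_c2c.
- by move=> x k vx; rewrite c2c_imageE; exact: c2c_word_WCS.
- by move=> l [G [C1 [C2 []]]].
- exact: Sx_c2e.
- by move=> x k vx; rewrite c2e_imageE; have [] := c2e_word_WCS k vx.
- by move=> l [G [e [C1 []]]].
Qed.
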